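(* For a caterpillar $G$ it can be decided in linear time whether $G$ is a unit disk contact graph, where arbitrary embeddings are allowed. Moreover, if $G$ is a unit disk contact graph, a unit disk contact representation of $G$ can be constructed in linear time (on a Real RAM).
   Context: A caterpillar is a tree for which a path remains after removing all leaves. A disk contact representation of a graph $G=(V,E)$ is a set of interior-disjoint closed disks in the plane together with a bijection between $V$ and the disks such that two disks touch if and only if the corresponding vertices are adjacent. A graph is a unit disk contact graph (UDC graph) if it has a disk contact representation in which all disks have the same radius; such a representation is a unit disk contact representation. ''Arbitrary embeddings allowed'' means the representation need not induce any prescribed planar embedding. The Real RAM model assumes that basic arithmetic operations, including square roots and trigonometric functions, on real numbers take constant time. *)

(* Defs.v *)
From Stdlib Require Import Reals ZArith List Arith Lia.
Import ListNotations.
Open Scope R_scope.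

(* A graph on vertex set {0,...,n-1} with edge list E (undirected). *)
Definition adj (E : list (nat * nat)) (u v : nat) : Prop :=
  In (u, v) E \/ In (v, u) E.

Definition valid_input (n : nat) (E : list (nat * nat)) : Prop :=
  NoDup E /\
  (forall u v, In (u, v) E -> (u < n)%nat /\ (v < n)%nat /\ u <> v /\ ~ In (v, u) E).

Fixpoint walk_from (E : list (nat * nat)) (x : nat) (p : list nat) : Prop :=
  match p with
  | [] => True
  | y :: p' => adj E x y /\ walk_from E y p'
  end.

Definition connected (n : nat) (E : list (nat * nat)) : Prop :=
  forall u v, (u < n)%nat -> (v < n)%nat ->
    exists p, walk_from E u p /\ last p u = v.

Definition has_cycle (E : list (nat * nat)) : Prop :=
  exists x p, (2 <= length p)%nat /\ NoDup (x :: p) /\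
    walk_from E x p /\ adj E (last p x) x.

Definition is_tree (n : nat) (E : list (nat * nat)) : Prop :=
  (1 <= n)%nat /\ connected n E /\ ~ has_cycle E.

Definition is_leaf (n : nat) (E : list (nat * nat)) (v : nat) : Prop :=
  exists u, (u < n)%nat /\ adj E u v /\ forall w, adj E w v -> w = u.

(* Caterpillar: a tree such that removing all leaves leaves a path
   (the remaining vertex set can be listed as p with adjacency among them
   being exactly consecutiveness in p; the empty graph counts as a path). *)
Definition consecutive (p : list nat) (u v : nat) : Prop :=
  exists i, (nth_error p i = Some u /\ nth_error p (S i) = Some v) \/
            (nth_error p i = Some v /\ nth_error p (S i) = Some u).

Definition caterpillar (n : nat) (E : list (nat * nat)) : Prop :=
  is_tree n E /\
  exists p : list nat, NoDup p /\
    (forall v, In v p <-> ((v < n)%nat /\ ~ is_leaf n E v)) /\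
    (forall u v, In u p -> In v p -> (adj E u v <-> consecutive p u v)).

Definition sqdist (a b : R * R) : R :=
  (fst a - fst b) ^ 2 + (snd a - snd b) ^ 2.

(* closed disks of radius r centred at c v (v < n): pairwise interior-disjoint,
   touching iff adjacent.  (Distinct centres follow, so the map is a bijection.) *)
Definition udc_rep (n : nat) (E : list (nat * nat)) (r : R) (c : nat -> R * R) : Prop :=
  0 < r /\
  forall u v, (u < n)%nat -> (v < n)%nat -> u <> v ->
    (2 * r) ^ 2 <= sqdist (c u) (c v) /\
    (sqdist (c u) (c v) = (2 * r) ^ 2 <-> adj E u v).

Definition UDC (n : nat) (E : list (nat * nat)) : Prop :=
  exists r c, udc_rep n E r c.

(* Integer registers I[.] (Z) and real registers R[.] (R), unit cost per
   instruction; indirect addressing through integer registers. *)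
Inductive instr : Type :=
| IConst (d : nat) (z : Z)
| IAdd (d a b : nat)
| ISub (d a b : nat)
| ILoad (d a : nat)
| IStore (a s : nat)
| RConst (d : nat) (z : Z) (q : positive)
| RAdd (d a b : nat) | RSub (d a b : nat) | RMul (d a b : nat) | RDiv (d a b : nat)
| RSqrt (d a : nat) | RSin (d a : nat) | RCos (d a : nat) | RAtan (d a : nat)
| RLoad (d a : nat)
| RStore (a s : nat)
| RofI (d a : nat)
| Jmp (l : nat)
| JZ (a l : nat)
| JLt (a b l : nat)
| RJLt (a b l : nat)
| Halt.

Definition program := list instr.

Record cfg : Type := Cfg { pc : nat; ireg : nat -> Z; rreg : nat -> R }.

Definition upd {A : Type} (f : nat -> A) (i : nat) (x : A) : nat -> A :=
  fun j => if Nat.eqb j i then x else f j.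

Definition exec (ins : instr) (c : cfg) : cfg :=
  let I := ireg c in let Rg := rreg c in let nx := S (pc c) in
  match ins with
  | IConst d z => Cfg nx (upd I d z) Rg
  | IAdd d a b => Cfg nx (upd I d (I a + I b)%Z) Rg
  | ISub d a b => Cfg nx (upd I d (I a - I b)%Z) Rg
  | ILoad d a => Cfg nx (upd I d (I (Z.to_nat (I a)))) Rg
  | IStore a s => Cfg nx (upd I (Z.to_nat (I a)) (I s)) Rg
  | RConst d z q => Cfg nx I (upd Rg d (IZR z / IZR (Zpos q)))
  | RAdd d a b => Cfg nx I (upd Rg d (Rg a + Rg b))
  | RSub d a b => Cfg nx I (upd Rg d (Rg a - Rg b))
  | RMul d a b => Cfg nx I (upd Rg d (Rg a * Rg b))
  | RDiv d a b => Cfg nx I (upd Rg d (Rg a / Rg b))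
  | RSqrt d a => Cfg nx I (upd Rg d (sqrt (Rg a)))
  | RSin d a => Cfg nx I (upd Rg d (sin (Rg a)))
  | RCos d a => Cfg nx I (upd Rg d (cos (Rg a)))
  | RAtan d a => Cfg nx I (upd Rg d (atan (Rg a)))
  | RLoad d a => Cfg nx I (upd Rg d (Rg (Z.to_nat (I a))))
  | RStore a s => Cfg nx I (upd Rg (Z.to_nat (I a)) (Rg s))
  | RofI d a => Cfg nx I (upd Rg d (IZR (I a)))
  | Jmp l => Cfg l I Rg
  | JZ a l => Cfg (if Z.eqb (I a) 0 then l else nx) I Rg
  | JLt a b l => Cfg (if Z.ltb (I a) (I b) then l else nx) I Rg
  | RJLt a b l => Cfg (if Rlt_dec (Rg a) (Rg b) then l else nx) I Rg
  | Halt => c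
  end.

Definition step (P : program) (c : cfg) : option cfg :=
  match nth_error P (pc c) with
  | None => None
  | Some Halt => None
  | Some ins => Some (exec ins c)
  end.

Fixpoint steps (P : program) (k : nat) (c : cfg) : option cfg :=
  match k with
  | O => Some c
  | S k' => match step P c with Some c' => steps P k' c' | None => None end
  end.

Definition halts_in (P : program) (k : nat) (c c' : cfg) : Prop :=
  steps P k c = Some c' /\ step P c' = None.

(* Input convention: I[0] = n, I[1] = |E|, I[2+2j], I[3+2j] = endpoints of the
   j-th edge; every other register is 0. *)
Definition init_cfg (n : nat) (E : list (nat * nat)) : cfg :=
  Cfg 0
    (fun i => match i with
              | O => Z.of_nat n
              | 1 => Z.of_nat (length E)
              | S (S j) => match nth_error E (Nat.div2 j) with
                           | Some (u, v) => Z.of_nat (if Nat.even j then u else v)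
                           | None => 0%Z
                           end
              end)
    (fun _ => 0).

Definition out_yes (c : cfg) : Prop := ireg c 0 = 1%Z.
Definition out_radius (c : cfg) : R := rreg c 0.
Definition out_center (c : cfg) (v : nat) : R * R :=
  (rreg c (1 + 2 * v), rreg c (2 + 2 * v)).

(* Main.v *)
Require Import Defs.
From Stdlib Require Import Reals ZArith List Arith.
From Stdlib Require Import Lra Psatz Lia Bool Permutation.
Import ListNotations.

(* Let v_1, ..., v_K be the non-leaves, in the order of the path that they form. The caterpillar is a
   unit disk contact graph if and only if all degrees are at most 5 and any two vertices of degree 5
   are separated by a vertex of degree at most 3 on this path.

   Necessity. A disk has room for at most five pairwise separated neighbours. Walk along the path
   and record, on each side of the current edge, which angles are no longer available to the
   neighbours of the next vertex because of the disks already placed. A vertex of degree 5 leaves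
   blocked angles whose sum over the two sides exceeds pi/3; a vertex of degree 4 cannot decrease
   this sum, since rolling a blocking disk along an edge shows that blocked positions are inherited;
   and a further vertex of degree 5 does not fit.

   Sufficiency. Bend the path very slightly, by 1/(10n) per vertex. Then every path vertex has room
   for one disk below it, and every path edge has room for one disk in the notch above it, attached
   to either end of the edge. Degree 5 uses both notches of a vertex and degree 4 one of them, so
   that the assignment of notches is decided by a two-state automaton running along the path. *)

(** Only the sum of the two blocked arcs is invariant: a turn of the path at a vertex of degree 4
    can make either arc alone shrink. The threshold pi/3 is critical. Neighbours of a vertex are
    pairwise non-adjacent, hence separated by angles strictly above pi/3, and at a vertex of degree
    5 the four neighbours other than a given one spread over more than pi. At the first such vertex
    this blocks more than pi - 2pi/3; at the second, a blocked sum above pi/3 leaves a window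
    narrower than pi.

    A straight path cannot be decorated in this way, since disks in adjacent notches, or below
    adjacent vertices, would touch or overlap. The bend has to separate the disks on both sides at
    once, which explains the direction chosen for the lower ones.

    The automaton is greedy and never revises a choice. Nothing is lost, because each refusal
    exhibits a degree above 5 or two vertices of degree 5 with only degree 4 between them, which are
    the obstructions of the necessity part.

    The edges come in arbitrary order; the order of the path is recovered in linear time from
    degrees and sums of neighbours, without adjacency lists. *)

Local Notation graph := (list (nat * nat)).

(** * Geometry of a tight path *)

(* With C = cos(u/2) and S = sin(u/2), the three hypotheses say that a point lies outside the unit
   disks around 0 and e^(iu) and inside the one around e^(i pi/3). The x-axis is the line through
   e^(2i pi/3), e^(i(pi/3+u)) and e^(iu) + e^(i pi/3), and the middle one of them is the origin. *)
Lemma pocket_core (k C S x y : R) :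
  0 < k -> k ^ 2 = 3 -> C ^ 2 + S ^ 2 = 1 -> 0 <= S -> k * S < C ->
  0 <= x ^ 2 + y ^ 2 + (C - k * S) * x + (k * C + S) * y ->
  0 <= x ^ 2 + y ^ 2 - (C + k * S) * x + (k * C - S) * y ->
  x ^ 2 + y ^ 2 - 2 * k * S * x - (C - k * S) * (C + k * S) + 2 * S * y <= 0 ->
  0 <= y.
Proof.
  intros Hk Hk2 HCS HS Hc H0 Hs H60.
  destruct (Rle_dec 0 y) as [|Hy]; [assumption | exfalso].
  apply Rnot_le_lt in Hy.
  assert (Ee : exists e, y = - e /\ 0 < e) by (exists (- y); lra).
  destruct Ee as (e & -> & He). clear Hy.
  assert (HC : 0 < C) by nra.
  assert (Hk1 : 1 < k) by nra.
  assert (Hk2' : k < 2) by nra.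
  assert (HkS : (k * S) * (k * S) < C * C) by (assert (0 <= k * S) by nra; nra).
  assert (HSC : S < 1/2) by nra.
  set (c := C - k * S) in *. set (a := C + k * S) in *.
  assert (Hcp : 0 < c) by (unfold c; lra).
  assert (Hap : 0 < a) by (unfold a; nra).
  assert (E1 : k * C - S - 2 * S = k * c) by (unfold c; ring_simplify; rewrite Hk2; ring).
  assert (E2 : a - c = 2 * k * S) by (unfold a, c; ring).
  assert (Hks : 1 <= k * C - S) by nra.
  assert (Hk0 : k <= k * C + S) by nra.
  assert (Ha : a <= k) by (unfold a; nra).
  (* The three circles cut the x-axis only at -c, 0 and a, and x is located among these points.
     Subtracting one of the first two inequalities from the third leaves a linear relation between x
     and e, which is absurd outside [-c, a] and bounds e too tightly inside. *)
  destruct (Rlt_dec a x) as [Hx | Hx].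
  { assert (0 < c * (x - a)) by nra. nra. }
  destruct (Rlt_dec 0 x) as [Hx0 | Hx0].
  { assert (Q1 : k * c * e <= c * (a - x)) by nra.
    assert (Q2 : k * e <= a - x) by nra.
    assert (e < k * C - S -> False) by (intro; nra).
    nra. }
  destruct (Rlt_dec x (- c)) as [Hx1 | Hx1].
  { assert (0 < a * (- (x + c))) by nra. nra. }
  assert (Q : e * (k * C - S) <= a * (x + c)) by nra.
  assert (Q3 : k * C + S <= e) by nra.
  assert (Q4 : (k * C + S) * (k * C - S) <= a * c) by nra.
  unfold a, c in Q4. nra.
Qed.

(** In the rotated frame the disk of the conclusion is the mirror image, in the x-axis of
    [pocket_core], of the disk in the last hypothesis: the two equations differ only in the sign of
    [2 * S * y]. A point of one disk with [0 <= y] therefore lies in the other. *)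
Lemma pocket_poly (k C S X Y : R) :
  0 < k -> k ^ 2 = 3 -> C ^ 2 + S ^ 2 = 1 -> 0 <= S -> k * S < C ->
  1 <= X ^ 2 + Y ^ 2 -> 1 <= (X - 1) ^ 2 + Y ^ 2 ->
  (X - ((C ^ 2 - S ^ 2) / 2 + k * S * C)) ^ 2 + (Y - (k * (C ^ 2 - S ^ 2) / 2 - S * C)) ^ 2 <= 1 ->
  (X - 1 - (- (C ^ 2 - S ^ 2) / 2 + k * S * C)) ^ 2 + (Y - (k * (C ^ 2 - S ^ 2) / 2 + S * C)) ^ 2 <= 1.
Proof.
  intros Hk Hk2 HCS HS Hc H0 Hs H60.
  (* Rotation by the half angle u/2 about the point (1/2, k/2), which is e^(i pi/3). *)
  pose (x := (X - 1/2) * C - (Y - k/2) * S).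
  pose (y := (X - 1/2) * S + (Y - k/2) * C).
  assert (EX : X = 1/2 + x * C + y * S).
  { transitivity (1/2 + (X - 1/2) * (C ^ 2 + S ^ 2)); [rewrite HCS | unfold x, y]; field. }
  assert (EY : Y = k/2 - x * S + y * C).
  { transitivity (k/2 + (Y - k/2) * (C ^ 2 + S ^ 2)); [rewrite HCS | unfold x, y]; field. }
  clearbody x y. subst X Y.
  assert (E0 : (1/2 + x * C + y * S) ^ 2 + (k/2 - x * S + y * C) ^ 2 - 1 =
     x ^ 2 + y ^ 2 + (C - k * S) * x + (k * C + S) * y).
  { transitivity ((1 + k ^ 2) / 4 + (x ^ 2 + y ^ 2) * (C ^ 2 + S ^ 2)
       + (C - k * S) * x + (k * C + S) * y - 1); [field | rewrite HCS, Hk2; field]. }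
  assert (E1 : (1/2 + x * C + y * S - 1) ^ 2 + (k/2 - x * S + y * C) ^ 2 - 1 =
     x ^ 2 + y ^ 2 - (C + k * S) * x + (k * C - S) * y).
  { transitivity ((1 + k ^ 2) / 4 + (x ^ 2 + y ^ 2) * (C ^ 2 + S ^ 2)
       - (C + k * S) * x + (k * C - S) * y - 1); [field | rewrite HCS, Hk2; field]. }
  assert (F : forall t1 t2,
    (1/2 + x * C + y * S - t1) ^ 2 + (k/2 - x * S + y * C - t2) ^ 2 =
    ((C ^ 2 + S ^ 2)/2 + x * C + y * S - t1) ^ 2 + (k * (C ^ 2 + S ^ 2)/2 - x * S + y * C - t2) ^ 2).
  { intros. rewrite HCS. field. }
  assert (E2 : (1/2 + x * C + y * S - ((C ^ 2 - S ^ 2) / 2 + k * S * C)) ^ 2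
     + (k/2 - x * S + y * C - (k * (C ^ 2 - S ^ 2) / 2 - S * C)) ^ 2 - 1 =
     x ^ 2 + y ^ 2 - 2 * k * S * x - (C - k * S) * (C + k * S) + 2 * S * y).
  { rewrite F. transitivity (S ^ 2 * (1 + k ^ 2) * (C ^ 2 + S ^ 2) + (x ^ 2 + y ^ 2) * (C ^ 2 + S ^ 2)
      + 2 * S * (y - k * x) * (C ^ 2 + S ^ 2) - 1); [field |].
    rewrite HCS. replace (1 + k ^ 2) with 4 by lra.
    transitivity (4 * S ^ 2 + x ^ 2 + y ^ 2 + 2 * S * (y - k * x) - (C ^ 2 + S ^ 2)); [rewrite HCS; field |].
    transitivity (x ^ 2 + y ^ 2 - 2 * k * S * x - C ^ 2 + 3 * S ^ 2 + 2 * S * y); [field |].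
    rewrite <- Hk2. field. }
  assert (Hy : 0 <= y) by (apply (pocket_core k C S x y); auto; lra).
  assert (HSy : 0 <= S * y) by nra.
  assert (E3 : (1/2 + x * C + y * S - 1 - (- (C ^ 2 - S ^ 2) / 2 + k * S * C)) ^ 2
     + (k/2 - x * S + y * C - (k * (C ^ 2 - S ^ 2) / 2 + S * C)) ^ 2 - 1 =
     x ^ 2 + y ^ 2 - 2 * k * S * x - (C - k * S) * (C + k * S) - 2 * S * y).
  { replace (1/2 + x * C + y * S - 1 - (- (C ^ 2 - S ^ 2) / 2 + k * S * C))
      with (1/2 + x * C + y * S - (1 - (C ^ 2 - S ^ 2) / 2 + k * S * C)) by field.
    rewrite F.
    replace (1 - (C ^ 2 - S ^ 2) / 2 + k * S * C)
      with ((C ^ 2 + S ^ 2) - (C ^ 2 - S ^ 2) / 2 + k * S * C) by (rewrite HCS; field).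
    transitivity (S ^ 2 * (1 + k ^ 2) * (C ^ 2 + S ^ 2) + (x ^ 2 + y ^ 2) * (C ^ 2 + S ^ 2)
      - 2 * S * (y + k * x) * (C ^ 2 + S ^ 2) - 1); [field |].
    rewrite HCS. replace (1 + k ^ 2) with 4 by lra.
    transitivity (4 * S ^ 2 + x ^ 2 + y ^ 2 - 2 * S * (y + k * x) - (C ^ 2 + S ^ 2)); [rewrite HCS; field |].
    transitivity (x ^ 2 + y ^ 2 - 2 * k * S * x - C ^ 2 + 3 * S ^ 2 - 2 * S * y); [field |].
    rewrite <- Hk2. field. }
  lra.
Qed.

(** * Angles around a disk centre and blocked arcs *)

(** For a unit vector [d], the centre of a disk touching the one at [v], in the direction [d] turned
    by [a]: counterclockwise for [t = 1], clockwise for [t = -1]. The sign lets one proof serve both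
    sides of the path. *)
Definition pt (v d : R * R) (t a : R) : R * R :=
  (fst v + fst d * cos a - t * snd d * sin a, snd v + snd d * cos a + t * fst d * sin a).

Definition dir (v w : R * R) : R * R := (fst w - fst v, snd w - snd v).

Definition unitv (d : R * R) : Prop := fst d ^ 2 + snd d ^ 2 = 1.

Lemma sqdist_sym (a b : R * R) : sqdist a b = sqdist b a.
Proof. unfold sqdist. ring. Qed.

Lemma unitv_dir (v w : R * R) : sqdist v w = 1 -> unitv (dir v w).
Proof. unfold sqdist, unitv, dir; simpl fst; simpl snd. intros H. rewrite <- H. ring. Qed.

Lemma pt_dir (v w : R * R) (t : R) : pt v (dir v w) t 0 = w.
Proof. unfold pt, dir; destruct v, w; simpl. rewrite cos_0, sin_0. f_equal; ring. Qed.

Lemma pt_opp (v d : R * R) (t a : R) : pt v d (- t) a = pt v d t (- a).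
Proof. unfold pt. rewrite cos_neg, sin_neg. f_equal; ring. Qed.

Lemma pt_2PI (v d : R * R) (t a : R) : pt v d t (a + 2 * PI) = pt v d t a.
Proof. unfold pt. now rewrite cos_plus, sin_plus, cos_2PI, sin_2PI; f_equal; ring. Qed.

Lemma pt_back (v w : R * R) (t : R) : pt w (dir v w) t PI = v.
Proof. unfold pt, dir; destruct v, w; simpl. rewrite cos_PI, sin_PI. f_equal; ring. Qed.

Lemma pt_turn (v w d : R * R) (t a b : R) :
  t * t = 1 -> w = pt v d t a -> pt v (dir v w) t b = pt v d t (a + b).
Proof.
  intros Ht ->. unfold pt, dir; destruct v, d; simpl. rewrite cos_plus, sin_plus.
  f_equal; ring_simplify; replace (t ^ 2) with 1 by (rewrite <- Ht; ring); ring.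
Qed.

Lemma sin2_cos2_pow (a : R) : sin a ^ 2 = 1 - cos a ^ 2.
Proof. generalize (sin2_cos2 a). unfold Rsqr. lra. Qed.

Lemma sqdist_pt (v d : R * R) (t a b : R) :
  t * t = 1 -> unitv d -> sqdist (pt v d t a) (pt v d t b) = 2 - 2 * cos (a - b).
Proof.
  unfold sqdist, pt, unitv; destruct v, d; simpl fst; simpl snd. intros Ht Hd.
  rewrite cos_minus.
  transitivity ((r1 ^ 2 + r2 ^ 2) * ((cos a - cos b) ^ 2 + t * t * (sin a - sin b) ^ 2)); [ring|].
  rewrite Hd, Ht. generalize (sin2_cos2_pow a) (sin2_cos2_pow b). intros. ring_simplify. lra.
Qed.

Lemma unit_angle (x y : R) : x ^ 2 + y ^ 2 = 1 ->
  exists a, 0 <= a < 2 * PI /\ x = cos a /\ y = sin a.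
Proof.
  intros H. assert (Hx : -1 <= x <= 1) by nra. pose proof PI_RGT_0 as HP.
  destruct (acos_bound x) as [B1 B2].
  assert (Es : sin (acos x) = Rabs y).
  { rewrite sin_acos by lra. replace (1 - Rsqr x) with (Rsqr y) by (unfold Rsqr; lra).
    apply sqrt_Rsqr_abs. }
  destruct (Rle_dec 0 y) as [Hy | Hy].
  - exists (acos x). rewrite cos_acos, Es, Rabs_right by lra. repeat split; lra.
  - destruct (Rtotal_order (acos x) 0) as [E | [E | E]]; [lra | |].
    + rewrite E, sin_0, Rabs_left in Es by lra. lra.
    + exists (2 * PI - acos x).
      rewrite cos_minus, sin_minus, cos_2PI, sin_2PI, cos_acos, Es, Rabs_left by lra.
      repeat split; lra.
Qed.

Lemma pt_exists (v d q : R * R) (t : R) : t * t = 1 -> unitv d -> sqdist v q = 1 ->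
  exists a, 0 <= a < 2 * PI /\ q = pt v d t a.
Proof.
  intros Ht Hd Hq. destruct v as [v1 v2], d as [d1 d2], q as [q1 q2].
  unfold unitv, sqdist in *; simpl fst in *; simpl snd in *.
  destruct (unit_angle ((q1 - v1) * d1 + (q2 - v2) * d2) (t * ((q2 - v2) * d1 - (q1 - v1) * d2)))
    as (a & Ha & Hc & Hs).
  { transitivity ((d1 ^ 2 + d2 ^ 2) * ((v1 - q1) ^ 2 + (v2 - q2) ^ 2)
      + (t * t - 1) * ((q2 - v2) * d1 - (q1 - v1) * d2) ^ 2); [ring|].
    rewrite Hd, Ht, Hq. ring. }
  exists a. split; [assumption|]. unfold pt; simpl. rewrite <- Hc, <- Hs. f_equal.
  - transitivity (v1 + (d1 ^ 2 + d2 ^ 2) * (q1 - v1)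
      + (1 - t * t) * d2 * ((q2 - v2) * d1 - (q1 - v1) * d2)); [rewrite Hd, Ht; ring | ring].
  - transitivity (v2 + (d1 ^ 2 + d2 ^ 2) * (q2 - v2)
      + (t * t - 1) * d1 * ((q2 - v2) * d1 - (q1 - v1) * d2)); [rewrite Hd, Ht; ring | ring].
Qed.

Lemma cos_gt_half (a : R) : Rabs a <= PI / 3 -> 1 / 2 <= cos a.
Proof.
  intros H. pose proof PI_RGT_0. rewrite <- cos_PI3.
  assert (E : cos a = cos (Rabs a)).
  { unfold Rabs. destruct (Rcase_abs a); [now rewrite cos_neg | reflexivity]. }
  rewrite E. generalize (Rabs_pos a). intros. apply cos_decr_1; lra.
Qed.

(** Angles are kept as real representatives, so closeness has to be excluded both at difference 0
    and at difference 2 PI. Centres at distance at most 1 are those whose angles differ by an amount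
    of cosine at least 1/2. *)
Lemma angle_sep (v d : R * R) (t a b : R) :
  t * t = 1 -> unitv d -> 1 < sqdist (pt v d t a) (pt v d t b) ->
  PI / 3 < Rabs (a - b) /\ PI / 3 < Rabs (Rabs (a - b) - 2 * PI).
Proof.
  intros Ht Hd. rewrite sqdist_pt by assumption. intros H. split.
  - destruct (Rlt_dec (PI / 3) (Rabs (a - b))); [assumption|].
    assert (1 / 2 <= cos (a - b)) by (apply cos_gt_half; lra). lra.
  - destruct (Rlt_dec (PI / 3) (Rabs (Rabs (a - b) - 2 * PI))) as [|N]; [assumption|].
    assert (C : 1 / 2 <= cos (Rabs (a - b) - 2 * PI)) by (apply cos_gt_half; lra).
    rewrite cos_minus, cos_2PI, sin_2PI in C.
    assert (cos (Rabs (a - b)) = cos (a - b)).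
    { unfold Rabs. destruct (Rcase_abs (a - b)); [now rewrite cos_neg | reflexivity]. }
    lra.
Qed.

Lemma pt_close (v d : R * R) (t a b : R) :
  t * t = 1 -> unitv d -> Rabs (a - b) <= PI / 3 -> sqdist (pt v d t a) (pt v d t b) <= 1.
Proof.
  intros Ht Hd H. rewrite sqdist_pt by assumption. generalize (cos_gt_half _ H). lra.
Qed.

Lemma sqdist_frame (z v d : R * R) (t a : R) : t * t = 1 -> unitv d ->
  sqdist z (pt v d t a) =
  ((fst z - fst v) * fst d + (snd z - snd v) * snd d - cos a) ^ 2 +
  (t * ((snd z - snd v) * fst d - (fst z - fst v) * snd d) - sin a) ^ 2.
Proof.
  intros Ht Hd. destruct z as [z1 z2], v as [v1 v2], d as [d1 d2].
  unfold sqdist, pt, unitv in *; simpl fst in *; simpl snd in *.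
  apply Rminus_diag_uniq.
  transitivity ((1 - (d1 ^ 2 + d2 ^ 2)) * ((z1 - v1) ^ 2 + (z2 - v2) ^ 2 - cos a ^ 2 - t * t * sin a ^ 2)
    + (t * t - 1) * (sin a ^ 2 - ((z2 - v2) * d1 - (z1 - v1) * d2) ^ 2)); [ring|].
  rewrite Hd, Ht. ring.
Qed.

(* Rolling a disk along the edge [v w]: a disk [z] that blocks a position of a neighbour of [v] also
   blocks the corresponding position of a neighbour of [w]. *)
Lemma pocket (z v w : R * R) (t u : R) :
  t * t = 1 -> sqdist v w = 1 -> 0 <= u < PI / 3 ->
  1 <= sqdist z v -> 1 <= sqdist z w ->
  sqdist z (pt v (dir v w) t (PI / 3 - u)) <= 1 ->
  sqdist z (pt w (dir v w) t (2 * (PI / 3) - u)) <= 1.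
Proof.
  intros Ht Hvw Hu Hv Hw H. assert (Hd := unitv_dir _ _ Hvw).
  set (d := dir v w) in *.
  set (X := (fst z - fst v) * fst d + (snd z - snd v) * snd d).
  set (Y := t * ((snd z - snd v) * fst d - (fst z - fst v) * snd d)).
  assert (EX : (fst z - fst w) * fst d + (snd z - snd w) * snd d = X - 1).
  { unfold X. replace 1 with (fst d ^ 2 + snd d ^ 2) by exact Hd.
    unfold d, dir; simpl. ring. }
  assert (EY : t * ((snd z - snd w) * fst d - (fst z - fst w) * snd d) = Y).
  { unfold Y, d, dir; simpl. ring. }
  assert (HK : 0 < sqrt 3) by (apply sqrt_lt_R0; lra).
  assert (HK2 : sqrt 3 ^ 2 = 3) by (apply pow2_sqrt; lra).
  pose proof PI_RGT_0 as HP.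
  assert (Hh : sin (u / 2) ^ 2 = 1 - cos (u / 2) ^ 2) by apply sin2_cos2_pow.
  assert (Eu : u = 2 * (u / 2)) by field.
  assert (Ec : cos u = cos (u / 2) ^ 2 - sin (u / 2) ^ 2).
  { rewrite Eu at 1. rewrite cos_2a. ring. }
  assert (Es : sin u = 2 * sin (u / 2) * cos (u / 2)).
  { rewrite Eu at 1. apply sin_2a. }
  assert (Hfz : sqdist z v = X ^ 2 + Y ^ 2).
  { rewrite <- (pt_back v w t) at 1. fold d. rewrite sqdist_frame, EX, EY, cos_PI, sin_PI by auto. ring. }
  assert (Hfw : sqdist z w = (X - 1) ^ 2 + Y ^ 2).
  { rewrite <- (pt_dir v w t) at 1. fold d. rewrite sqdist_frame, cos_0, sin_0 by auto.
    fold X Y. ring. }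
  rewrite sqdist_frame in H by auto. fold X Y in H.
  rewrite cos_minus, sin_minus, cos_PI3, sin_PI3, Ec, Es in H.
  rewrite sqdist_frame by auto. rewrite EX, EY.
  replace (2 * (PI / 3)) with (PI - PI / 3) by field.
  replace (PI - PI / 3 - u) with (PI - (PI / 3 + u)) by ring.
  rewrite cos_minus, sin_minus, cos_PI, sin_PI, cos_plus, sin_plus, cos_PI3, sin_PI3, Ec, Es.
  eapply Rle_trans; [| apply (pocket_poly (sqrt 3) (cos (u / 2)) (sin (u / 2)) X Y)]; try lra.
  - apply sin_ge_0; lra.
  (* The condition [k * S < C] says tan (u/2) < tan (PI/6), that is u < PI/3. *)
  - assert (Hs : sin (u / 2 - PI / 6) < 0) by (apply sin_lt_0_var; lra).
    rewrite sin_minus, cos_PI6, sin_PI6 in Hs. lra.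
Qed.

(* The side [t] of the edge direction [d] is [1] (left) or [-1] (right). On the next vertex of the
   path the blocked arc becomes a forbidden range of angles just beyond [PI/3]. *)
Definition blocked (O : R * R -> Prop) (t : R) (v d : R * R) (c : R) : Prop :=
  forall u, 0 <= u <= c -> exists x, O x /\ sqdist x (pt v d t (PI / 3 - u)) <= 1.

Lemma blocked_next (O : R * R -> Prop) (t : R) (v w : R * R) (c u : R) :
  t * t = 1 -> sqdist v w = 1 -> c < PI / 3 -> blocked O t v (dir v w) c ->
  (forall x, O x -> 1 <= sqdist x v /\ 1 <= sqdist x w) ->
  0 <= u <= c -> exists x, O x /\ sqdist x (pt w (dir v w) t (2 * (PI / 3) - u)) <= 1.
Proof.
  intros Ht Hvw Hc HB HO Hu. destruct (HB u Hu) as (x & Ox & Hx). exists x. split; [assumption|].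
  destruct (HO x Ox). apply (pocket x v w t u); auto; lra.
Qed.

(** Here [l] is the angle at [w] measured from the edge back to [v]. For PI/3 <= l <= PI/3 + c the
    position of [q] is one of those that [blocked_next] puts within distance 1 of an obstacle. *)
Lemma blocked_gap (O : R * R -> Prop) (t : R) (v w q : R * R) (c l : R) :
  t * t = 1 -> sqdist v w = 1 -> c < PI / 3 -> blocked O t v (dir v w) c ->
  (forall x, O x -> 1 <= sqdist x v /\ 1 <= sqdist x w /\ 1 < sqdist x q) ->
  1 < sqdist v q -> 0 <= l < 2 * PI -> q = pt w (dir v w) t (PI - l) ->
  PI / 3 < l < 5 * (PI / 3) /\ PI / 3 + c < l.
Proof.
  intros Ht Hvw Hc HB HO Hv Hl Hq. pose proof PI_RGT_0.
  assert (Hd := unitv_dir _ _ Hvw).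
  assert (A : PI / 3 < l < 5 * (PI / 3)).
  { assert (S : 1 < sqdist (pt w (dir v w) t (PI - l)) (pt w (dir v w) t PI)).
    { rewrite <- Hq, pt_back, sqdist_sym. assumption. }
    apply angle_sep in S; auto. destruct S as [S1 S2].
    replace (PI - l - PI) with (- l) in * by ring.
    rewrite Rabs_Ropp, (Rabs_right l) in * by lra.
    rewrite Rabs_left in S2 by lra. lra. }
  split; [assumption|]. destruct (Rlt_dec (PI / 3 + c) l) as [|N]; [assumption|]. exfalso.
  destruct (blocked_next O t v w c (l - PI / 3)) as (x & Ox & Hx); auto; try lra.
  { intros x Ox. destruct (HO x Ox). tauto. }
  destruct (HO x Ox) as (_ & _ & Hxq). rewrite Hq in Hxq.
  replace (2 * (PI / 3) - (l - PI / 3)) with (PI - l) in Hx by field. lra.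
Qed.

(** The turn towards [q] shifts the blocked arc. Positions up to 2 PI/3 from the old direction are
    blocked by the rolled obstacles and those beyond 2 PI/3 by the disk of [v] itself, which is why
    [v] joins the obstacles. *)
Lemma blocked_pass (O : R * R -> Prop) (t : R) (v w q : R * R) (c l : R) :
  t * t = 1 -> sqdist v w = 1 -> c < PI / 3 -> blocked O t v (dir v w) c ->
  (forall x, O x -> 1 <= sqdist x v /\ 1 <= sqdist x w) ->
  PI / 3 < l -> q = pt w (dir v w) t (PI - l) ->
  blocked (fun x => O x \/ x = v) t w (dir w q) (c + 2 * (PI / 3) - l).
Proof.
  intros Ht Hvw Hc HB HO Hl Hq u Hu. pose proof PI_RGT_0.
  assert (Hd := unitv_dir _ _ Hvw).
  rewrite (pt_turn w q (dir v w) t (PI - l)) by assumption.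
  destruct (Rle_dec (PI - l + (PI / 3 - u)) (2 * (PI / 3))) as [L | L].
  - destruct (blocked_next O t v w c (2 * (PI / 3) - (PI - l + (PI / 3 - u)))) as (x & Ox & Hx); auto; try lra.
    exists x. split; [now left|].
    now replace (2 * (PI / 3) - (2 * (PI / 3) - (PI - l + (PI / 3 - u))))
      with (PI - l + (PI / 3 - u)) in Hx by ring.
  - exists v. split; [now right|]. rewrite <- (pt_back v w t) at 1.
    apply pt_close; auto. rewrite Rabs_right; lra.
Qed.

Lemma blocked_leaf (t : R) (w q f : R * R) (m : R) :
  t * t = 1 -> sqdist w f = 1 -> PI / 3 <= m -> q = pt w (dir w f) t m ->
  blocked (fun x => x = q) t w (dir w f) (2 * (PI / 3) - m).
Proof.
  intros Ht Hwf Hm Hq u Hu. exists q. split; [reflexivity|]. rewrite Hq.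
  apply pt_close; auto using unitv_dir. rewrite Rabs_right; lra.
Qed.

Lemma blocked_mono (O O' : R * R -> Prop) (t : R) (v d : R * R) (c : R) :
  (forall x, O x -> O' x) -> blocked O t v d c -> blocked O' t v d c.
Proof. intros H HB u Hu. destruct (HB u Hu) as (x & ? & ?). exists x; auto. Qed.

(* The blocked arcs on the two sides add up to more than [PI/3], which is what a vertex with five
   neighbours leaves behind, and more than what a second such vertex can afford. *)
Definition tight (O : R * R -> Prop) (v d : R * R) : Prop :=
  exists a b, a < PI / 3 /\ b < PI / 3 /\ PI / 3 < a + b /\
    blocked O 1 v d a /\ blocked O (-1) v d b.

(** * Stars of pairwise separated neighbours *)

Lemma exists_max (l : list R) : l <> [] ->
  exists x l', Permutation l (x :: l') /\ forall y, In y l' -> y <= x.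
Proof.
  induction l as [|a l IH]; [congruence|]. intros _.
  destruct l as [|b l]; [exists a, []; split; [reflexivity | intros ? []]|].
  destruct IH as (x & l' & P & H); [congruence|].
  destruct (Rle_dec a x).
  - exists x, (a :: l'). split; [rewrite P; apply perm_swap|].
    intros y [-> | Hy]; auto.
  - exists a, (x :: l'). split; [now rewrite P|].
    intros y [-> | Hy]; [lra|]. specialize (H y Hy). lra.
Qed.

(** Induction by removing the greatest number, which exceeds the greatest of the rest by more than
    [e]. A single number has spread 0, hence the guard [n <> O] on the strict bound. *)
Lemma separated_spread (n : nat) : forall (l : list R) (e : R), length l = S n ->
  (forall i j, (i < j < length l)%nat -> e < Rabs (nth i l 0 - nth j l 0)) ->
  exists x y, In x l /\ In y l /\ (forall z, In z l -> x <= z <= y) /\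
    (n <> O -> INR n * e < y - x).
Proof.
  intros l e Hlen Hsep.
  assert (HP : ForallOrdPairs (fun x y => e < Rabs (x - y)) l).
  { clear Hlen. induction l as [|a l IH]; constructor.
    - apply Forall_forall. intros x Hx. apply (In_nth _ _ 0) in Hx as (j & Hj & <-).
      apply (Hsep 0%nat (S j)). simpl. lia.
    - apply IH. intros i j Hij. apply (Hsep (S i) (S j)). simpl. lia. }
  clear Hsep. revert l Hlen HP. induction n as [|n IH]; intros l Hlen HP.
  - destruct l as [|a [|]]; try discriminate. exists a, a. simpl. repeat split; auto; try tauto;
      intuition subst; lra.
  - destruct (exists_max l) as (m & l' & P & Hm); [destruct l; discriminate|].
    assert (HP' : ForallOrdPairs (fun x y => e < Rabs (x - y)) (m :: l')).
    { clear - P HP. induction P; auto.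
      - inversion HP; subst. constructor; auto.
        apply Forall_forall. intros y Hy. rewrite Forall_forall in H1. apply H1.
        now rewrite P.
      - inversion HP as [|? ? F1 Q]; subst. inversion Q as [|? ? F2 Q']; subst.
        inversion F1; subst. constructor; [constructor; [now rewrite Rabs_minus_sym|]; auto | constructor; auto]. }
    inversion HP' as [|? ? F Q]; subst.
    destruct (IH l') as (x & y & Hx & Hy & Hxy & Hs).
    { apply Permutation_length in P. simpl in P. lia. }
    { assumption. }
    exists x, m. rewrite S_INR. repeat split.
    + rewrite P. now right.
    + rewrite P. now left.
    + rewrite P in H. destruct H as [<- | H]; [apply Hm in Hx; lra | now apply Hxy].
    + rewrite P in H. destruct H as [<- | H]; [lra | now apply Hm].
    + intros _. rewrite Forall_forall in F. generalize (F y Hy) (Hm y Hy). intros F' Hle.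
      rewrite Rabs_right in F' by lra. destruct n as [|n].
      * simpl. assert (x = y). { destruct l' as [|z [|]]; simpl in *; try tauto.
          - destruct Hx, Hy; try tauto; congruence.
          - apply Permutation_length in P. simpl in P. lia. } subst. lra.
      * specialize (Hs ltac:(discriminate)). lra.
Qed.

(** Measured from [f], all other neighbours have angles in the window (PI/3, 5 PI/3). No wrap-around
    occurs there, so the problem becomes one about separated real numbers. *)
Lemma star_spread (v f : R * R) (t : R) (n : nat) (qs : list (R * R)) :
  t * t = 1 -> sqdist v f = 1 -> length qs = S (S n) ->
  (forall q, In q qs -> sqdist v q = 1 /\ 1 < sqdist q f) ->
  (forall i j, (i < j < length qs)%nat -> 1 < sqdist (nth i qs v) (nth j qs v)) ->
  exists a b p q, In p qs /\ In q qs /\ p = pt v (dir v f) t a /\ q = pt v (dir v f) t b /\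
    PI / 3 < a /\ b < 5 * (PI / 3) /\ INR (S n) * (PI / 3) < b - a.
Proof.
  intros Ht Hf Hlen H1 H2. pose proof PI_RGT_0.
  assert (Hd := unitv_dir _ _ Hf).
  assert (HA : exists l, length l = length qs /\ forall i, (i < length qs)%nat ->
     PI / 3 < nth i l 0 < 5 * (PI / 3) /\ nth i qs v = pt v (dir v f) t (nth i l 0)).
  { clear H2 Hlen. induction qs as [|q qs IH]; [exists []; split; [reflexivity | simpl; lia]|].
    destruct IH as (l & Hl & HIH); [intros; apply H1; now right|].
    destruct (H1 q) as [Hq Hqf]; [now left|].
    destruct (pt_exists v (dir v f) q t Ht Hd Hq) as (a & Ha & Hqa).
    exists (a :: l). split; [simpl; lia|]. intros [|i] Hi; simpl.
    - split; [|assumption].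
      assert (Hqf' : 1 < sqdist (pt v (dir v f) t a) (pt v (dir v f) t 0))
        by (rewrite pt_dir, <- Hqa; assumption).
      clear Hqf. rename Hqf' into Hqf. apply angle_sep in Hqf; auto. rewrite Rminus_0_r, (Rabs_right a) in Hqf by lra.
      rewrite Rabs_left in Hqf by lra. lra.
    - apply HIH. simpl in Hi. lia. }
  destruct HA as (l & Hl & HA).
  destruct (separated_spread (S n) l (PI / 3)) as (a & b & Ia & Ib & _ & Hab).
  { congruence. }
  { intros i j Hij. rewrite Hl in Hij.
    destruct (HA i) as [_ Ei]; [lia|]. destruct (HA j) as [_ Ej]; [lia|].
    specialize (H2 i j Hij). rewrite Ei, Ej in H2. now apply angle_sep in H2. }
  apply (In_nth _ _ 0) in Ia as (i & Hi & <-). apply (In_nth _ _ 0) in Ib as (j & Hj & <-).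
  rewrite Hl in *. destruct (HA i Hi) as [Bi Ei]. destruct (HA j Hj) as [Bj Ej].
  exists (nth i l 0), (nth j l 0), (nth i qs v), (nth j qs v).
  repeat split; try lra; auto using nth_In.
Qed.

(** Five neighbours besides [f] would spread over more than 4 PI/3, the full width of their
    window. *)
Lemma star_six (v f : R * R) (qs : list (R * R)) :
  sqdist v f = 1 -> length qs = 5%nat ->
  (forall q, In q qs -> sqdist v q = 1 /\ 1 < sqdist q f) ->
  (forall i j, (i < j < length qs)%nat -> 1 < sqdist (nth i qs v) (nth j qs v)) -> False.
Proof.
  intros Hf Hl H1 H2.
  destruct (star_spread v f 1 3 qs) as (a & b & p & q & H); auto; [ring|].
  simpl INR in H. lra.
Qed.

(** The outermost disks [p] and [q] block the positions within PI/3 of themselves. The two arcs add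
    up to (b - a) - 2 PI/3, and four disks have b - a > PI. *)
Lemma tight_start (v f : R * R) (qs : list (R * R)) :
  sqdist v f = 1 -> length qs = 4%nat ->
  (forall q, In q qs -> sqdist v q = 1 /\ 1 < sqdist q f) ->
  (forall i j, (i < j < length qs)%nat -> 1 < sqdist (nth i qs v) (nth j qs v)) ->
  tight (fun x => In x qs) v (dir v f).
Proof.
  intros Hf Hl H1 H2. pose proof PI_RGT_0.
  destruct (star_spread v f 1 2 qs) as (a & b & p & q & Hp & Hq & Ep & Eq & H'); auto; [ring|].
  simpl INR in H'. exists (2 * (PI / 3) - a), (2 * (PI / 3) - (2 * PI - b)). repeat split; try lra.
  - eapply blocked_mono; [| apply (blocked_leaf 1 v p f a)]; auto; try lra. now intros x ->.
  - eapply blocked_mono; [| apply (blocked_leaf (-1) v q f (2 * PI - b))]; auto; try lra.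
    + now intros x ->.
    + replace (-1) with (- (1)) by ring. rewrite pt_opp, <- pt_2PI.
      now replace (- (2 * PI - b) + 2 * PI) with b by ring.
Qed.

(** The blocked arcs leave a window of width 4 PI/3 - (cl + cr) < PI, whereas the four neighbours of
    [w] other than [v] need more than PI. *)
Lemma tight_end (O : R * R -> Prop) (v w : R * R) (qs : list (R * R)) :
  sqdist v w = 1 -> tight O v (dir v w) -> length qs = 4%nat ->
  (forall q, In q qs -> sqdist w q = 1 /\ 1 < sqdist q v) ->
  (forall i j, (i < j < length qs)%nat -> 1 < sqdist (nth i qs w) (nth j qs w)) ->
  (forall x, O x -> 1 <= sqdist x v /\ 1 <= sqdist x w /\ forall q, In q qs -> 1 < sqdist x q) ->
  False.
Proof.
  intros Hvw (cl & cr & Hl & Hr & Hlr & BL & BR) Hlen H1 H2 HO. pose proof PI_RGT_0.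
  assert (Hwv : sqdist w v = 1) by now rewrite sqdist_sym.
  destruct (star_spread w v (-1) 2 qs) as (a & b & p & q & Hp & Hq & Ep & Eq & Ha & Hb & H'); auto; [ring|].
  simpl INR in H'.
  assert (T : forall x, pt w (dir w v) (-1) x = pt w (dir v w) 1 (PI - x)).
  { intros x. rewrite (pt_turn w v (dir v w) (-1) PI); [| ring | now rewrite pt_back].
    replace (-1) with (- (1)) by ring. rewrite pt_opp, <- pt_2PI. f_equal. ring. }
  rewrite T in Ep, Eq.
  destruct (blocked_gap O 1 v w p cl a) as [_ Ga]; auto; try lra.
  { intros x Ox. destruct (HO x Ox) as (? & ? & Hx). auto. }
  { rewrite sqdist_sym. now apply H1. }
  destruct (blocked_gap O (-1) v w q cr (2 * PI - b)) as [_ Gb]; auto; try lra.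
  { intros x Ox. destruct (HO x Ox) as (? & ? & Hx). auto. }
  { rewrite sqdist_sym. now apply H1. }
  { replace (-1) with (- (1)) by ring. rewrite pt_opp. rewrite Eq. f_equal. ring. }
Qed.

(** The way out to [f] may lie on either side of both [p] and [q] or between them. On a side of [f]
    that contains one of these disks, the disk next to [f] supplies the new arc; on an empty side
    the old arc is inherited through [blocked_pass]. *)
Lemma tight_pass (O : R * R -> Prop) (v w f p q : R * R) :
  sqdist v w = 1 -> tight O v (dir v w) ->
  sqdist w f = 1 -> sqdist w p = 1 -> sqdist w q = 1 ->
  1 < sqdist v f -> 1 < sqdist v p -> 1 < sqdist v q ->
  1 < sqdist f p -> 1 < sqdist f q -> 1 < sqdist p q ->
  (forall x, O x -> 1 <= sqdist x v /\ 1 <= sqdist x w /\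
     1 < sqdist x f /\ 1 < sqdist x p /\ 1 < sqdist x q) ->
  tight (fun x => O x \/ x = v \/ x = p \/ x = q) w (dir w f).
Proof.
  intros Hvw (cl & cr & Hl & Hr & Hlr & BL & BR) Hf Hp Hq Hvf Hvp Hvq Hfp Hfq Hpq HO.
  pose proof PI_RGT_0.
  assert (Hd := unitv_dir _ _ Hvw).
  assert (T1 : 1 * 1 = 1) by ring. assert (T2 : (-1) * (-1) = 1) by ring.
  assert (TR : forall x, pt w (dir v w) 1 (PI - x) = pt w (dir v w) (-1) (PI - (2 * PI - x))).
  { intros x. replace (-1) with (- (1)) by ring. rewrite pt_opp. f_equal. ring. }
  assert (EX : forall z, sqdist w z = 1 -> 1 < sqdist v z -> (forall x, O x -> 1 < sqdist x z) ->
    exists l, z = pt w (dir v w) 1 (PI - l) /\ PI / 3 + cl < l /\ l < 5 * (PI / 3) - cr /\ PI / 3 < l < 5 * (PI / 3)).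
  { intros z Hz Hvz HOz. destruct (pt_exists w (dir v w) z (-1) T2 Hd Hz) as (a & Ha & Ez).
    assert (exists l, 0 <= l < 2 * PI /\ z = pt w (dir v w) 1 (PI - l)) as (l & Bl & El).
    { replace (-1) with (- (1)) in Ez by ring. rewrite pt_opp in Ez.
      destruct (Rle_dec PI a).
      - exists (a - PI). split; [lra|]. rewrite Ez, <- pt_2PI. f_equal. ring.
      - exists (a + PI). split; [lra|]. rewrite Ez. f_equal. ring. }
    exists l. split; [assumption|].
    destruct (blocked_gap O 1 v w z cl l) as [G1 G2]; auto.
    { intros x Ox. destruct (HO x Ox) as (? & ? & _). auto. }
    destruct (blocked_gap O (-1) v w z cr (2 * PI - l)) as [_ G3]; auto; try lra.
    { intros x Ox. destruct (HO x Ox) as (? & ? & _). auto. }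
    { now rewrite <- TR. } }
  destruct (EX f) as (lf & Ef & Bf); auto. { intros x Ox. apply (HO x Ox). }
  assert (SEP : forall z1 z2 l1 l2, z1 = pt w (dir v w) 1 (PI - l1) -> z2 = pt w (dir v w) 1 (PI - l2) ->
    1 < sqdist z1 z2 -> PI / 3 < l1 - l2 \/ PI / 3 < l2 - l1).
  { intros z1 z2 l1 l2 -> -> S. apply angle_sep in S; auto. destruct S as [S _].
    replace (PI - l1 - (PI - l2)) with (l2 - l1) in S by ring.
    unfold Rabs in S. destruct (Rcase_abs (l2 - l1)); lra. }
  assert (WL : forall z l, z = pt w (dir v w) 1 (PI - l) -> z = pt w (dir w f) 1 (lf - l)).
  { intros z l Ez. rewrite (pt_turn w f (dir v w) 1 (PI - lf)) by auto. rewrite Ez. f_equal. ring. }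
  assert (WR : forall z l, z = pt w (dir v w) 1 (PI - l) -> z = pt w (dir w f) (-1) (l - lf)).
  { intros z l Ez. rewrite (WL z l Ez). replace (-1) with (- (1)) by ring. rewrite pt_opp. f_equal. ring. }
  assert (PL : blocked (fun x => O x \/ x = v) 1 w (dir w f) (cl + 2 * (PI / 3) - lf)).
  { apply blocked_pass; auto; try lra. intros x Ox. destruct (HO x Ox) as (? & ? & _). auto. }
  assert (PR : blocked (fun x => O x \/ x = v) (-1) w (dir w f) (cr + 2 * (PI / 3) - (2 * PI - lf))).
  { apply blocked_pass; auto; try lra.
    - intros x Ox. destruct (HO x Ox) as (? & ? & _). auto.
    - now rewrite <- TR. }
  assert (main : forall p q lp lq, p = pt w (dir v w) 1 (PI - lp) -> q = pt w (dir v w) 1 (PI - lq) ->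
     PI / 3 + cl < lp /\ lp < 5 * (PI / 3) - cr ->
     PI / 3 + cl < lq /\ lq < 5 * (PI / 3) - cr ->
     PI / 3 < lf - lp \/ PI / 3 < lp - lf -> PI / 3 < lf - lq \/ PI / 3 < lq - lf ->
     PI / 3 < lq - lp -> tight (fun x => O x \/ x = v \/ x = p \/ x = q) w (dir w f)).
  { clear p q Hp Hq Hvp Hvq Hfp Hfq Hpq HO. intros p q lp lq Ep Eq Bp Bq Sp Sq Spq.
    (* In the three consistent cases the new sums are cr + lq - 2 PI/3, 4 PI/3 - (lq - lp) and cl +
       4 PI/3 - lp. Each exceeds cl + cr, by the bounds on lp and lq and by lq - lp > PI/3. *)
    destruct Sp as [Sp | Sp]; destruct Sq as [Sq | Sq]; try lra.
    - exists (2 * (PI / 3) - (lf - lq)), (cr + 2 * (PI / 3) - (2 * PI - lf)).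
      repeat split; try lra.
      + eapply blocked_mono; [| apply (blocked_leaf 1 w q f)]; auto; try lra; simpl; tauto.
      + eapply blocked_mono; [| exact PR]; simpl; tauto.
    - exists (2 * (PI / 3) - (lf - lp)), (2 * (PI / 3) - (lq - lf)).
      repeat split; try lra.
      + eapply blocked_mono; [| apply (blocked_leaf 1 w p f)]; auto; try lra; simpl; tauto.
      + eapply blocked_mono; [| apply (blocked_leaf (-1) w q f)]; auto; try lra; simpl; tauto.
    - exists (cl + 2 * (PI / 3) - lf), (2 * (PI / 3) - (lp - lf)).
      repeat split; try lra.
      + eapply blocked_mono; [| exact PL]; simpl; tauto.
      + eapply blocked_mono; [| apply (blocked_leaf (-1) w p f)]; auto; try lra; simpl; tauto. }
  destruct (EX p) as (lp & Ep & Bp); auto. { intros x Ox. apply (HO x Ox). }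
  destruct (EX q) as (lq & Eq & Bq); auto. { intros x Ox. apply (HO x Ox). }
  assert (Sp := SEP _ _ _ _ Ef Ep Hfp). assert (Sq := SEP _ _ _ _ Ef Eq Hfq).
  destruct (SEP _ _ _ _ Ep Eq Hpq).
  - assert (M : tight (fun x => O x \/ x = v \/ x = q \/ x = p) w (dir w f)).
    { apply (main q p lq lp); auto; lra. }
    destruct M as (a & b & ? & ? & ? & M1 & M2). exists a, b. repeat split; auto.
    + eapply blocked_mono; [| exact M1]; simpl; tauto.
    + eapply blocked_mono; [| exact M2]; simpl; tauto.
  - apply (main p q lp lq); auto; lra.
Qed.

(** * A drawing with three rows *)

Inductive slot : Type := SV (j : nat) | SB (j : nat) | ST (j : nat).

Definition slot_index (s : slot) : nat := match s with SV j | SB j | ST j => j end.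

(* [ph j] tells whether the disk [ST j] in the notch above the spine edge from [SV j] to
   [SV (S j)] touches the left end of that edge (true) or the right end (false). *)
Definition touch (ph : nat -> bool) (a b : slot) : Prop :=
  match a, b with
  | SV i, SV j => j = S i \/ i = S j
  | SV i, SB j | SB j, SV i => i = j
  | SV i, ST j | ST j, SV i => i = if ph j then j else S j
  | _, _ => False
  end.

Fixpoint Vpos (w : R) (j : nat) : R * R :=
  match j with
  | O => (0, 0)
  | S i => (fst (Vpos w i) + cos (INR i * w), snd (Vpos w i) - sin (INR i * w))
  end.

(** Together with [height], the shift by w/8 gives squared distance 1 to one end of the edge and 1 +
    w/4 to the other. It is small enough for the bend to keep disks in adjacent notches apart. *)
Definition notch (w : R) (b : bool) : R := if b then 1 / 2 - w / 8 else 1 / 2 + w / 8.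

Definition height (w : R) : R := sqrt (1 - (1 / 2 - w / 8) * (1 / 2 - w / 8)).

(** Edge [j] has direction (cos (j w), - sin (j w)), so the path bends downwards and opens the upper
    notches. Below, the same bend would press disks on the normals together; [SB j] therefore hangs
    in direction (sin (j w), - cos (j w)), which turns the opposite way. *)
Definition place (w : R) (ph : nat -> bool) (s : slot) : R * R :=
  match s with
  | SV j => Vpos w j
  | SB j => (fst (Vpos w j) + sin (INR j * w), snd (Vpos w j) - cos (INR j * w))
  | ST j => (fst (Vpos w j) + (notch w (ph j) * cos (INR j * w) + height w * sin (INR j * w)),
             snd (Vpos w j) + (height w * cos (INR j * w) - notch w (ph j) * sin (INR j * w)))
  end.

(** * Distances between the slots of the drawing *)

Lemma small_sin (a : R) : 0 <= a <= 1 / 5 -> 0 <= sin a <= 1 / 5.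
Proof.
  intros H. pose proof PI2_3_2. split; [apply sin_ge_0; lra|].
  destruct (Req_dec a 0) as [-> | ?]; [rewrite sin_0; lra|].
  generalize (sin_lt_x a). lra.
Qed.

Lemma small_cos (a : R) : 0 <= a <= 1 / 5 -> 49 / 50 <= cos a <= 1.
Proof.
  intros H. split; [|apply COS_bound].
  generalize (small_sin (a / 2)). intros Hs.
  replace a with (2 * (a / 2)) by field. rewrite cos_2a_sin.
  assert (sin (a / 2) <= 1 / 10).
  { destruct (Req_dec a 0) as [-> | ?]; [replace (0 / 2) with 0 by field; rewrite sin_0; lra|].
    generalize (sin_lt_x (a / 2)). lra. }
  nra.
Qed.

Lemma sin_lower (w : R) : 0 < w <= 1 / 10 -> 9 / 10 * w <= sin w.
Proof.
  intros Hw. assert (P := pre_sin_bound w 0). pose proof PI2_3_2.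
  destruct P as [P _]; try lra.
  unfold sin_approx, sin_term in P. simpl in P. nra.
Qed.

Lemma height_sq (w : R) : 0 < w <= 1 / 10 -> height w ^ 2 = 1 - (1 / 2 - w / 8) ^ 2.
Proof. intros H. unfold height. rewrite pow2_sqrt by nra. ring. Qed.

Lemma height_bounds (w : R) : 0 < w <= 1 / 10 -> 43 / 50 <= height w <= 9 / 10.
Proof.
  intros H. generalize (height_sq w H). assert (0 <= height w) by apply sqrt_pos. intros. nra.
Qed.

(** Most pairs of slots are separated by one coordinate alone; exact formulas are needed only for
    close indices. *)
Lemma far_x (a b : R * R) : 1 < fst b - fst a -> 1 < sqdist a b.
Proof. intros H. unfold sqdist. generalize (pow2_ge_0 (snd a - snd b)). nra. Qed.

Lemma far_y (a b : R * R) : 1 < snd a - snd b -> 1 < sqdist a b.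
Proof. intros H. unfold sqdist. generalize (pow2_ge_0 (fst a - fst b)). nra. Qed.

Lemma Vpos_bounds (w : R) (N i j : nat) : 0 < w -> INR N * w <= 1 / 5 -> (i <= j <= S N)%nat ->
  49 / 50 * (INR j - INR i) <= fst (Vpos w j) - fst (Vpos w i) /\
  0 <= snd (Vpos w i) - snd (Vpos w j) <= 1 / 5 * (INR j - INR i).
Proof.
  intros Hw HN [Hij HjN]. induction Hij as [|j Hij IH]; [lra|].
  specialize (IH ltac:(lia)). rewrite S_INR. simpl.
  assert (A : 0 <= INR j * w <= 1 / 5).
  { assert (INR j <= INR N) by (apply le_INR; lia). assert (0 <= INR j) by apply pos_INR. nra. }
  generalize (small_sin _ A) (small_cos _ A). lra.
Qed.

Lemma index_angle (w : R) (N j : nat) : 0 < w -> INR N * w <= 1 / 5 -> (j <= N)%nat ->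
  0 <= INR j * w <= 1 / 5.
Proof.
  intros Hw HN Hj. assert (INR j <= INR N) by (apply le_INR; lia).
  assert (0 <= INR j) by apply pos_INR. nra.
Qed.

Lemma offset_bounds (w a : R) (b : bool) : 0 < w <= 1 / 10 -> 0 <= a <= 1 / 5 ->
  9 / 20 <= notch w b * cos a + height w * sin a <= 19 / 25 /\
  7 / 10 <= height w * cos a - notch w b * sin a.
Proof.
  intros Hw Ha. generalize (small_sin _ Ha) (small_cos _ Ha) (height_bounds w Hw).
  intros Hs Hc Hh.
  assert (Hn : 97 / 200 <= notch w b <= 103 / 200) by (unfold notch; destruct b; lra).
  repeat split; nra.
Qed.

Lemma INR_gap (i j k : nat) : (i + k <= j)%nat -> INR k <= INR j - INR i.
Proof. intros H. apply le_INR in H. rewrite plus_INR in H. lra. Qed.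

Lemma cos2_sin2 (a : R) : cos a ^ 2 = 1 - sin a ^ 2.
Proof. generalize (sin2_cos2 a). unfold Rsqr. lra. Qed.

Lemma VV_edge (w : R) (i : nat) : sqdist (Vpos w i) (Vpos w (S i)) = 1.
Proof.
  unfold sqdist. simpl fst. simpl snd.
  transitivity (cos (INR i * w) ^ 2 + sin (INR i * w) ^ 2); [ring | rewrite cos2_sin2; ring].
Qed.

Lemma VV_far (w : R) (ph : nat -> bool) (N i j : nat) :
  0 < w <= 1 / 10 -> INR N * w <= 1 / 5 -> (i <= N)%nat -> (j <= N)%nat -> (S i < j)%nat ->
  1 < sqdist (place w ph (SV i)) (place w ph (SV j)).
Proof.
  intros Hw HN Hi Hj Hij. apply far_x. simpl.
  destruct (Vpos_bounds w N i j) as [B _]; try lra; try lia.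
  assert (G := INR_gap i j 2 ltac:(lia)). simpl INR in G. lra.
Qed.

Lemma VB_touch (w : R) (ph : nat -> bool) (j : nat) :
  sqdist (place w ph (SV j)) (place w ph (SB j)) = 1.
Proof.
  unfold sqdist. simpl fst. simpl snd.
  transitivity (cos (INR j * w) ^ 2 + sin (INR j * w) ^ 2); [ring | rewrite cos2_sin2; ring].
Qed.

Lemma VB_far (w : R) (ph : nat -> bool) (N i j : nat) :
  0 < w <= 1 / 10 -> INR N * w <= 1 / 5 -> (i <= N)%nat -> (j <= N)%nat -> i <> j ->
  1 < sqdist (place w ph (SV i)) (place w ph (SB j)).
Proof.
  intros Hw HN Hi Hj Hij.
  assert (Aj := index_angle w N j ltac:(lra) HN Hj). assert (Ai := index_angle w N i ltac:(lra) HN Hi).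
  generalize (small_sin _ Aj) (small_cos _ Aj) (small_sin _ Ai) (small_cos _ Ai). intros Sj Cj Si Ci.
  destruct (lt_eq_lt_dec i j) as [[L | L] | L]; [| tauto |].
  - destruct (Nat.eq_dec j (S i)) as [-> | Nj].
    + unfold sqdist. simpl fst. simpl snd.
      match goal with |- 1 < ?x => replace x with
        (cos (INR i * w) ^ 2 + sin (INR i * w) ^ 2 + cos (INR (S i) * w) ^ 2 + sin (INR (S i) * w) ^ 2
          + 2 * (cos (INR i * w) * sin (INR (S i) * w) + sin (INR i * w) * cos (INR (S i) * w))) by (simpl INR; ring) end.
      rewrite (cos2_sin2 (INR i * w)), (cos2_sin2 (INR (S i) * w)). nra.
    + apply far_x. simpl.
      destruct (Vpos_bounds w N i j) as [B _]; try lra; try lia.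
      assert (G := INR_gap i j 2 ltac:(lia)). simpl INR in G. lra.
  - destruct (Nat.eq_dec i (S j)) as [-> | Ni].
    (* The squared distance is 2 - 2 sin (2 j w). It exceeds 1 because the bound 1/5 keeps the tilt
       below PI/12. *)
    + unfold sqdist. simpl fst. simpl snd.
      match goal with |- 1 < ?x => replace x with
        (2 * (cos (INR j * w) ^ 2 + sin (INR j * w) ^ 2) - 4 * (sin (INR j * w) * cos (INR j * w))) by ring end.
      rewrite (cos2_sin2 (INR j * w)). nra.
    + rewrite sqdist_sym. apply far_x. simpl.
      destruct (Vpos_bounds w N j i) as [B _]; try lra; try lia.
      assert (G := INR_gap j i 2 ltac:(lia)). simpl INR in G. lra.
Qed.

Lemma VT_near (w : R) (ph : nat -> bool) (i j : nat) : 0 < w <= 1 / 10 -> i = j \/ i = S j ->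
  sqdist (place w ph (SV i)) (place w ph (ST j)) =
  if Nat.eqb i (if ph j then j else S j) then 1 else 1 + w / 4.
Proof.
  intros Hw Hi. generalize (height_sq w Hw) (cos2_sin2 (INR j * w)). intros Hh Hc.
  assert (Q : (i = j /\ sqdist (place w ph (SV i)) (place w ph (ST j)) = notch w (ph j) ^ 2 + height w ^ 2) \/
     (i = S j /\ sqdist (place w ph (SV i)) (place w ph (ST j)) = (1 - notch w (ph j)) ^ 2 + height w ^ 2)).
  { unfold sqdist. destruct Hi as [-> | ->]; simpl fst; simpl snd; [left | right]; split; auto.
    - transitivity ((notch w (ph j) ^ 2 + height w ^ 2) * (cos (INR j * w) ^ 2 + sin (INR j * w) ^ 2)); [ring|].
      rewrite Hc. ring.
    - transitivity (((1 - notch w (ph j)) ^ 2 + height w ^ 2) * (cos (INR j * w) ^ 2 + sin (INR j * w) ^ 2)); [ring|].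
      rewrite Hc. ring. }
  destruct Q as [[-> ->] | [-> ->]]; rewrite Hh; unfold notch; destruct (ph j);
    match goal with |- context [Nat.eqb ?a ?b] => destruct (Nat.eqb_spec a b) end; try lia; field.
Qed.

Lemma VT_far (w : R) (ph : nat -> bool) (N i j : nat) :
  0 < w <= 1 / 10 -> INR N * w <= 1 / 5 -> (i <= N)%nat -> (j <= N)%nat -> i <> j -> i <> S j ->
  1 < sqdist (place w ph (SV i)) (place w ph (ST j)).
Proof.
  intros Hw HN Hi Hj Hij Hij'.
  assert (Aj := index_angle w N j ltac:(lra) HN Hj).
  destruct (offset_bounds w (INR j * w) (ph j) Hw Aj) as [X Y].
  destruct (le_lt_dec i j) as [L | L].
  - apply far_x. simpl. destruct (Vpos_bounds w N i j) as [B _]; try lra; try lia.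
    assert (G := INR_gap i j 1 ltac:(lia)). simpl INR in G. lra.
  - rewrite sqdist_sym. apply far_x. simpl. destruct (Vpos_bounds w N j i) as [B _]; try lra; try lia.
    assert (G := INR_gap j i 2 ltac:(lia)). simpl INR in G. lra.
Qed.

Lemma BB_far (w : R) (ph : nat -> bool) (N i j : nat) :
  0 < w <= 1 / 10 -> INR N * w <= 1 / 5 -> (i <= N)%nat -> (j <= N)%nat -> (i < j)%nat ->
  1 < sqdist (place w ph (SB i)) (place w ph (SB j)).
Proof.
  intros Hw HN Hi Hj Hij.
  assert (Aj := index_angle w N j ltac:(lra) HN Hj). assert (Ai := index_angle w N i ltac:(lra) HN Hi).
  generalize (small_sin _ Aj) (small_cos _ Aj) (small_sin _ Ai) (small_cos _ Ai). intros Sj Cj Si Ci.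
  destruct (Nat.eq_dec j (S i)) as [-> | Nj].
  (* The difference of sines measures the opposite turn of the lower disks: it is positive because
     their tilt grows with the index. *)
  - assert (Q : sqdist (place w ph (SB i)) (place w ph (SB (S i))) =
      1 + 2 * (sin (INR i * w + INR (S i) * w) - sin (INR i * w + INR i * w))
        + 2 * (1 - cos (INR (S i) * w - INR i * w))).
    { rewrite !sin_plus, cos_minus. unfold sqdist. cbn [fst snd place Vpos].
      generalize (cos2_sin2 (INR i * w)) (cos2_sin2 (INR (S i) * w)).
      generalize (cos (INR i * w)) (sin (INR i * w)).
      generalize (cos (INR (S i) * w)).
      generalize (sin (INR (S i) * w)).
      intros s' c' c s E1 E2.
      transitivity (c ^ 2 + s ^ 2 + (c ^ 2 + s ^ 2) + (c' ^ 2 + s' ^ 2)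
        + 2 * (s * c' + c * s' - 2 * s * c) - 2 * (c' * c + s' * s)); [ring|]. rewrite E1, E2. ring. }
    rewrite Q. pose proof PI2_3_2. pose proof PI_RGT_0.
    assert (sin (INR i * w + INR i * w) < sin (INR i * w + INR (S i) * w)).
    { apply sin_increasing_1; try lra. rewrite S_INR. lra. }
    generalize (COS_bound (INR (S i) * w - INR i * w)). lra.
  - apply far_x. simpl. destruct (Vpos_bounds w N i j) as [B _]; try lra; try lia.
    assert (G := INR_gap i j 2 ltac:(lia)). simpl INR in G. lra.
Qed.

Lemma TB_far (w : R) (ph : nat -> bool) (N i j : nat) :
  0 < w <= 1 / 10 -> INR N * w <= 1 / 5 -> (i <= N)%nat -> (j <= N)%nat ->
  1 < sqdist (place w ph (ST i)) (place w ph (SB j)).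
Proof.
  intros Hw HN Hi Hj.
  assert (Aj := index_angle w N j ltac:(lra) HN Hj). assert (Ai := index_angle w N i ltac:(lra) HN Hi).
  generalize (small_sin _ Aj) (small_cos _ Aj). intros Sj Cj.
  destruct (offset_bounds w (INR i * w) (ph i) Hw Ai) as [X Y].
  destruct (le_lt_dec i j) as [L | L].
  - apply far_y. simpl. destruct (Vpos_bounds w N i j) as [_ B]; try lra; try lia.
  - destruct (Vpos_bounds w N j i) as [B B']; try lra; try lia.
    destruct (le_lt_dec i (j + 3)) as [L' | L'].
    + apply far_y. simpl. apply le_INR in L'. rewrite plus_INR in L'. simpl INR in L'. lra.
    + rewrite sqdist_sym. apply far_x. simpl.
      assert (G := INR_gap j i 2 ltac:(lia)). simpl INR in G. lra.
Qed.

Lemma TT_far (w : R) (ph : nat -> bool) (N i j : nat) :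
  0 < w <= 1 / 10 -> INR N * w <= 1 / 5 -> (i <= N)%nat -> (j <= N)%nat -> (i < j)%nat ->
  1 < sqdist (place w ph (ST i)) (place w ph (ST j)).
Proof.
  intros Hw HN Hi Hj Hij.
  assert (Aj := index_angle w N j ltac:(lra) HN Hj). assert (Ai := index_angle w N i ltac:(lra) HN Hi).
  destruct (offset_bounds w (INR i * w) (ph i) Hw Ai) as [Xi _].
  destruct (offset_bounds w (INR j * w) (ph j) Hw Aj) as [Xj _].
  destruct (Nat.eq_dec j (S i)) as [-> | Nj].
  - generalize (height_bounds w Hw) (height_sq w Hw) (sin_lower w Hw). intros Hh Hh2 Hs.
    set (A := 1 - notch w (ph i)). set (B := notch w (ph (S i))).
    assert (Q : sqdist (place w ph (ST i)) (place w ph (ST (S i))) =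
      (A + B) ^ 2 + 2 * (height w ^ 2 - A * B) * (1 - cos w) + 2 * height w * sin w * (A + B)).
    { assert (Ew : w = INR (S i) * w - INR i * w) by (rewrite S_INR; ring).
      assert (Ec : cos w = cos (INR (S i) * w) * cos (INR i * w) + sin (INR (S i) * w) * sin (INR i * w))
        by (rewrite Ew at 1; apply cos_minus).
      assert (Es : sin w = sin (INR (S i) * w) * cos (INR i * w) - cos (INR (S i) * w) * sin (INR i * w))
        by (rewrite Ew at 1; apply sin_minus).
      rewrite Ec, Es. clear Ew Ec Es Hs.
      unfold sqdist, A, B. cbn [fst snd place Vpos].
      generalize (cos2_sin2 (INR i * w)) (cos2_sin2 (INR (S i) * w)).
      generalize (cos (INR i * w)) (sin (INR i * w)).
      generalize (cos (INR (S i) * w)).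
      generalize (sin (INR (S i) * w)).
      generalize (notch w (ph i)) (notch w (ph (S i))) (height w).
      intros a b h s' c' c s E1 E2.
      transitivity ((1 - a) ^ 2 * (c ^ 2 + s ^ 2) + b ^ 2 * (c' ^ 2 + s' ^ 2)
        + 2 * (1 - a) * b * (c' * c + s' * s) + 2 * h * ((1 - a) + b) * (s' * c - c' * s)
        + h ^ 2 * (c ^ 2 + s ^ 2 + (c' ^ 2 + s' ^ 2)) - 2 * h ^ 2 * (c' * c + s' * s)
        + 2 * h * b * (s' * c' - c' * s') + 2 * h * (1 - a) * (s * c - c * s)); [ring|].
      rewrite E1, E2. ring. }
    rewrite Q.
    assert (HA : 1 / 2 - w / 8 <= A <= 1 / 2 + w / 8) by (unfold A, notch; destruct (ph i); lra).
    assert (HB : 1 / 2 - w / 8 <= B <= 1 / 2 + w / 8) by (unfold B, notch; destruct (ph (S i)); lra).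
    generalize (COS_bound w). intros Hc.
    assert (HAB : A * B <= height w ^ 2) by (rewrite Hh2; nra).
    assert (0 <= 2 * (height w ^ 2 - A * B) * (1 - cos w)) by (apply Rmult_le_pos; lra).
    (* The worst case is two disks leaning towards each other. This costs about w/2 in the squared
       distance, whereas the turn contributes 2 [height w] sin w (A + B), which is about 3/2 w or
       more. *)
    assert (G1 : (1 - w / 4) ^ 2 <= (A + B) ^ 2) by nra.
    assert (G2 : 43 / 50 * (9 / 10 * w) <= height w * sin w) by nra.
    assert (G3 : 2 * (43 / 50 * (9 / 10 * w)) * (1 - w / 4) <= 2 * height w * sin w * (A + B)) by nra.
    nra.
  - apply far_x. simpl. destruct (Vpos_bounds w N i j) as [B _]; try lra; try lia.
    assert (G := INR_gap i j 2 ltac:(lia)). simpl INR in G. lra.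
Qed.

Lemma slot_positions (w : R) (ph : nat -> bool) (N : nat) (a b : slot) :
  0 < w <= 1 / 10 -> INR N * w <= 1 / 5 -> (slot_index a <= N)%nat -> (slot_index b <= N)%nat -> a <> b ->
  1 <= sqdist (place w ph a) (place w ph b) /\ (sqdist (place w ph a) (place w ph b) = 1 <-> touch ph a b).
Proof.
  intros Hw HN Ha Hb Hab.
  assert (far : forall a b, 1 < sqdist (place w ph a) (place w ph b) -> ~ touch ph a b ->
    1 <= sqdist (place w ph a) (place w ph b) /\ (sqdist (place w ph a) (place w ph b) = 1 <-> touch ph a b)).
  { intros. split; [lra|]. split; [lra | tauto]. }
  assert (near : forall a b, sqdist (place w ph a) (place w ph b) = 1 -> touch ph a b ->
    1 <= sqdist (place w ph a) (place w ph b) /\ (sqdist (place w ph a) (place w ph b) = 1 <-> touch ph a b)).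
  { intros. split; [lra | tauto]. }
  assert (VB : forall i j, (i <= N)%nat -> (j <= N)%nat ->
    1 <= sqdist (place w ph (SV i)) (place w ph (SB j)) /\ (sqdist (place w ph (SV i)) (place w ph (SB j)) = 1 <-> touch ph (SV i) (SB j))).
  { intros i j Hi Hj. destruct (Nat.eq_dec i j) as [-> | Nij].
    - apply near; [apply VB_touch | reflexivity].
    - apply far; [now apply VB_far with N | exact Nij]. }
  assert (VT : forall i j, (i <= N)%nat -> (j <= N)%nat ->
    1 <= sqdist (place w ph (SV i)) (place w ph (ST j)) /\ (sqdist (place w ph (SV i)) (place w ph (ST j)) = 1 <-> touch ph (SV i) (ST j))).
  { intros i j Hi Hj. destruct (Nat.eq_dec i j) as [E | N1]; [| destruct (Nat.eq_dec i (S j)) as [E | N2]].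
    1,2: rewrite VT_near by auto; simpl touch;
      destruct (Nat.eqb_spec i (if ph j then j else S j)); split; try lra; split; intros; try lra; tauto.
    apply far; [now apply VT_far with N |]. simpl. destruct (ph j); assumption. }
  destruct a as [i | i | i], b as [j | j | j]; simpl in Ha, Hb.
  - destruct (lt_eq_lt_dec i j) as [[L | ->] | L]; [| congruence |].
    + destruct (Nat.eq_dec j (S i)) as [-> | Nj].
      * apply near; [apply VV_edge | simpl; auto].
      * apply far; [apply VV_far with N; auto; lia | simpl; lia].
    + destruct (Nat.eq_dec i (S j)) as [-> | Nj].
      * apply near; [rewrite sqdist_sym; apply VV_edge | simpl; auto].
      * apply far; [rewrite sqdist_sym; apply VV_far with N; auto; lia | simpl; lia].
  - now apply VB.
  - now apply VT.
  - rewrite sqdist_sym. now apply VB.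
  - assert (i <> j) by congruence. apply far; [|simpl; tauto].
    destruct (lt_eq_lt_dec i j) as [[L | L] | L]; [| tauto | rewrite sqdist_sym]; now apply BB_far with N.
  - apply far; [rewrite sqdist_sym; now apply TB_far with N | simpl; tauto].
  - rewrite sqdist_sym. now apply VT.
  - apply far; [now apply TB_far with N | simpl; tauto].
  - assert (i <> j) by congruence. apply far; [|simpl; tauto].
    destruct (lt_eq_lt_dec i j) as [[L | L] | L]; [| tauto | rewrite sqdist_sym]; now apply TT_far with N.
Qed.

Local Open Scope nat_scope.

(** * Spines of caterpillars *)

Definition nbrs (E : graph) (v : nat) : list nat :=
  flat_map (fun e => if fst e =? v then [snd e] else if snd e =? v then [fst e] else []) E.

Definition deg (E : graph) (v : nat) : nat := length (nbrs E v).

Lemma in_nbrs (E : graph) (u v : nat) : In u (nbrs E v) <-> adj E u v.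
Proof.
  unfold nbrs, adj. rewrite in_flat_map. split.
  - intros ([a b] & He & Hu). simpl in Hu.
    destruct (a =? v) eqn:Ea; [apply Nat.eqb_eq in Ea; subst; simpl in Hu; intuition subst; auto|].
    destruct (b =? v) eqn:Eb; [apply Nat.eqb_eq in Eb; subst; simpl in Hu; intuition subst; auto|].
    destruct Hu.
  - intros [H | H].
    + exists (u, v). split; [assumption|]. simpl. rewrite Nat.eqb_refl.
      destruct (u =? v) eqn:Ea; simpl; auto. apply Nat.eqb_eq in Ea. auto.
    + exists (v, u). split; [assumption|]. simpl. rewrite Nat.eqb_refl. simpl. auto.
Qed.

Lemma valid_input_tail (n : nat) (e : nat * nat) (E : graph) :
  valid_input n (e :: E) -> valid_input n E.
Proof.
  intros [H1 H2]. split; [now inversion H1|]. intros u v H.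
  destruct (H2 u v (or_intror H)) as (? & ? & ? & N). repeat split; auto.
  intros H'. apply N. now right.
Qed.

Lemma NoDup_nbrs (n : nat) (E : graph) (v : nat) : valid_input n E -> NoDup (nbrs E v).
Proof.
  induction E as [|[a b] E IH]; intros V; [constructor|].
  assert (V' := valid_input_tail _ _ _ V). specialize (IH V').
  destruct V as [V1 V2]. inversion V1; subst. destruct (V2 a b (or_introl eq_refl)) as (_ & _ & _ & N).
  change (nbrs ((a, b) :: E) v) with
    ((if a =? v then [b] else if b =? v then [a] else []) ++ nbrs E v).
  destruct (Nat.eqb_spec a v) as [-> | _].
  - simpl. constructor; [|assumption]. rewrite in_nbrs. intros [A | A]; [apply N; now right | tauto].
  - destruct (Nat.eqb_spec b v) as [-> | _]; [|assumption].
    simpl. constructor; [|assumption]. rewrite in_nbrs. intros [A | A]; [tauto | apply N; now right].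
Qed.

Lemma adj_sym (E : graph) (u v : nat) : adj E u v -> adj E v u.
Proof. unfold adj. tauto. Qed.

Lemma adj_valid (n : nat) (E : graph) (u v : nat) :
  valid_input n E -> adj E u v -> u < n /\ v < n /\ u <> v.
Proof. intros [_ V] [H | H]; apply V in H; intuition. Qed.

Lemma is_leaf_deg (n : nat) (E : graph) (v : nat) :
  valid_input n E -> (is_leaf n E v <-> deg E v = 1).
Proof.
  intros V. unfold deg. assert (ND := NoDup_nbrs n E v V). split.
  - intros (u & _ & Hu & Hw). apply in_nbrs in Hu.
    destruct (nbrs E v) as [|a [|b l]] eqn:El; [destruct Hu | reflexivity | exfalso].
    assert (a = u) by (apply Hw, in_nbrs; rewrite El; simpl; auto).
    assert (b = u) by (apply Hw, in_nbrs; rewrite El; simpl; auto).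
    subst. inversion ND; subst. apply H1. now left.
  - intros H. destruct (nbrs E v) as [|a [|b l]] eqn:El; try discriminate. exists a.
    assert (A : adj E a v) by (apply in_nbrs; rewrite El; simpl; auto).
    repeat split; auto; [apply (adj_valid n E a v V A)|].
    intros w Hw. apply in_nbrs in Hw. rewrite El in Hw. simpl in Hw. intuition.
Qed.

Lemma walk_adj (E : graph) (x : nat) (p : list nat) :
  walk_from E x p -> last p x <> x -> exists y, adj E x y.
Proof. destruct p as [|y p]; simpl; [congruence|]. intros [H _] _. now exists y. Qed.

Lemma deg_pos (n : nat) (E : graph) (v : nat) :
  valid_input n E -> is_tree n E -> 2 <= n -> v < n -> 1 <= deg E v.
Proof.
  intros V (_ & Hc & _) Hn Hv.
  destruct (Hc v (if v =? 0 then 1 else 0)) as (p & Hw & Hl);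
    [assumption | destruct (v =? 0); lia |].
  destruct (walk_adj E v p Hw) as (y & Hy).
  { rewrite Hl. destruct (Nat.eqb_spec v 0); lia. }
  apply adj_sym, in_nbrs in Hy. unfold deg. destruct (nbrs E v); [destruct Hy | simpl; lia].
Qed.

(** Once all degrees are positive, the non-leaves are the vertices of degree at least 2. The list is
    empty for a single edge, and its reverse is a spine as well, so the walk may start at either
    end. *)
Record spine (n : nat) (E : graph) (p : list nat) : Prop := {
  spine_valid : valid_input n E;
  spine_nodup : NoDup p;
  spine_deg_pos : forall v, v < n -> 1 <= deg E v;
  spine_mem : forall v, In v p <-> v < n /\ 2 <= deg E v;
  spine_adj : forall i j, i < length p -> j < length p ->
    (adj E (nth i p 0) (nth j p 0) <-> j = S i \/ i = S j)
}.

Arguments spine_valid {n E p}.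
Arguments spine_nodup {n E p}.
Arguments spine_deg_pos {n E p}.
Arguments spine_mem {n E p}.
Arguments spine_adj {n E p}.

Lemma consecutive_nth (p : list nat) (i j : nat) : NoDup p -> i < length p -> j < length p ->
  (consecutive p (nth i p 0) (nth j p 0) <-> j = S i \/ i = S j).
Proof.
  intros ND Hi Hj. unfold consecutive.
  assert (T : forall a b, a < length p -> nth_error p b = Some (nth a p 0) -> a = b).
  { intros a b Ha Hb. rewrite NoDup_nth_error in ND. apply ND; [assumption|].
    rewrite Hb. now apply nth_error_nth'. }
  split.
  - intros (k & [[H1 H2] | [H1 H2]]); apply T in H1, H2; auto; lia.
  - intros [-> | ->]; [exists i; left | exists j; right]; split; now apply nth_error_nth'.
Qed.

Lemma caterpillar_spine (n : nat) (E : graph) :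
  valid_input n E -> caterpillar n E -> 2 <= n -> exists p, spine n E p.
Proof.
  intros V (T & p & ND & M & A) Hn. exists p.
  assert (D : forall v, v < n -> 1 <= deg E v) by (intros; now apply (deg_pos n)).
  assert (M' : forall v, In v p <-> v < n /\ 2 <= deg E v).
  { intros v. rewrite M, is_leaf_deg by assumption. split; intros [H1 H2]; split; auto; try lia.
    specialize (D v H1). lia. }
  split; auto.
  intros i j Hi Hj. rewrite A by now apply nth_In. now apply consecutive_nth.
Qed.

Lemma spine_rev (n : nat) (E : graph) (p : list nat) : spine n E p -> spine n E (rev p).
Proof.
  intros [V ND D M A]. split; auto.
  - now apply NoDup_rev.
  - intros v. now rewrite <- in_rev.
  - intros i j. rewrite length_rev. intros Hi Hj. rewrite !rev_nth by assumption.
    rewrite A by lia. lia.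
Qed.

Definition leaf_of (E : graph) (z u : nat) : Prop :=
  adj E z u /\ forall w, adj E z w -> w = u.

Lemma deg1_leaf_of (E : graph) (z u : nat) : deg E z = 1 -> adj E z u -> leaf_of E z u.
Proof.
  intros Hd A. split; [assumption|]. intros w B. apply adj_sym, in_nbrs in A, B.
  unfold deg in Hd. destruct (nbrs E z) as [|a [|]]; try discriminate. simpl in *. intuition congruence.
Qed.

Lemma spine_nbr (n : nat) (E : graph) (p : list nat) (m u : nat) :
  spine n E p -> m < length p -> adj E u (nth m p 0) ->
  (1 <= m /\ u = nth (m - 1) p 0) \/ (S m < length p /\ u = nth (S m) p 0) \/
  leaf_of E u (nth m p 0).
Proof.
  intros S Hm A. destruct (adj_valid n E _ _ (spine_valid S) A) as (Hu & Hv & _).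
  destruct (le_lt_dec 2 (deg E u)) as [D | D].
  - assert (I : In u p) by (apply (spine_mem S); auto).
    apply (In_nth _ _ 0) in I as (j & Hj & <-).
    apply (spine_adj S) in A; [|assumption..]. destruct A as [-> | ->].
    + left. split; [lia|]. f_equal. lia.
    + right; left. auto.
  - right; right. apply deg1_leaf_of; auto.
    generalize (spine_deg_pos S u Hu). lia.
Qed.

Lemma spine_inj (n : nat) (E : graph) (p : list nat) (i j : nat) :
  spine n E p -> i < length p -> j < length p -> nth i p 0 = nth j p 0 -> i = j.
Proof. intros S Hi Hj. now apply (proj1 (NoDup_nth p 0) (spine_nodup S)). Qed.

Lemma leaf_of_deg (n : nat) (E : graph) (z u : nat) :
  valid_input n E -> leaf_of E z u -> deg E z = 1.
Proof.
  intros V [A L]. destruct (adj_valid n E _ _ V A) as (Hz & Hu & _).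
  apply (is_leaf_deg n); auto. exists u. repeat split; auto using adj_sym.
Qed.

Lemma leaf_of_not_spine (n : nat) (E : graph) (p : list nat) (z u : nat) (m : nat) :
  spine n E p -> m < length p -> leaf_of E z u -> z <> nth m p 0.
Proof.
  intros S Hm L ->. apply (leaf_of_deg n) in L; [|apply S].
  assert (I : In (nth m p 0) p) by now apply nth_In. apply (spine_mem S) in I. lia.
Qed.

Lemma spine_lt (n : nat) (E : graph) (p : list nat) (m : nat) :
  spine n E p -> m < length p -> nth m p 0 < n.
Proof. intros S Hm. apply (spine_mem S). now apply nth_In. Qed.

(** * Necessity: the two obstructions *)

(** Disks scaled to diameter 1, so that touching means distance 1 between centres. *)
Definition unit_rep (n : nat) (E : graph) (x : nat -> R * R) : Prop :=
  forall u v, u < n -> v < n -> u <> v ->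
    (1 <= sqdist (x u) (x v))%R /\ (sqdist (x u) (x v) = 1%R <-> adj E u v).

Lemma UDC_unit_rep (n : nat) (E : graph) : UDC n E -> exists x, unit_rep n E x.
Proof.
  intros (r & c & Hr & H). exists (fun v => (fst (c v) / (2 * r), snd (c v) / (2 * r))%R).
  intros u v Hu Hv Huv. destruct (H u v Hu Hv Huv) as [H1 H2]. rewrite <- H2.
  assert (P : (0 < (2 * r) ^ 2)%R) by (apply pow_lt; lra).
  assert (E1 : sqdist (fst (c u) / (2 * r), snd (c u) / (2 * r))%R (fst (c v) / (2 * r), snd (c v) / (2 * r))%R
     = (sqdist (c u) (c v) / (2 * r) ^ 2)%R) by (unfold sqdist; simpl fst; simpl snd; field; lra).
  rewrite E1. split; [|split].
  - apply Rmult_le_reg_r with ((2 * r) ^ 2)%R; [assumption|].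
    unfold Rdiv. rewrite Rmult_assoc, Rinv_l; lra.
  - intros Q. apply (Rmult_eq_compat_r ((2 * r) ^ 2)%R) in Q.
    unfold Rdiv in Q. rewrite Rmult_assoc, Rinv_l in Q; lra.
  - intros ->. field. lra.
Qed.

Lemma unit_rep_far (n : nat) (E : graph) (x : nat -> R * R) (u v : nat) :
  unit_rep n E x -> u < n -> v < n -> u <> v -> ~ adj E u v -> (1 < sqdist (x u) (x v))%R.
Proof.
  intros U Hu Hv Huv N. destruct (U u v Hu Hv Huv) as [[H | H] H2]; [assumption|].
  exfalso. apply N, H2. auto.
Qed.

Lemma unit_rep_adj (n : nat) (E : graph) (x : nat -> R * R) (u v : nat) :
  valid_input n E -> unit_rep n E x -> adj E u v -> sqdist (x u) (x v) = 1%R.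
Proof. intros V U A. destruct (adj_valid n E _ _ V A) as (Hu & Hv & Huv). now apply U. Qed.

(** The absence of triangles is what makes all separations at a spine vertex strict. A leaf has no
    second neighbour, and distinct path neighbours have indices that differ by 2. *)
Lemma nbrs_indep (n : nat) (E : graph) (p : list nat) (m u w : nat) :
  spine n E p -> m < length p -> adj E u (nth m p 0) -> adj E w (nth m p 0) -> ~ adj E u w.
Proof.
  intros HS Hm Hu Hw A.
  assert (B : forall a b, adj E b (nth m p 0) -> adj E a b -> leaf_of E a (nth m p 0) -> False).
  { intros a b Hb Hab [_ L]. apply L in Hab. subst.
    apply (adj_valid n E) in Hb; [tauto | apply HS]. }
  destruct (spine_nbr n E p m u HS Hm Hu) as [(H1 & Eu) | [(H1 & Eu) | L]];
    [| | now apply (B u w)];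
  (destruct (spine_nbr n E p m w HS Hm Hw) as [(H2 & Ew) | [(H2 & Ew) | L]];
    [| | now apply (B w u); auto using adj_sym]);
  rewrite Eu, Ew in A; apply (spine_adj HS) in A; lia.
Qed.

Lemma nth_map_nbrs_far (n : nat) (E : graph) (p : list nat) (x : nat -> R * R)
    (m : nat) (l : list nat) (d : R * R) :
  spine n E p -> unit_rep n E x -> m < length p -> NoDup l ->
  (forall u, In u l -> adj E u (nth m p 0)) ->
  forall i j, i < j < length (map x l) -> (1 < sqdist (nth i (map x l) d) (nth j (map x l) d))%R.
Proof.
  intros HS U Hm ND Hl i j Hij. rewrite length_map in Hij.
  rewrite !(nth_indep _ d (x 0)) by (rewrite length_map; lia). rewrite !map_nth.
  assert (Ii : In (nth i l 0) l) by (apply nth_In; lia).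
  assert (Ij : In (nth j l 0) l) by (apply nth_In; lia).
  apply (unit_rep_far n E); auto.
  - apply (adj_valid n E _ _ (spine_valid HS) (Hl _ Ii)).
  - apply (adj_valid n E _ _ (spine_valid HS) (Hl _ Ij)).
  - intros Q. apply (proj1 (NoDup_nth l 0) ND) in Q; lia.
  - apply (nbrs_indep n E p m); auto.
Qed.

Lemma not_UDC_deg6 (n : nat) (E : graph) (p : list nat) (m : nat) :
  spine n E p -> m < length p -> 6 <= deg E (nth m p 0) -> ~ UDC n E.
Proof.
  intros HS Hm Hd H. apply UDC_unit_rep in H as (x & U).
  assert (V := spine_valid HS). unfold deg in Hd.
  assert (ND := NoDup_nbrs n E (nth m p 0) V).
  set (l := firstn 6 (nbrs E (nth m p 0))).
  assert (Hl : forall u, In u l -> adj E u (nth m p 0)).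
  { intros u Hu. apply in_nbrs. unfold l in Hu.
    rewrite <- (firstn_skipn 6). apply in_or_app. now left. }
  assert (NDl : NoDup l).
  { unfold l. rewrite <- (firstn_skipn 6) in ND. now apply NoDup_app_remove_r in ND. }
  assert (Ll : length l = 6) by (unfold l; rewrite length_firstn; lia).
  destruct l as [|f qs]; [discriminate|]. inversion NDl as [|? ? Nf NDq]; subst.
  apply (star_six (x (nth m p 0)) (x f) (map x qs)).
  - rewrite sqdist_sym. apply (unit_rep_adj n E); auto. apply Hl. now left.
  - rewrite length_map. simpl in Ll. lia.
  - intros q Hq. apply in_map_iff in Hq as (u & <- & Hu). split.
    + rewrite sqdist_sym. apply (unit_rep_adj n E); auto. apply Hl. now right.
    + assert (Au := Hl u (or_intror Hu)). assert (Af := Hl f (or_introl eq_refl)).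
      apply (unit_rep_far n E); auto.
      * apply (adj_valid n E _ _ V Au).
      * apply (adj_valid n E _ _ V Af).
      * congruence.
      * apply (nbrs_indep n E p m); auto.
  - apply (nth_map_nbrs_far n E p x m); auto. intros u Hu. apply Hl. now right.
Qed.

(* Vertices whose disks may block positions next to the spine edge from [p_j] to [p_(j+1)]. *)
Definition obstacle (E : graph) (p : list nat) (j z : nat) : Prop :=
  (exists m, m < j /\ z = nth m p 0) \/ (exists m, m <= j /\ leaf_of E z (nth m p 0)).

(** Obstacles lie behind the edge, while [q] is the next path vertex or a leaf of [p_(j+1)]. Such
    pairs are never adjacent, which supplies the strict inequalities that [tight_pass] and
    [tight_end] ask for. *)
Lemma obstacle_far (n : nat) (E : graph) (p : list nat) (j z q : nat) :
  spine n E p -> S j < length p -> obstacle E p j z -> adj E q (nth (S j) p 0) ->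
  q <> nth j p 0 ->
  z < n /\ z <> nth j p 0 /\ z <> nth (S j) p 0 /\ z <> q /\ ~ adj E z q.
Proof.
  intros HS Hj Hz Hq Nq. assert (V := spine_valid HS).
  assert (Q : (S (S j) < length p /\ q = nth (S (S j)) p 0) \/ leaf_of E q (nth (S j) p 0)).
  { destruct (spine_nbr n E p (S j) q HS Hj Hq) as [(H1 & Eq) | [(H1 & Eq) | L]]; auto.
    exfalso. apply Nq. rewrite Eq. f_equal. lia. }
  destruct Hz as [(m & Hm & ->) | (m & Hm & L)].
  - repeat split.
    + apply (spine_lt n E p); auto; lia.
    + intros Q'. apply (spine_inj n E) in Q'; auto; lia.
    + intros Q'. apply (spine_inj n E) in Q'; auto; lia.
    + destruct Q as [(H1 & ->) | L]; intros Q'.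
      * apply (spine_inj n E) in Q'; auto; lia.
      * symmetry in Q'. apply (leaf_of_not_spine n E p _ _ m HS) in L; auto; lia.
    + destruct Q as [(H1 & ->) | [L1 L2]]; intros A.
      * apply (spine_adj HS) in A; lia.
      * apply adj_sym, L2 in A. apply (spine_inj n E) in A; auto; lia.
  - assert (LL := L). destruct LL as [L1 L2]. repeat split.
    + apply (adj_valid n E _ _ V L1).
    + apply (leaf_of_not_spine n E p _ (nth m p 0)); auto; lia.
    + apply (leaf_of_not_spine n E p _ (nth m p 0)); auto; lia.
    + intros ->. apply L2 in Hq. apply (spine_inj n E) in Hq; auto; lia.
    + intros A. apply L2 in A. destruct Q as [(H1 & ->) | Lq].
      * apply (spine_inj n E) in A; auto; lia.
      * apply (leaf_of_not_spine n E p q (nth (S j) p 0) m HS); auto; lia.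
Qed.

Definition obstacle_pts (E : graph) (p : list nat) (x : nat -> R * R) (j : nat) (y : R * R) : Prop :=
  exists z, obstacle E p j z /\ y = x z.

Lemma tight_mono (O O' : R * R -> Prop) (v d : R * R) :
  (forall y, O y -> O' y) -> tight O v d -> tight O' v d.
Proof.
  intros H (a & b & ? & ? & ? & B1 & B2). exists a, b. repeat split; auto.
  - eapply blocked_mono; [exact H | exact B1].
  - eapply blocked_mono; [exact H | exact B2].
Qed.

Lemma nbr_obstacle (n : nat) (E : graph) (p : list nat) (j u : nat) :
  spine n E p -> j < length p -> adj E u (nth j p 0) -> (S j < length p -> u <> nth (S j) p 0) ->
  obstacle E p j u.
Proof.
  intros HS Hj A N. destruct (spine_nbr n E p j u HS Hj A) as [(H1 & ->) | [(H1 & Eu) | L]].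
  - left. exists (j - 1). split; [lia | reflexivity].
  - now apply N in Eu.
  - right. now exists j.
Qed.

Lemma not_UDC_pair (n : nat) (E : graph) (p : list nat) (i j : nat) :
  spine n E p -> i < j < length p -> deg E (nth i p 0) = 5 -> deg E (nth j p 0) = 5 ->
  (forall k, i < k < j -> deg E (nth k p 0) = 4) -> ~ UDC n E.
Proof.
  intros HS Hij Di Dj Dk H. apply UDC_unit_rep in H as (x & U).
  assert (V := spine_valid HS).
  assert (LT : forall u w, adj E u w -> u < n) by (intros u w A; apply (adj_valid n E _ _ V A)).
  assert (SP : forall a w l, adj E a w -> Permutation (nbrs E w) (a :: l) ->
     NoDup l /\ ~ In a l /\ forall u, In u l -> adj E u w).
  { intros a w l A P. assert (ND := NoDup_nbrs n E w V).
    rewrite P in ND. inversion ND; subst. repeat split; auto.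
    intros u Hu. apply in_nbrs. rewrite P. now right. }
  assert (IV : forall a w, adj E a w -> exists l, Permutation (nbrs E w) (a :: l)).
  { intros a w A. apply in_nbrs, in_split in A as (l1 & l2 & ->). exists (l1 ++ l2).
    symmetry. apply Permutation_middle. }
  assert (NX : forall k, S k < length p -> adj E (nth (S k) p 0) (nth k p 0)).
  { intros k Hk. apply (spine_adj HS); lia. }
  assert (OF : forall k y q, S k < length p -> obstacle_pts E p x k y ->
     adj E q (nth (S k) p 0) -> q <> nth k p 0 ->
     (1 <= sqdist y (x (nth k p 0%nat)) /\ 1 <= sqdist y (x (nth (S k) p 0%nat)) /\ 1 < sqdist y (x q))%R).
  { intros k y q Hk (z & Hz & ->) Hq Nq.
    destruct (obstacle_far n E p k z q HS Hk Hz Hq Nq) as (B0 & B1 & B2 & B3 & B4).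
    split; [|split].
    - apply U; auto. apply (spine_lt n E p); auto; lia.
    - apply U; auto. apply (spine_lt n E p); auto; lia.
    - apply (unit_rep_far n E); auto. now apply (LT q (nth (S k) p 0)). }
  (* Every edge from the first vertex of degree 5 up to the second one is tight, by induction on the
     distance from [p_i]. *)
  assert (T : forall k, i <= k < j ->
     tight (obstacle_pts E p x k) (x (nth k p 0)) (dir (x (nth k p 0)) (x (nth (S k) p 0)))).
  { intros k Hk. replace k with (i + (k - i)) in * by lia. generalize (k - i) as e, Hk. clear k Hk.
    intros e. induction e as [|e IH]; intros Hk.
    - rewrite Nat.add_0_r in *. assert (An : adj E (nth (S i) p 0) (nth i p 0)) by (apply NX; lia).
      destruct (IV _ _ An) as (l & P). destruct (SP _ _ _ An P) as (ND & NI & Al).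
      eapply tight_mono; [| apply (tight_start (x (nth i p 0)) (x (nth (S i) p 0)) (map x l))].
      + intros y Hy. apply in_map_iff in Hy as (z & <- & Hz). exists z. split; [|reflexivity].
        apply (nbr_obstacle n); auto; [lia|]. intros _. congruence.
      + apply (unit_rep_adj n E); auto using adj_sym.
      + rewrite length_map. unfold deg in Di. apply Permutation_length in P. simpl in P. lia.
      + intros q Hq. apply in_map_iff in Hq as (u & <- & Hu). split.
        * apply (unit_rep_adj n E); auto using adj_sym.
        * apply (unit_rep_far n E); auto.
          -- eauto.
          -- eauto.
          -- congruence.
          -- apply (nbrs_indep n E p i); auto. lia.
      + apply (nth_map_nbrs_far n E p x i); auto. lia.
    - replace (i + S e) with (S (i + e)) in * by lia. set (k := i + e) in *.
      specialize (IH ltac:(lia)).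
      assert (Hb : adj E (nth k p 0) (nth (S k) p 0)) by (apply adj_sym, NX; lia).
      assert (Hf : adj E (nth (S (S k)) p 0) (nth (S k) p 0)) by (apply NX; lia).
      assert (Nbf : nth (S (S k)) p 0 <> nth k p 0).
      { intros Q. apply (spine_inj n E) in Q; auto; lia. }
      destruct (IV _ _ Hb) as (l & P). destruct (SP _ _ _ Hb P) as (ND & NI & Al).
      assert (If : In (nth (S (S k)) p 0) l).
      { apply in_nbrs in Hf. rewrite P in Hf. destruct Hf; [congruence | assumption]. }
      apply in_split in If as (l1 & l2 & ->).
      assert (P2 : Permutation (l1 ++ nth (S (S k)) p 0 :: l2) (nth (S (S k)) p 0 :: (l1 ++ l2)))
        by (symmetry; apply Permutation_middle).
      assert (L : length (l1 ++ l2) = 2).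
      { rewrite P2 in P. apply Permutation_length in P. fold (deg E (nth (S k) p 0)) in P.
        rewrite Dk in P by lia. simpl in P. lia. }
      rewrite P2 in ND. inversion ND as [|? ? NI2 ND2]; subst.
      assert (Al2 : forall u, In u (l1 ++ l2) -> adj E u (nth (S k) p 0)).
      { intros u Hu. apply Al. rewrite P2. now right. }
      assert (NI3 : ~ In (nth k p 0) (l1 ++ l2)).
      { intros Q. apply NI. rewrite P2. now right. }
      (* Degree 4 leaves exactly two neighbours [a] and [b] besides the path vertices before and
         after. *)
      destruct (l1 ++ l2) as [|a [|b [|]]]; try discriminate.
      assert (Aa : adj E a (nth (S k) p 0)) by (apply Al2; simpl; auto).
      assert (Ab : adj E b (nth (S k) p 0)) by (apply Al2; simpl; auto).
      assert (Nab : a <> b) by (intros ->; inversion ND2 as [|? ? Q]; apply Q; now left).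
      assert (FAR : forall u w, adj E u (nth (S k) p 0) -> adj E w (nth (S k) p 0) -> u <> w ->
         (1 < sqdist (x u) (x w))%R).
      { intros u w Hu Hw Huw. apply (unit_rep_far n E); eauto.
        apply (nbrs_indep n E p (S k)); auto. lia. }
      simpl in NI2, NI3.
      eapply tight_mono; [| apply (tight_pass (obstacle_pts E p x k) (x (nth k p 0))
        (x (nth (S k) p 0)) (x (nth (S (S k)) p 0)) (x a) (x b))].
      + intros y [(z & Hz & ->) | [-> | [-> | ->]]].
        * exists z. split; [|reflexivity].
          destruct Hz as [(m & Hm & ->) | (m & Hm & Lz)];
            [left; exists m | right; exists m]; split; auto; lia.
        * exists (nth k p 0). split; [|reflexivity]. left. exists k. split; [lia | reflexivity].
        * exists a. split; [|reflexivity]. apply (nbr_obstacle n); auto; try lia; intros _ Q; apply NI2; auto.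
        * exists b. split; [|reflexivity]. apply (nbr_obstacle n); auto; try lia; intros _ Q; apply NI2; auto.
      + apply (unit_rep_adj n E); auto.
      + exact IH.
      + apply (unit_rep_adj n E); auto using adj_sym.
      + apply (unit_rep_adj n E); auto using adj_sym.
      + apply (unit_rep_adj n E); auto using adj_sym.
      + apply FAR; auto.
      + apply FAR; auto.
      + apply FAR; auto.
      + apply FAR; auto.
      + apply FAR; auto.
      + apply FAR; auto.
      + intros y Hy.
        destruct (OF k y (nth (S (S k)) p 0) ltac:(lia) Hy Hf Nbf) as (F1 & F2 & F3).
        destruct (OF k y a ltac:(lia) Hy Aa ltac:(auto)) as (_ & _ & F4).
        destruct (OF k y b ltac:(lia) Hy Ab ltac:(auto)) as (_ & _ & F5). auto. }
  destruct j as [|k]; [lia|].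
  specialize (T k ltac:(lia)).
  assert (Hb : adj E (nth k p 0) (nth (S k) p 0)) by (apply adj_sym, NX; lia).
  destruct (IV _ _ Hb) as (l & P). destruct (SP _ _ _ Hb P) as (ND & NI & Al).
  apply (tight_end (obstacle_pts E p x k) (x (nth k p 0)) (x (nth (S k) p 0)) (map x l)).
  - apply (unit_rep_adj n E); auto.
  - exact T.
  - rewrite length_map. unfold deg in Dj. apply Permutation_length in P. simpl in P. lia.
  - intros q Hq. apply in_map_iff in Hq as (u & <- & Hu). split.
    + apply (unit_rep_adj n E); auto using adj_sym.
    + apply (unit_rep_far n E); eauto; [congruence|]. apply (nbrs_indep n E p (S k)); auto. lia.
  - apply (nth_map_nbrs_far n E p x (S k)); auto. lia.
  - intros y Hy.
    assert (G : forall u, In u l -> _) by (intros u Hu; exact (OF k y u ltac:(lia) Hy (Al u Hu) ltac:(congruence))).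
    destruct l as [|u l']; [apply Permutation_length in P; unfold deg in Dj; simpl in P; lia|].
    destruct (G u (or_introl eq_refl)) as (F1 & F2 & _). repeat split; auto.
    intros q Hq. apply in_map_iff in Hq as (w & <- & Hw). now apply G.
Qed.

(* State of the notch above the [j]-th spine edge: a spine vertex of degree 5 needs the notches on
   both of its sides, one of degree 4 needs one of them, and any other vertex needs none. *)
Fixpoint phase (E : graph) (p : list nat) (j : nat) : bool :=
  match j with
  | O => false
  | S i => if 4 <? deg E (nth i p 0) then true
           else if deg E (nth i p 0) <? 4 then false else phase E p i
  end.

(** A vertex of degree 5 also needs the notch on its left, which must not be assigned to the vertex
    before it. *)
Definition fits (E : graph) (p : list nat) (i : nat) : Prop :=
  deg E (nth i p 0) <= 5 /\ (4 < deg E (nth i p 0) -> phase E p i = false).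

(** * Sufficiency: assigning the leaves to slots *)

(** Path positions are shifted by one: [p_i] sits at [SV (S i)], so that [SV 0] and the position
    after the last vertex can hold leaves of the two end vertices. The last entry is the place of
    [p_(i+1)], and available to a leaf only if [p_i] is the last vertex. *)
Definition slots (E : graph) (p : list nat) (i : nat) : list slot :=
  (if i =? 0 then [SV 0] else []) ++ (if phase E p i then [] else [ST i]) ++ [SB (S i)] ++
  (if phase E p (S i) then [ST (S i)] else []) ++ [SV (S (S i))].

Definition par (E : graph) (v : nat) : nat := hd 0 (nbrs E v).

Definition leaves_below (E : graph) (v u : nat) : list nat :=
  filter (fun z => (deg E z <? 2) && (par E z =? u)) (seq 0 v).

(** Leaves of one vertex are numbered by increasing index, the order in which the program meets
    them. *)
Definition rank (E : graph) (v : nat) : nat := length (leaves_below E v (par E v)).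

Definition placed (E : graph) (p : list nat) (v : nat) (s : slot) : Prop :=
  exists i, i < length p /\
    ((v = nth i p 0 /\ s = SV (S i)) \/
     (leaf_of E v (nth i p 0) /\ s = nth (rank E v) (slots E p i) (SV 0))).

Lemma leaf_of_par (n : nat) (E : graph) (v u : nat) :
  valid_input n E -> leaf_of E v u -> par E v = u.
Proof.
  intros V L. assert (D := leaf_of_deg n E v u V L). destruct L as [A _].
  apply adj_sym, in_nbrs in A. unfold par, deg in *.
  destruct (nbrs E v) as [|a [|]]; try discriminate. simpl in *. intuition.
Qed.

Lemma leaves_below_count (n : nat) (E : graph) (p : list nat) (i : nat) :
  spine n E p -> i < length p ->
  length (leaves_below E n (nth i p 0)) + (if i =? 0 then 0 else 1) + (if S i <? length p then 1 else 0)
  <= deg E (nth i p 0).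
Proof.
  intros HS Hi. assert (V := spine_valid HS).
  set (l1 := if i =? 0 then [] else [nth (i - 1) p 0]).
  set (l2 := if S i <? length p then [nth (S i) p 0] else []).
  assert (L : length (leaves_below E n (nth i p 0) ++ l1 ++ l2) <= deg E (nth i p 0)).
  { apply NoDup_incl_length.
    - assert (D : forall z, In z (leaves_below E n (nth i p 0)) -> In z p -> False).
      { intros z Hz Hp. apply filter_In in Hz as [_ Hz]. apply andb_prop in Hz as [Hz _].
        apply Nat.ltb_lt in Hz. apply (spine_mem HS) in Hp. lia. }
      assert (I1 : forall z, In z l1 -> i <> 0 /\ z = nth (i - 1) p 0).
      { intros z. unfold l1. destruct (Nat.eqb_spec i 0); simpl; intuition. }
      assert (I2 : forall z, In z l2 -> S i < length p /\ z = nth (S i) p 0).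
      { intros z. unfold l2. destruct (Nat.ltb_spec (S i) (length p)); simpl; intuition. }
      apply NoDup_app.
      + apply NoDup_filter, seq_NoDup.
      + apply NoDup_app.
        * unfold l1. destruct (i =? 0); repeat constructor; simpl; tauto.
        * unfold l2. destruct (S i <? length p); repeat constructor; simpl; tauto.
        * intros z H1 H2. apply I1 in H1 as [? ->]. apply I2 in H2 as [? H2].
          apply (spine_inj n E) in H2; auto; lia.
      + intros z H1 H2. apply (D z H1). apply in_app_or in H2 as [H2 | H2].
        * apply I1 in H2 as [? ->]. apply nth_In. lia.
        * apply I2 in H2 as [? ->]. apply nth_In. lia.
    - intros z Hz. apply in_app_or in Hz as [Hz | Hz].
      + apply filter_In in Hz as [Hz1 Hz]. apply andb_prop in Hz as [Hz2 Hz].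
        apply Nat.eqb_eq in Hz. apply in_seq in Hz1.
        apply in_nbrs, adj_sym, in_nbrs. rewrite <- Hz. unfold par.
        assert (P := spine_deg_pos HS z ltac:(lia)). unfold deg in P.
        destruct (nbrs E z); simpl in *; [lia | auto].
      + apply in_nbrs. unfold l1, l2 in Hz.
        destruct (Nat.eqb_spec i 0); destruct (Nat.ltb_spec (S i) (length p)); simpl in Hz;
          intuition subst; apply (spine_adj HS); lia. }
  rewrite !length_app in L. unfold l1, l2 in L.
  destruct (i =? 0), (S i <? length p); simpl in L; lia.
Qed.

Lemma leaves_below_lt (E : graph) (a b u : nat) :
  a < b -> deg E a < 2 -> par E a = u ->
  length (leaves_below E a u) < length (leaves_below E b u).
Proof.
  intros H D P. unfold leaves_below. replace b with (a + S (b - S a)) by lia.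
  rewrite seq_app, filter_app, length_app. simpl.
  apply Nat.ltb_lt in D. rewrite D. apply Nat.eqb_eq in P. rewrite P. simpl. lia.
Qed.

Definition usable (E : graph) (p : list nat) (i : nat) (s : slot) : Prop :=
  s = SB (S i) \/ (s = ST i /\ phase E p i = false) \/ (s = ST (S i) /\ phase E p (S i) = true) \/
  (s = SV 0 /\ i = 0) \/ (s = SV (S (length p)) /\ S i = length p).

Lemma NoDup_slots (E : graph) (p : list nat) (i : nat) : NoDup (slots E p i).
Proof.
  unfold slots. destruct (i =? 0), (phase E p i), (phase E p (S i)); simpl;
    repeat constructor; simpl; intuition (try congruence; try discriminate);
  match goal with H : ST _ = ST _ |- _ => injection H; lia | H : SV _ = SV _ |- _ => injection H; lia end.
Qed.

(** The number of slots follows the phases on both sides of [p_i]. Away from the left end it is four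
    for degree 5, three for degree 4 and at least two for smaller degrees, counting the last entry,
    which is withheld from the leaves while a further spine vertex exists. *)
Lemma rank_usable (n : nat) (E : graph) (p : list nat) (i v : nat) :
  spine n E p -> i < length p -> fits E p i -> v < n -> leaf_of E v (nth i p 0) ->
  rank E v < length (slots E p i) /\ usable E p i (nth (rank E v) (slots E p i) (SV 0)).
Proof.
  intros HS Hi [F1 F2] Hv L. assert (V := spine_valid HS).
  assert (R : rank E v < length (leaves_below E n (nth i p 0))).
  { unfold rank. rewrite (leaf_of_par n E v _ V L). apply leaves_below_lt; auto.
    - rewrite (leaf_of_deg n E v _ V L). lia.
    - now apply (leaf_of_par n). }
  assert (C := leaves_below_count n E p i HS Hi).
  assert (Q : rank E v < length (slots E p i) - (if S i <? length p then 1 else 0)).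
  { unfold slots. simpl phase in *. rewrite !length_app. simpl.
    destruct (Nat.ltb_spec 4 (deg E (nth i p 0))) as [D | D].
    - rewrite (F2 D). destruct (i =? 0), (S i <? length p); simpl; lia.
    - destruct (Nat.ltb_spec (deg E (nth i p 0)) 4) as [D' | D'];
        destruct (phase E p i), (i =? 0), (S i <? length p); simpl; lia. }
  split; [lia|].
  assert (I : In (nth (rank E v) (slots E p i) (SV 0)) (slots E p i)) by (apply nth_In; lia).
  assert (N : S i < length p -> nth (rank E v) (slots E p i) (SV 0) <> SV (S (S i))).
  { intros HK. apply Nat.ltb_lt in HK. rewrite HK in Q. intros Eq.
    assert (Z : nth (length (slots E p i) - 1) (slots E p i) (SV 0) = SV (S (S i))).
    { assert (G : forall l x, nth (length (l ++ [x]) - 1) (l ++ [x]) (SV 0) = x).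
      { intros l x. rewrite length_app, Nat.add_sub. apply nth_middle. }
      unfold slots. rewrite !app_assoc. apply G. }
    rewrite <- Z in Eq. apply (proj1 (NoDup_nth _ _) (NoDup_slots E p i)) in Eq; lia. }
  set (s := nth (rank E v) (slots E p i) (SV 0)) in *. clearbody s.
  unfold slots in I. unfold usable.
  rewrite !in_app_iff in I.
  destruct I as [I | [I | [I | [I | I]]]].
  - destruct (Nat.eqb_spec i 0); simpl in I; intuition.
  - destruct (phase E p i); simpl in I; intuition.
  - simpl in I; intuition.
  - destruct (phase E p (S i)); simpl in I; intuition.
  - destruct I as [I | []]. subst s. destruct (Nat.lt_ge_cases (S i) (length p)) as [HK | HK].
    + now apply N in HK.
    + right; right; right; right. split; [f_equal|]; lia.
Qed.

Lemma usable_inj (E : graph) (p : list nat) (i j : nat) (s : slot) :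
  usable E p i s -> usable E p j s -> i = j.
Proof.
  unfold usable.
  intros [-> | [[-> A] | [[-> A] | [[-> A] | [-> A]]]]] [B | [[B B'] | [[B B'] | [[B B'] | [B B']]]]];
    try discriminate; try injection B; intros; subst; try lia; try congruence.
Qed.

Lemma usable_touch_spine (E : graph) (p : list nat) (i k : nat) (s : slot) :
  i < length p -> k < length p -> usable E p i s ->
  (touch (phase E p) (SV (S k)) s <-> k = i) /\ s <> SV (S k).
Proof.
  unfold usable.
  intros Hi Hk [-> | [[-> A] | [[-> A] | [[-> A] | [-> A]]]]]; cbn [touch]; rewrite ?A; split;
    try (intros Q; injection Q); try discriminate; try (split; intros); try lia.
Qed.

Lemma usable_not_touch (E : graph) (p : list nat) (i j : nat) (s s' : slot) :
  i < length p -> j < length p -> usable E p i s -> usable E p j s' -> ~ touch (phase E p) s s'.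
Proof.
  unfold usable.
  intros Hi Hj [-> | [[-> A] | [[-> A] | [[-> A] | [-> A]]]]] [-> | [[-> B] | [[-> B] | [[-> B] | [-> B]]]]];
    cbn [touch]; rewrite ?A, ?B; intros Q; try tauto; lia.
Qed.

Lemma usable_index (E : graph) (p : list nat) (i : nat) (s : slot) :
  i < length p -> usable E p i s -> slot_index s <= S (length p).
Proof. unfold usable. intros Hi [-> | [[-> A] | [[-> A] | [[-> A] | [-> A]]]]]; simpl; lia. Qed.

Lemma touch_sym (ph : nat -> bool) (a b : slot) : touch ph a b -> touch ph b a.
Proof. destruct a, b; simpl; tauto. Qed.

Lemma spine_length_le (n : nat) (E : graph) (p : list nat) : spine n E p -> length p <= n.
Proof.
  intros HS. rewrite <- (length_seq n 0). apply NoDup_incl_length; [apply HS|].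
  intros v Hv. apply (spine_mem HS) in Hv. apply in_seq. lia.
Qed.

Lemma placed_udc_rep (n : nat) (E : graph) (p : list nat) (c : nat -> R * R) :
  spine n E p -> 1 <= n -> (forall i, i < length p -> fits E p i) ->
  (forall v, v < n -> exists s, placed E p v s /\ c v = place (1 / (10 * INR n))%R (phase E p) s) ->
  udc_rep n E (1 / 2)%R c.
Proof.
  intros HS Hn HF HC. split; [lra|].
  assert (V := spine_valid HS).
  set (w := (1 / (10 * INR n))%R) in *.
  assert (Hn' : (1 <= INR n)%R) by (apply (le_INR 1); lia).
  assert (Hw : (0 < w <= 1 / 10)%R).
  { unfold w. split; [apply Rdiv_lt_0_compat; lra|].
    apply Rmult_le_reg_r with (10 * INR n)%R; [lra|]. field_simplify; lra. }
  (* At most n + 1 turns by 1/(10 n) add up to at most 1/5, the range in which [slot_positions]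
     holds. *)
  assert (HN : (INR (S (length p)) * w <= 1 / 5)%R).
  { assert (K : (INR (length p) <= INR n)%R) by (apply le_INR; now apply (spine_length_le n E)).
    rewrite S_INR. unfold w. apply Rmult_le_reg_r with (10 * INR n)%R; [lra|]. field_simplify; lra. }
  replace ((2 * (1 / 2)) ^ 2)%R with 1%R by field.
  assert (HP : forall u, u < n -> forall s, placed E p u s -> slot_index s <= S (length p) /\
    exists i, i < length p /\
    ((u = nth i p 0 /\ s = SV (S i)) \/
     (leaf_of E u (nth i p 0) /\ usable E p i s /\ s = nth (rank E u) (slots E p i) (SV 0) /\
      rank E u < length (slots E p i)))).
  { intros u Hu s (i & Hi & [[-> ->] | [L ->]]).
    - split; [simpl; lia|]. exists i. auto.
    - destruct (rank_usable n E p i u) as [R1 R2]; auto.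
      split; [now apply (usable_index E p i)|]. exists i. auto 7. }
  intros u v Hu Hv Huv.
  destruct (HC u Hu) as (s & Ps & ->). destruct (HC v Hv) as (s' & Ps' & ->).
  destruct (HP u Hu s Ps) as (Is & i & Hi & Cs).
  destruct (HP v Hv s' Ps') as (Is' & j & Hj & Cs'). clear HC HP Ps Ps'.
  assert (M : s <> s' /\ (touch (phase E p) s s' <-> adj E u v)).
  { destruct Cs as [[-> ->] | (L & Us & Es & Rs)], Cs' as [[-> ->] | (L' & Us' & Es' & Rs')].
    - split; [congruence|]. rewrite (spine_adj HS) by assumption. simpl. lia.
    - destruct (usable_touch_spine E p j i s' Hj Hi Us') as [T N]. split; [congruence|].
      rewrite T. split.
      + intros ->. apply adj_sym, L'.
      + intros A. apply adj_sym, L' in A. now apply (spine_inj n E p i j HS Hi Hj).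
    - destruct (usable_touch_spine E p i j s Hi Hj Us) as [T N]. split; [congruence|].
      split.
      + intros A. apply touch_sym, T in A. subst. apply L.
      + intros A. apply touch_sym, T. apply L in A. now apply (spine_inj n E p j i HS Hj Hi).
    - split.
      + intros <-. assert (i = j) by now apply (usable_inj E p i j s). subst j.
        rewrite Es in Es'. apply (proj1 (NoDup_nth _ _) (NoDup_slots E p i)) in Es'; try assumption.
        assert (P1 := leaf_of_par n E u _ V L). assert (P2 := leaf_of_par n E v _ V L').
        assert (D1 := leaf_of_deg n E u _ V L). assert (D2 := leaf_of_deg n E v _ V L').
        unfold rank in Es'. rewrite P1, P2 in Es'.
        destruct (Nat.lt_total u v) as [Q | [Q | Q]]; [|congruence|].
        * apply (leaves_below_lt E u v (nth i p 0)) in Q; lia.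
        * apply (leaves_below_lt E v u (nth i p 0)) in Q; lia.
      + split; intros A.
        * exfalso. revert A. now apply (usable_not_touch E p i j).
        * exfalso. apply L in A. apply (leaf_of_not_spine n E p v (nth j p 0) i HS Hi L'). assumption. }
  destruct M as [M1 M2]. rewrite <- M2. now apply (slot_positions w (phase E p) (S (length p))).
Qed.

(** Only degree 4 preserves the state, so a state true goes back to a vertex of degree above 4
    through vertices of degree 4. *)
Lemma phase_true (E : graph) (p : list nat) (j : nat) : phase E p j = true ->
  exists i, i < j /\ 4 < deg E (nth i p 0) /\ forall k, i < k < j -> deg E (nth k p 0) = 4.
Proof.
  induction j as [|j IH]; simpl; [discriminate|].
  destruct (Nat.ltb_spec 4 (deg E (nth j p 0))) as [D | D].
  - intros _. exists j. repeat split; auto; lia.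
  - destruct (Nat.ltb_spec (deg E (nth j p 0)) 4) as [D' | D']; [discriminate|].
    intros H. destruct (IH H) as (i & Hi & Di & Hk). exists i. repeat split; [lia | assumption |].
    intros k Hkj. destruct (Nat.eq_dec k j) as [-> | ?]; [lia | apply Hk; lia].
Qed.

(** A refusal at [p_i] is one of the two obstructions: a degree of 6 or more, or by [phase_true] a
    forbidden pair of vertices of degree 5. *)
Lemma UDC_fits (n : nat) (E : graph) (p : list nat) (i : nat) :
  spine n E p -> UDC n E -> i < length p -> fits E p i.
Proof.
  intros HS U Hi.
  assert (D : forall k, k < length p -> deg E (nth k p 0) <= 5).
  { intros k Hk. destruct (Nat.le_gt_cases (deg E (nth k p 0)) 5); [assumption|].
    exfalso. now apply (not_UDC_deg6 n E p k HS Hk). }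
  split; [now apply D|]. intros Hd. destruct (phase E p i) eqn:HP; [exfalso | reflexivity].
  apply phase_true in HP as (j & Hj & Dj & Hk).
  apply (not_UDC_pair n E p j i HS); auto.
  - generalize (D j ltac:(lia)). lia.
  - generalize (D i Hi). lia.
Qed.

(** * Structured programs for the RAM *)

Definition store : Type := ((nat -> Z) * (nat -> R))%type.

Inductive test : Type := TLt (a b : nat) | TZero (a : nat).

Inductive cmd : Type :=
| Block (l : list instr)
| Seq (a b : cmd)
| If (t : test) (a b : cmd)
| While (x y : nat) (c : cmd).

Definition straight (i : instr) : bool :=
  match i with Jmp _ | JZ _ _ | JLt _ _ _ | RJLt _ _ _ | Halt => false | _ => true end.

Definition run1 (s : store) (i : instr) : store :=
  let c := exec i (Cfg 0 (fst s) (snd s)) in (ireg c, rreg c).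

Definition run (l : list instr) (s : store) : store := fold_left run1 l s.

Definition holds (t : test) (s : store) : bool :=
  match t with TLt a b => Z.ltb (fst s a) (fst s b) | TZero a => Z.eqb (fst s a) 0 end.

(** The number is the exact count of machine steps of the compiled code: a false branch ends with a
    jump over the true one, each round of a loop pays for its test and the jump back, and leaving a
    loop costs the test and one jump. *)
Inductive ev : cmd -> store -> nat -> store -> Prop :=
| ev_block l s : forallb straight l = true -> ev (Block l) s (length l) (run l s)
| ev_seq a b s1 s2 s3 t1 t2 : ev a s1 t1 s2 -> ev b s2 t2 s3 -> ev (Seq a b) s1 (t1 + t2) s3
| ev_if_true t a b s s' k : holds t s = true -> ev a s k s' -> ev (If t a b) s (1 + k) s'
| ev_if_false t a b s s' k : holds t s = false -> ev b s k s' -> ev (If t a b) s (1 + (k + 1)) s'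
| ev_while_true x y c s s' s'' k k' : holds (TLt x y) s = true -> ev c s k s' ->
    ev (While x y c) s' k' s'' -> ev (While x y c) s (1 + (k + (1 + k'))) s''
| ev_while_false x y c s : holds (TLt x y) s = false -> ev (While x y c) s 2 s.

Definition jump (t : test) (l : nat) : instr :=
  match t with TLt a b => JLt a b l | TZero a => JZ a l end.

Fixpoint clen (c : cmd) : nat :=
  match c with
  | Block l => length l
  | Seq a b => clen a + clen b
  | If _ a b => 1 + clen b + 1 + clen a
  | While _ _ c => 2 + clen c + 1
  end.

(** Jump targets are absolute, hence the start address [k]. The false branch comes first, so that a
    successful test jumps past it. *)
Fixpoint compile (c : cmd) (k : nat) : program :=
  match c with
  | Block l => l
  | Seq a b => compile a k ++ compile b (k + clen a)
  | If t a b =>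
      jump t (k + 1 + clen b + 1) :: compile b (k + 1) ++
      Jmp (k + 1 + clen b + 1 + clen a) :: compile a (k + 1 + clen b + 1)
  | While x y c =>
      JLt x y (k + 2) :: Jmp (k + 2 + clen c + 1) :: compile c (k + 2) ++ [Jmp k]
  end.

Lemma length_compile (c : cmd) : forall k, length (compile c k) = clen c.
Proof.
  induction c; intros k; simpl; rewrite ?length_app; simpl; rewrite ?length_app, ?IHc, ?IHc1, ?IHc2; simpl; lia.
Qed.

Lemma steps_add (P : program) (a b : nat) : forall c c',
  steps P a c = Some c' -> steps P (a + b) c = steps P b c'.
Proof.
  induction a as [|a IH]; intros c c'; simpl; [now intros [= ->]|].
  destruct (step P c); [apply IH | discriminate].
Qed.

Definition at_pc (k : nat) (s : store) : cfg := Cfg k (fst s) (snd s).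

Definition code_at (P : program) (k : nat) (l : program) : Prop :=
  forall i, i < length l -> nth_error P (k + i) = nth_error l i.

Lemma code_at_app (P : program) (k : nat) (l1 l2 : program) :
  code_at P k (l1 ++ l2) -> code_at P k l1 /\ code_at P (k + length l1) l2.
Proof.
  intros H. split; intros i Hi.
  - rewrite H by (rewrite length_app; lia). now apply nth_error_app1.
  - rewrite <- Nat.add_assoc, H by (rewrite length_app; lia).
    rewrite nth_error_app2 by lia. f_equal. lia.
Qed.

Lemma code_at_cons (P : program) (k : nat) (i : instr) (l : program) :
  code_at P k (i :: l) -> nth_error P k = Some i /\ code_at P (k + 1) l.
Proof.
  intros H. split.
  - specialize (H 0). rewrite Nat.add_0_r in H. apply H. simpl. lia.
  - intros j Hj. rewrite <- Nat.add_assoc. apply (H (1 + j)). simpl. lia.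
Qed.

Lemma step_straight (P : program) (k : nat) (i : instr) (s : store) :
  nth_error P k = Some i -> straight i = true ->
  step P (at_pc k s) = Some (at_pc (k + 1) (run1 s i)).
Proof.
  intros H Hi. unfold step, at_pc. simpl pc. rewrite H, Nat.add_1_r.
  destruct i; simpl in Hi; try discriminate; reflexivity.
Qed.

Lemma step_jump (P : program) (k : nat) (t : test) (l : nat) (s : store) :
  nth_error P k = Some (jump t l) ->
  step P (at_pc k s) = Some (at_pc (if holds t s then l else k + 1) s).
Proof.
  intros H. unfold step, at_pc. simpl pc. rewrite H, Nat.add_1_r. now destruct t.
Qed.

Lemma step_Jmp (P : program) (k l : nat) (s : store) :
  nth_error P k = Some (Jmp l) -> step P (at_pc k s) = Some (at_pc l s).
Proof. intros H. unfold step, at_pc. simpl pc. now rewrite H. Qed.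

Lemma steps_block (P : program) (l : list instr) : forall k s,
  code_at P k l -> forallb straight l = true ->
  steps P (length l) (at_pc k s) = Some (at_pc (k + length l) (run l s)).
Proof.
  induction l as [|i l IH]; intros k s H Hs; simpl.
  - now rewrite Nat.add_0_r.
  - apply code_at_cons in H as [H1 H2]. simpl in Hs. apply andb_prop in Hs as [S1 S2].
    rewrite (step_straight P k i s H1 S1), IH by assumption.
    now replace (k + 1 + length l) with (k + S (length l)) by lia.
Qed.

Lemma compile_correct (P : program) (c : cmd) (s s' : store) (t : nat) : ev c s t s' ->
  forall k, code_at P k (compile c k) -> steps P t (at_pc k s) = Some (at_pc (k + clen c) s').
Proof.
  induction 1 as [l s Hl | a b s1 s2 s3 t1 t2 H1 IH1 H2 IH2 | t a b s s' n Ht H IH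
    | t a b s s' n Ht H IH | x y c s s1 s2 n n' Ht H1 IH1 H2 IH2 | x y c s Ht];
    intros k HC; simpl compile in HC; simpl clen.
  - now apply steps_block.
  - apply code_at_app in HC as [C1 C2]. rewrite length_compile in C2.
    rewrite (steps_add _ _ _ _ _ (IH1 k C1)), (IH2 _ C2). now rewrite Nat.add_assoc.
  - apply code_at_cons in HC as [C1 C2]. apply code_at_app in C2 as [_ C2].
    apply code_at_cons in C2 as [_ C2]. rewrite length_compile in C2.
    simpl steps. rewrite (step_jump _ _ _ _ _ C1), Ht, (IH _ C2). do 2 f_equal. lia.
  - apply code_at_cons in HC as [C1 C2]. apply code_at_app in C2 as [C2 C3].
    apply code_at_cons in C3 as [C3 _]. rewrite length_compile in C3.
    simpl steps. rewrite (step_jump _ _ _ _ _ C1), Ht.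
    rewrite (steps_add _ _ _ _ _ (IH _ C2)). simpl steps.
    rewrite (step_Jmp _ _ _ _ C3). do 2 f_equal. lia.
  - assert (HC' := HC). apply code_at_cons in HC as [C1 C2]. apply code_at_cons in C2 as [_ C2].
    apply code_at_app in C2 as [C2 C3]. apply code_at_cons in C3 as [C3 _].
    rewrite length_compile in C3. replace (k + 1 + 1) with (k + 2) in * by lia.
    simpl steps. rewrite (step_jump _ _ (TLt x y) _ _ C1), Ht.
    rewrite (steps_add _ _ _ _ _ (IH1 _ C2)). simpl steps.
    rewrite (step_Jmp _ _ _ _ C3). apply (IH2 k). exact HC'.
  - apply code_at_cons in HC as [C1 C2]. apply code_at_cons in C2 as [C2 _].
    simpl steps. rewrite (step_jump _ _ (TLt x y) _ _ C1), Ht, (step_Jmp _ _ _ _ C2). do 2 f_equal. lia.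
Qed.

(** The code contains no [Halt]: the machine stops because no instruction follows the last one. *)
Lemma compile_halts (c : cmd) (s s' : store) (t : nat) : ev c s t s' ->
  halts_in (compile c 0) t (at_pc 0 s) (at_pc (clen c) s').
Proof.
  intros H. split.
  - apply (compile_correct _ _ _ _ _ H 0). intros i _. reflexivity.
  - unfold step. simpl pc. replace (nth_error _ _) with (@None instr); [reflexivity|].
    symmetry. apply nth_error_None. rewrite length_compile. lia.
Qed.

(** Total-correctness triple with an upper bound [b] on the running time, replacing the exact counts
    of [ev]. *)
Definition does (c : cmd) (s : store) (b : nat) (Q : store -> Prop) : Prop :=
  exists t s', ev c s t s' /\ t <= b /\ Q s'.

Lemma does_block (l : list instr) (s : store) (Q : store -> Prop) :
  forallb straight l = true -> Q (run l s) -> does (Block l) s (length l) Q.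
Proof. intros H HQ. exists (length l), (run l s). split; [now constructor | auto]. Qed.

Lemma does_seq (a b : cmd) (s : store) (t1 t2 : nat) (Q1 Q : store -> Prop) :
  does a s t1 Q1 -> (forall s', Q1 s' -> does b s' t2 Q) -> does (Seq a b) s (t1 + t2) Q.
Proof.
  intros (k1 & s1 & E1 & L1 & H1) H2. destruct (H2 s1 H1) as (k2 & s2 & E2 & L2 & HQ).
  exists (k1 + k2), s2. split; [econstructor; eassumption | split; [lia | assumption]].
Qed.

Lemma does_if (t : test) (a b : cmd) (s : store) (k : nat) (Q : store -> Prop) :
  (holds t s = true -> does a s k Q) -> (holds t s = false -> does b s k Q) ->
  does (If t a b) s (k + 2) Q.
Proof.
  intros H1 H2. destruct (holds t s) eqn:E.
  - destruct (H1 eq_refl) as (k1 & s1 & E1 & L1 & HQ).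
    exists (1 + k1), s1. split; [now constructor | split; [lia | assumption]].
  - destruct (H2 eq_refl) as (k1 & s1 & E1 & L1 & HQ).
    exists (1 + (k1 + 1)), s1. split; [now apply ev_if_false | split; [lia | assumption]].
Qed.

Lemma does_weaken (c : cmd) (s : store) (b b' : nat) (Q Q' : store -> Prop) :
  does c s b Q -> b <= b' -> (forall s', Q s' -> Q' s') -> does c s b' Q'.
Proof. intros (t & s' & E & L & H) Hb HQ. exists t, s'. repeat split; auto. lia. Qed.

Lemma does_block_le (l : list instr) (s : store) (b : nat) (Q : store -> Prop) :
  forallb straight l = true -> length l <= b -> Q (run l s) -> does (Block l) s b Q.
Proof. intros H Hb HQ. apply does_weaken with (length l) Q; auto using does_block. Qed.

(** [Inv] is indexed by the number of completed rounds, and this index decides the test, so that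
    termination and time bound come together. *)
Lemma does_while (x y : nat) (c : cmd) (b N : nat) (Inv : nat -> store -> Prop) :
  (forall j s, j <= N -> Inv j s -> holds (TLt x y) s = (j <? N)) ->
  (forall j s, j < N -> Inv j s -> does c s b (Inv (S j))) ->
  forall s, Inv 0 s -> does (While x y c) s (N * (b + 2) + 2) (Inv N).
Proof.
  intros HT HB s H0.
  assert (G : forall d j s, j + d = N -> Inv j s -> does (While x y c) s (d * (b + 2) + 2) (Inv N)).
  { clear s H0. induction d as [|d IH]; intros j s Hj Hs.
    - rewrite Nat.add_0_r in Hj. subst j. exists 2, s. split; [|split; [simpl; lia | assumption]].
      constructor. rewrite (HT N s) by auto. apply Nat.ltb_irrefl.
    - destruct (HB j s) as (k1 & s1 & E1 & L1 & I1); [lia | assumption |].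
      destruct (IH (S j) s1) as (k2 & s2 & E2 & L2 & I2); [lia | assumption |].
      exists (1 + (k1 + (1 + k2))), s2. split; [|split; [simpl; lia | assumption]].
      eapply ev_while_true; eauto. rewrite (HT j s) by (auto; lia). apply Nat.ltb_lt. lia. }
  apply (G N 0); auto.
Qed.

Lemma upd_same {A : Type} (f : nat -> A) (i : nat) (x : A) : upd f i x i = x.
Proof. unfold upd. now rewrite Nat.eqb_refl. Qed.

Lemma upd_other {A : Type} (f : nat -> A) (i j : nat) (x : A) : j <> i -> upd f i x j = f j.
Proof. intros H. unfold upd. now apply Nat.eqb_neq in H as ->. Qed.

(** * The program *)

(* Integer registers: 0 n, 1 and 3 the base addresses 32 |E| and 64 |E|, 2 the constant 1, 4 to 9 and
   18, 19 scratch, 10 number of spine vertices, 11 and 12 current and previous spine vertex, 13 phase,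
   14 loop index, 15 next free slot of the table, 16 first slot of the current vertex, 17 verdict.
   The address 64 |E| + 8 v + f holds, for f = 0, ..., 4, the degree of v, the sum of its neighbours,
   the number and the sum of its non-leaf neighbours, and the address of its next unused slot.
   A leaf stores its only neighbour as that sum, and a spine vertex can be left towards the
   neighbour it was not entered from by a subtraction.
   Real registers: 1 angle, 2 and 3 current spine point, 4 angle step, 7 to 9 the notch offsets and
   height, 10 and 11 cosine and sine of the angle, 12 to 14 scratch. The position of v is kept at
   64 + 4v and 65 + 4v, the k-th slot at 66 + 4k and 67 + 4k, until [output] moves the positions. *)
Definition skip : cmd := Block [].

Definition field_addr (f r : nat) : list instr :=
  [IAdd 8 r r; IAdd 8 8 8; IAdd 8 8 8; IAdd 8 8 3; IConst 9 (Z.of_nat f); IAdd 8 8 9].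

Definition get_field (f r d : nat) : list instr := field_addr f r ++ [ILoad d 8].

Definition bump (f a b : nat) : list instr :=
  field_addr f a ++
  [ILoad 9 8; IAdd 9 9 2; IStore 8 9; IAdd 8 8 2; ILoad 9 8; IAdd 9 9 b; IStore 8 9].

(** The registers to be saved still hold edges, so only registers 1 and 2 are at hand: the first is
    the moving pointer and the second the constant 1, its own content having been saved before. *)
Definition save_regs (k : nat) : list instr := flat_map (fun r => [IAdd 1 1 2; IStore 1 r]) (seq 3 k).

(* Frees the registers 2, ..., 19 and moves the edge list to the addresses 32 |E|, 32 |E| + 1, ... *)
Definition relocate : cmd :=
  Seq (Block ([IAdd 1 1 1; IAdd 1 1 1; IAdd 1 1 1; IAdd 1 1 1; IAdd 1 1 1; IStore 1 2; IConst 2 1]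
    ++ save_regs 17 ++
    [IConst 3 17; ISub 1 1 3; IConst 5 288; IConst 4 20; IConst 9 18; IAdd 6 1 9; IConst 9 16]))
  (Seq (While 5 1 (Block [ILoad 8 4; IStore 6 8; IAdd 4 4 2; IAdd 6 6 2; IAdd 5 5 9]))
  (Block [IAdd 3 1 1])).

(** The counter advances by 32 per edge, because register 1 now holds 32 |E| and |E| itself is no
    longer stored. *)
Definition edge_loop (body : cmd) : cmd :=
  Seq (Block [IConst 5 0; IAdd 4 1 5])
  (While 5 1 (Seq (Block [ILoad 6 4; IAdd 4 4 2; ILoad 7 4; IAdd 4 4 2; IConst 9 32; IAdd 5 5 9]) body)).

Definition count_nbrs : cmd := edge_loop (Block (bump 0 6 7 ++ bump 0 7 6)).

Definition count_spine_nbrs : cmd :=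
  edge_loop (Seq (Block (get_field 0 6 18 ++ get_field 0 7 19))
    (If (TLt 2 18) (If (TLt 2 19) (Block (bump 2 6 7 ++ bump 2 7 6)) skip) skip)).

Definition vertex_loop (body : cmd) : cmd :=
  Seq (Block [IConst 6 0]) (While 6 0 (Seq body (Block [IAdd 6 6 2]))).

(** An end of the spine is a non-leaf with at most one non-leaf neighbour; the last one met stays in
    register 11. *)
Definition find_end : cmd :=
  Seq (Block [IConst 10 0; IConst 11 0])
  (vertex_loop (Seq (Block (get_field 0 6 18 ++ get_field 2 6 19 ++ [IConst 9 2]))
    (If (TLt 2 18) (Seq (Block [IAdd 10 10 2]) (If (TLt 19 9) (Block [IConst 9 0; IAdd 11 6 9]) skip)) skip))).

(** The pointer advances by 4: slots and vertex positions are interleaved, so that both tables can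
    grow without a bound known in advance. *)
Definition emit (x y : nat) : list instr :=
  [RStore 15 x; IAdd 15 15 2; RStore 15 y; IConst 9 3; IAdd 15 15 9].

Definition emit_notch (r : nat) : list instr :=
  [RMul 12 r 10; RMul 14 9 11; RAdd 12 12 14; RAdd 12 2 12;
   RMul 13 9 10; RMul 14 r 11; RSub 13 13 14; RAdd 13 3 13] ++ emit 12 13.

(** Slot 0 is [SV 0] at the origin, which the zero registers represent already; writing therefore
    starts at slot 1, address 70. *)
Definition init_walk : list instr :=
  [IConst 12 0; IConst 13 0; IConst 14 0; IConst 16 66; IConst 15 70; IConst 17 1;
   RofI 4 0; RConst 5 10 1; RMul 4 5 4; RConst 5 1 1; RDiv 4 5 4; RConst 5 1 8; RMul 5 4 5;
   RConst 6 1 2; RSub 7 6 5; RAdd 8 6 5; RMul 9 7 7; RConst 10 1 1; RSub 9 10 9; RSqrt 9 9].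

Definition stage (x y : nat) (v : nat) : list instr :=
  [IAdd 8 v v; IAdd 8 8 8; IConst 9 64; IAdd 8 8 9; RStore 8 x; IAdd 8 8 2; RStore 8 y].

(** Expects the degree in register 18 and the constants 4 and 5 in registers 9 and 19. A violation
    of [fits] clears the verdict, but the walk continues. *)
Definition next_phase : cmd :=
  If (TLt 9 18)
    (Seq (If (TLt 19 18) (Block [IConst 17 0]) (If (TLt 13 2) skip (Block [IConst 17 0])))
         (Block [IConst 13 1]))
    (If (TLt 18 9) (Block [IConst 13 0]) skip).

Definition walk_step : cmd :=
  Seq (Block (field_addr 4 11 ++ [IStore 8 16; RCos 10 1; RSin 11 1]))
  (Seq (If (TLt 13 2) (Block (emit_notch 8)) skip)
  (Seq (Block ([RAdd 2 2 10; RSub 3 3 11; RAdd 1 1 4; RCos 10 1; RSin 11 1] ++ stage 2 3 11 ++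
         [RAdd 12 2 11; RSub 13 3 10] ++ emit 12 13 ++ get_field 0 11 18 ++ [IConst 9 4; IConst 19 5]))
  (Seq next_phase
  (Seq (If (TLt 13 2) skip (Block (emit_notch 7)))
  (Block ([RAdd 12 2 10; RSub 13 3 11] ++ emit 12 13 ++ get_field 3 11 18 ++
     [ISub 8 18 12; IConst 9 0; IAdd 12 11 9; IAdd 11 8 9; IAdd 16 15 9; IAdd 14 14 2])))))).

Definition walk_spine : cmd := Seq (Block init_walk) (While 14 10 walk_step).

Definition place_leaves : cmd :=
  vertex_loop (Seq (Block (get_field 0 6 18 ++ [IConst 9 2]))
    (If (TLt 18 9)
      (Block (get_field 1 6 7 ++ field_addr 4 7 ++
        [ILoad 18 8; IConst 9 4; IAdd 19 18 9; IStore 8 19; RLoad 12 18; IAdd 18 18 2; RLoad 13 18] ++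
        stage 12 13 6))
      skip)).

Definition output : cmd :=
  Seq (Block [IConst 6 0; IConst 4 64; IConst 5 1; IConst 9 3])
  (Seq (While 6 0 (Block [RLoad 0 4; RStore 5 0; IAdd 4 4 2; IAdd 5 5 2; RLoad 0 4; RStore 5 0;
      IAdd 4 4 9; IAdd 5 5 2; IAdd 6 6 2]))
  (Block [RConst 0 1 2; IConst 9 0; IAdd 0 17 9])).

Definition small : cmd := Block [RConst 0 1 2; RConst 3 1 1; IConst 0 1].

Definition large : cmd :=
  Seq count_nbrs (Seq count_spine_nbrs (Seq find_end (Seq walk_spine (Seq place_leaves output)))).

(** Comparing n with 3 requires a free register and so has to wait for [relocate]. That command
    needs an edge for its target addresses to clear the low registers, hence the preceding test for
    |E| = 0. *)
Definition udc_cmd : cmd :=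
  If (TZero 1) small (Seq relocate (Seq (Block [IConst 8 3]) (If (TLt 0 8) small large))).

(** * Symbolic execution of straight-line code *)

Lemma run_app (l1 l2 : list instr) (s : store) : run (l1 ++ l2) s = run l2 (run l1 s).
Proof. apply fold_left_app. Qed.

Ltac rd := repeat match goal with
  | |- context [upd ?f ?i ?x ?i] => rewrite (upd_same f i x)
  | |- context [upd ?f ?i ?x ?j] => rewrite (upd_other f i j x) by (discriminate || lia)
  end.

Ltac exec1 :=
  match goal with |- context [run (?i :: ?l) (?I, ?R)] =>
    let s := eval cbv beta iota zeta delta [run1 exec ireg rreg fst snd] in (run1 (I, R) i) in
    change (run (i :: l) (I, R)) with (run l s)
  end; rd.

Ltac exec_done := match goal with |- context [run [] ?s] => change (run [] s) with s end.

Ltac exec_all := repeat exec1; exec_done.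

Definition adr (m v f : nat) : nat := 64 * m + 8 * v + f.

Ltac adr_lia := unfold adr in *; lia.

Lemma run_field_addr (m u f r : nat) (I : nat -> Z) (R : nat -> R) :
  r <> 8 -> r <> 9 -> I 3 = Z.of_nat (64 * m) -> I r = Z.of_nat u ->
  exists J, run (field_addr f r) (I, R) = (J, R) /\ J 8 = Z.of_nat (adr m u f) /\
    forall x, x <> 8 -> x <> 9 -> J x = I x.
Proof.
  intros H8 H9 H3 Hr. unfold field_addr. exec_all.
  eexists. split; [reflexivity|]. split.
  - rd. rewrite H3, Hr. unfold adr. lia.
  - intros x X8 X9. rd. reflexivity.
Qed.

Lemma run_get_field (m u f r d : nat) (I : nat -> Z) (R : nat -> R) :
  1 <= m -> r <> 8 -> r <> 9 -> I 3 = Z.of_nat (64 * m) -> I r = Z.of_nat u ->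
  exists J, run (get_field f r d) (I, R) = (J, R) /\ J d = I (adr m u f) /\
    forall x, x <> 8 -> x <> 9 -> x <> d -> J x = I x.
Proof.
  intros Hm H8 H9 H3 Hr. unfold get_field. rewrite run_app.
  destruct (run_field_addr m u f r I R) as (J & -> & J8 & JX); auto.
  exec_all. eexists. split; [reflexivity|]. split.
  - rd. rewrite J8, Nat2Z.id. apply JX; unfold adr; lia.
  - intros x X8 X9 Xd. rd. auto.
Qed.

Lemma run_bump (m u v f a b : nat) (I : nat -> Z) (R : nat -> R) :
  1 <= m -> a <> 8 -> a <> 9 -> b <> 8 -> b <> 9 -> b < 20 ->
  I 2 = 1%Z -> I 3 = Z.of_nat (64 * m) -> I a = Z.of_nat u -> I b = Z.of_nat v ->
  exists J, run (bump f a b) (I, R) = (J, R) /\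
    forall x, x <> 8 -> x <> 9 ->
      J x = if x =? adr m u f then (I (adr m u f) + 1)%Z
            else if x =? adr m u (S f) then (I (adr m u (S f)) + Z.of_nat v)%Z else I x.
Proof.
  intros Hm A8 A9 B8 B9 Hb H2 H3 Ha Hb'. unfold bump. rewrite run_app.
  destruct (run_field_addr m u f a I R) as (J & -> & J8 & JX); auto.
  assert (L : 64 <= adr m u f) by adr_lia.
  assert (L' : adr m u (S f) = S (adr m u f)) by adr_lia. rewrite L'.
  set (A := adr m u f) in *.
  assert (J2 : J 2 = 1%Z) by (rewrite JX; auto).
  assert (E1 : Z.to_nat (Z.of_nat A + 1) = S A) by lia.
  exec1. exec1. rewrite J8, J2, Nat2Z.id. exec1.
  rewrite J8, Nat2Z.id. exec1. rewrite J8, J2. exec1. rewrite E1. exec1. exec1. rewrite E1.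
  exec_done.
  eexists. split; [reflexivity|]. intros x X8 X9.
  destruct (Nat.eqb_spec x A) as [-> | NA].
  - rd. now rewrite JX by lia.
  - destruct (Nat.eqb_spec x (S A)) as [-> | NB].
    + rd. rewrite !JX by lia. now rewrite Hb'.
    + rd. now apply JX.
Qed.

(** * Relocation of the input and loops over the edges *)

Definition ctx (n : nat) (E : graph) (I : nat -> Z) : Prop :=
  let m := length E in
  I 0 = Z.of_nat n /\ I 1 = Z.of_nat (32 * m) /\ I 2 = 1%Z /\ I 3 = Z.of_nat (64 * m) /\
  forall j u v, nth_error E j = Some (u, v) ->
    I (32 * m + 2 * j) = Z.of_nat u /\ I (32 * m + 2 * j + 1) = Z.of_nat v.

Lemma init_edge (n : nat) (E : graph) (j u v : nat) : nth_error E j = Some (u, v) ->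
  ireg (init_cfg n E) (2 + 2 * j) = Z.of_nat u /\ ireg (init_cfg n E) (2 + 2 * j + 1) = Z.of_nat v.
Proof.
  intros H. split.
  - change (2 + 2 * j) with (S (S (2 * j))). cbn [ireg init_cfg].
    rewrite Nat.div2_double, H, Nat.even_even. reflexivity.
  - replace (2 + 2 * j + 1) with (S (S (2 * j + 1))) by lia. cbn [ireg init_cfg].
    rewrite Nat.add_1_r, Nat.div2_succ_double, H.
    replace (Nat.even (S (2 * j))) with false; [reflexivity|].
    rewrite Nat.even_succ. now rewrite Nat.odd_even.
Qed.

Lemma init_zero (n : nat) (E : graph) (a : nat) : 2 + 2 * length E <= a ->
  ireg (init_cfg n E) a = 0%Z.
Proof.
  intros H. destruct a as [|[|i]]; try lia. cbn [ireg init_cfg].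
  replace (nth_error E (Nat.div2 i)) with (@None (nat * nat)); [reflexivity|].
  symmetry. apply nth_error_None. rewrite Nat.div2_div.
  apply Nat.div_le_lower_bound; lia.
Qed.

Lemma run_save_regs (m k : nat) (I : nat -> Z) (R : nat -> R) : 1 <= m -> k <= 17 ->
  I 1 = Z.of_nat (32 * m) -> I 2 = 1%Z ->
  exists J, run (save_regs k) (I, R) = (J, R) /\ J 1 = Z.of_nat (32 * m + k) /\
    (forall i, i < k -> J (32 * m + 1 + i) = I (3 + i)) /\
    forall x, x <> 1 -> x < 32 * m + 1 \/ 32 * m + k < x -> J x = I x.
Proof.
  intros Hm Hk H1 H2. induction k as [|k IH].
  - exists I. split; [reflexivity|]. repeat split; intros; lia || reflexivity.
  - destruct IH as (J & HJ & J1 & J2 & J3); [lia|].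
    unfold save_regs in *. rewrite seq_S, flat_map_app, run_app, HJ.
    cbn [flat_map app]. exec1. rewrite J1, (J3 2), H2 by lia. exec1.
    replace (Z.to_nat (Z.of_nat (32 * m + k) + 1)) with (32 * m + 1 + k) by lia.
    exec_done.
    eexists. split; [reflexivity|]. repeat split.
    + rd. lia.
    + intros i Hi. destruct (Nat.eq_dec i k) as [-> | Ni].
      * rd. apply J3; lia.
      * rd. apply J2. lia.
    + intros x X1 X2. rd. apply J3; lia.
Qed.

Lemma ltb_of_nat (a b : nat) : (Z.of_nat a <? Z.of_nat b)%Z = (a <? b).
Proof. destruct (Nat.ltb_spec a b); [apply Z.ltb_lt | apply Z.ltb_ge]; lia. Qed.

Lemma does_relocate (n : nat) (E : graph) (R : nat -> R) : 1 <= length E ->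
  does relocate (ireg (init_cfg n E), R) (14 * length E + 100)
    (fun s => ctx n E (fst s) /\ (forall a, 64 * length E <= a -> fst s a = 0%Z) /\ snd s = R).
Proof.
  intros Hm. set (m := length E) in *. set (I0 := ireg (init_cfg n E)).
  assert (H0 : I0 0 = Z.of_nat n) by reflexivity. assert (H1 : I0 1 = Z.of_nat m) by reflexivity.
  unfold relocate. eapply does_weaken.
  - eapply does_seq with (Q1 := fun s => snd s = R /\ fst s 0 = Z.of_nat n /\
      fst s 1 = Z.of_nat (32 * m) /\ fst s 2 = 1%Z /\ fst s 4 = 20%Z /\ fst s 5 = 288%Z /\
      fst s 6 = Z.of_nat (32 * m + 18) /\ fst s 9 = 16%Z /\
      (forall i, i < 18 -> fst s (32 * m + i) = I0 (2 + i)) /\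
      forall x, 20 <= x -> x < 32 * m \/ 32 * m + 18 <= x -> fst s x = I0 x).
    { apply does_block; [reflexivity|]. rewrite run_app.
      exec1. rewrite H1. exec1. exec1. exec1. exec1.
      set (M := (Z.of_nat m + Z.of_nat m + (Z.of_nat m + Z.of_nat m) +
        (Z.of_nat m + Z.of_nat m + (Z.of_nat m + Z.of_nat m)))%Z) in *.
      assert (EM : (M + M + (M + M))%Z = Z.of_nat (32 * m)) by (unfold M; lia).
      rewrite EM. exec1. rewrite Nat2Z.id. exec1.
      exec_done.
      match goal with |- context [run _ (?J, R)] => set (I1 := J) end.
      assert (A1 : I1 1 = Z.of_nat (32 * m)) by (unfold I1; rd; reflexivity).
      assert (A2 : I1 2 = 1%Z) by (unfold I1; rd; reflexivity).
      assert (A3 : I1 (32 * m) = I0 2) by (unfold I1; rd; reflexivity).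
      assert (A4 : forall x, x <> 1 -> x <> 2 -> x <> 32 * m -> I1 x = I0 x)
        by (intros x X1 X2 X3; unfold I1; rd; reflexivity).
      clearbody I1. rewrite run_app.
      destruct (run_save_regs m 17 I1 R Hm (le_n _) A1 A2) as (J & -> & J1 & J2 & J3).
      exec_all. cbn [fst snd]. repeat split; rd.
      - rewrite J3, A4 by lia. assumption.
      - rewrite J1. lia.
      - rewrite J3 by lia. assumption.
      - rewrite J1. lia.
      - intros i Hi. rd. destruct i as [|i].
        + rewrite Nat.add_0_r, J3 by lia. assumption.
        + replace (32 * m + S i) with (32 * m + 1 + i) by lia.
          rewrite J2 by lia. apply A4; lia.
      - intros x X1 X2. rd. rewrite J3 by lia. apply A4; lia. }
    intros [I1 R1] (HR & B0 & B1 & B2 & B4 & B5 & B6 & B9 & BS & BX). cbn [fst snd] in *. subst R1.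
    eapply does_seq.
    (* Registers 2 to 19 contributed 18 words already. Each word counts 16, so that the bound 32 m
       in register 1 is reached after 2 m words; 288 is 16 times 18, and the truncated difference is
       0 for short edge lists. *)
    { apply (does_while 5 1 _ 5 (2 * m - 18) (fun j s => snd s = R /\ fst s 0 = Z.of_nat n /\
        fst s 1 = Z.of_nat (32 * m) /\ fst s 2 = 1%Z /\ fst s 4 = Z.of_nat (20 + j) /\
        fst s 5 = Z.of_nat (288 + 16 * j) /\
        fst s 6 = Z.of_nat (32 * m + 18 + j) /\ fst s 9 = 16%Z /\
        (forall i, i < 18 + j -> fst s (32 * m + i) = I0 (2 + i)) /\
        forall x, 20 <= x -> x < 32 * m \/ 32 * m + 18 + j <= x -> fst s x = I0 x)).
      - intros j s Hj (_ & _ & C1 & _ & _ & C5 & _). cbn [holds]. rewrite C1, C5, ltb_of_nat.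
        destruct (Nat.ltb_spec j (2 * m - 18)); [apply Nat.ltb_lt | apply Nat.ltb_ge]; lia.
      - intros j [I R'] Hj (HR & C0 & C1 & C2 & C4 & C5 & C6 & C9 & CS & CX). cbn [fst snd] in *. subst R'.
        apply does_block; [reflexivity|].
        exec1. rewrite C4, Nat2Z.id. exec1. rewrite C6, Nat2Z.id. exec1. rewrite C4, C2. exec1. rewrite C6, C2.
        exec1. rewrite C5, C9.
        exec_done.
        cbn [fst snd]. repeat split; rd; try assumption; try lia.
        + intros i Hi. destruct (Nat.eq_dec i (18 + j)) as [-> | Ni].
          * rd. replace (32 * m + (18 + j)) with (32 * m + 18 + j) by lia. rd.
            rewrite CX by lia. f_equal.
          * rd. apply CS. lia.
        + intros x X1 X2. rd. apply CX; lia.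
      - cbn [fst snd]. repeat split; try assumption; try lia.
        intros x X1 X2. apply BX; lia. }
    intros [I R'] (HR & C0 & C1 & C2 & _ & _ & _ & _ & CS & CX). cbn [fst snd] in *. subst R'.
    apply does_block; [reflexivity|]. exec_all.
    instantiate (1 := fun s => ctx n E (fst s) /\ (forall a, 64 * m <= a -> fst s a = 0%Z) /\ snd s = R).
    cbn [fst snd]. repeat split; rd; try assumption.
    + rewrite C1. fold m. lia.
    + fold m. assert (L : j < m) by (apply nth_error_Some; congruence). rd.
      rewrite CS by lia. now apply (init_edge n E j u v).
    + fold m. assert (L : j < m) by (apply nth_error_Some; congruence). rd.
      rewrite <- Nat.add_assoc, CS by lia. rewrite Nat.add_assoc. now apply (init_edge n E j u v).
    + intros a Ha. rd. rewrite CX by lia. apply init_zero. fold m. lia.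
  - rewrite !length_app. simpl. lia.
  - auto.
Qed.

Lemma does_edge_loop (n : nat) (E : graph) (body : cmd) (b : nat)
    (Inv : nat -> (nat -> Z) -> Prop) (I0 : nat -> Z) (R0 : nat -> R) :
  1 <= length E ->
  (forall j I u v, nth_error E j = Some (u, v) -> ctx n E I -> I 6 = Z.of_nat u -> I 7 = Z.of_nat v ->
    Inv j I -> does body (I, R0) b (fun s => ctx n E (fst s) /\ fst s 4 = I 4 /\ fst s 5 = I 5 /\
       Inv (S j) (fst s) /\ snd s = R0)) ->
  (forall j I I', (forall r, 20 <= r -> I' r = I r) -> Inv j I -> Inv j I') ->
  ctx n E I0 -> Inv 0 I0 ->
  does (edge_loop body) (I0, R0) (length E * (b + 8) + 4)
    (fun s => ctx n E (fst s) /\ Inv (length E) (fst s) /\ snd s = R0).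
Proof.
  intros Hm HB HI HC H0. set (m := length E) in *. unfold edge_loop.
  eapply does_weaken.
  - eapply does_seq with (Q1 := fun s => ctx n E (fst s) /\ fst s 4 = Z.of_nat (32 * m) /\
      fst s 5 = 0%Z /\ Inv 0 (fst s) /\ snd s = R0).
    { apply does_block; [reflexivity|]. exec_all. destruct HC as (C0 & C1 & C2 & C3 & CE).
      cbn [fst snd]. repeat split; rd; auto.
      - fold m in CE |- *. rd. now apply CE with v.
      - fold m in CE |- *. rd. now apply CE with u.
      - rewrite C1. fold m. lia.
      - apply HI with I0; auto. intros r Hr. rd. reflexivity. }
    intros [I1 R1] (C & B4 & B5 & BI & HR). cbn [fst snd] in *. subst R1.
    apply (does_while 5 1 _ (6 + b) m (fun j s => ctx n E (fst s) /\
      fst s 4 = Z.of_nat (32 * m + 2 * j) /\ fst s 5 = Z.of_nat (32 * j) /\ Inv j (fst s) /\ snd s = R0)).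
    + intros j s Hj ((_ & C1 & _) & _ & C5 & _). cbn [holds]. rewrite C1, C5, ltb_of_nat. fold m.
      destruct (Nat.ltb_spec j m); [apply Nat.ltb_lt | apply Nat.ltb_ge]; lia.
    + intros j [I R] Hj ((C0 & C1 & C2 & C3 & CE) & D4 & D5 & DI & HR). cbn [fst snd] in *. subst R.
      destruct (nth_error E j) as [[u v]|] eqn:Ej; [|apply nth_error_None in Ej; fold m in Ej; lia].
      destruct (CE j u v Ej) as [Eu Ev]. fold m in CE, Eu, Ev.
      eapply does_seq with (t1 := 6) (Q1 := fun s => ctx n E (fst s) /\ fst s 4 = Z.of_nat (32 * m + 2 * S j) /\
        fst s 5 = Z.of_nat (32 * S j) /\ fst s 6 = Z.of_nat u /\ fst s 7 = Z.of_nat v /\ Inv j (fst s) /\ snd s = R0).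
      * apply does_block; [reflexivity|].
        exec1. rewrite D4, Nat2Z.id, Eu. exec1. rewrite D4, C2.
        exec1. replace (Z.to_nat (Z.of_nat (32 * m + 2 * j) + 1)) with (32 * m + 2 * j + 1) by lia. rd. rewrite Ev.
        exec1. rewrite C2. exec1. exec1. rewrite D5.
        exec_done.
        cbn [fst snd]. repeat split; rd; auto; try lia.
        -- fold m. rd. now apply CE with v0.
        -- fold m. rd. now apply CE with u0.
        -- apply HI with I; auto. intros r Hr. rd. reflexivity.
      * intros [I2 R2] (F & F4 & F5 & F6 & F7 & FI & FR). cbn [fst snd] in *. subst R2.
        eapply does_weaken; [apply (HB j I2 u v); auto | lia |].
        intros s (G1 & G4 & G5 & G6 & G7). rewrite G4, G5. auto.
    + cbn [fst snd]. rewrite B4, B5. repeat split; auto; try apply C; try lia.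
      * apply C in H. apply H.
      * apply C in H. apply H.
  - simpl length. lia.
  - intros s (G1 & _ & _ & G2 & G3). auto.
Qed.

Lemma ctx_frame (n : nat) (E : graph) (I J : nat -> Z) :
  1 <= length E ->
  (forall r, r <= 3 \/ 20 <= r < 64 * length E -> J r = I r) -> ctx n E I -> ctx n E J.
Proof.
  intros Hm H (C0 & C1 & C2 & C3 & CE). set (m := length E) in *.
  repeat split; rewrite ?H by lia; auto; fold m in CE |- *.
  - assert (L : j < m) by (apply nth_error_Some; congruence).
    rewrite H by lia. now apply CE with v.
  - assert (L : j < m) by (apply nth_error_Some; congruence).
    rewrite H by lia. now apply CE with u.
Qed.

(** * Degrees and neighbour sums *)

Definition nbrs1 (u v z : nat) : list nat := if u =? z then [v] else if v =? z then [u] else [].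

Lemma nbrs_firstn_S (E : graph) (j u v z : nat) : nth_error E j = Some (u, v) ->
  nbrs (firstn (S j) E) z = nbrs (firstn j E) z ++ nbrs1 u v z.
Proof.
  intros H.
  assert (E1 : firstn (S j) E = firstn j E ++ [(u, v)]).
  { apply nth_error_split in H as (l1 & l2 & -> & <-).
    assert (F : forall k, firstn (length l1 + k) (l1 ++ (u, v) :: l2) = l1 ++ firstn k ((u, v) :: l2))
      by (intros; apply firstn_app_2).
    generalize (F 0) (F 1). rewrite Nat.add_0_r, Nat.add_1_r. intros -> ->. simpl. now rewrite app_nil_r. }
  rewrite E1. unfold nbrs. rewrite flat_map_app. simpl. now rewrite app_nil_r.
Qed.

Lemma run_bump2 (m u v f : nat) (I : nat -> Z) (R : nat -> R) :
  1 <= m -> S f < 8 -> u <> v ->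
  I 2 = 1%Z -> I 3 = Z.of_nat (64 * m) -> I 6 = Z.of_nat u -> I 7 = Z.of_nat v ->
  exists J, run (bump f 6 7 ++ bump f 7 6) (I, R) = (J, R) /\
    (forall x, x <> 8 -> x <> 9 -> x < 64 * m -> J x = I x) /\
    (forall z g, g < 8 -> g <> f -> g <> S f -> J (adr m z g) = I (adr m z g)) /\
    (forall z, J (adr m z f) = (I (adr m z f) + Z.of_nat (length (nbrs1 u v z)))%Z /\
       J (adr m z (S f)) = (I (adr m z (S f)) + Z.of_nat (list_sum (nbrs1 u v z)))%Z).
Proof.
  intros Hm Hf Huv H2 H3 H6 H7.
  destruct (run_bump m u v f 6 7 I R) as (J & EJ & HJ); auto; try lia.
  assert (JX : forall x, x <> 8 -> x <> 9 -> x < 64 * m -> J x = I x).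
  { intros x X8 X9 X. rewrite HJ by assumption.
    destruct (Nat.eqb_spec x (adr m u f)); [unfold adr in *; lia|].
    destruct (Nat.eqb_spec x (adr m u (S f))); [unfold adr in *; lia | reflexivity]. }
  destruct (run_bump m v u f 7 6 J R) as (K & EK & HK); rewrite ?JX; auto; try lia.
  exists K. rewrite run_app, EJ, EK. split; [reflexivity|]. split; [|split].
  - intros x X8 X9 X. rewrite HK by assumption.
    destruct (Nat.eqb_spec x (adr m v f)); [unfold adr in *; lia|].
    destruct (Nat.eqb_spec x (adr m v (S f))); [unfold adr in *; lia | now apply JX].
  - intros z g Hg G1 G2. rewrite HK, !HJ by adr_lia.
    repeat match goal with |- context [?a =? ?b] => destruct (Nat.eqb_spec a b); [unfold adr in *; lia|] end.
    reflexivity.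
  - intros z. unfold nbrs1.
    rewrite !HK, !HJ by adr_lia.
    destruct (Nat.eqb_spec u z) as [-> | Nu]; [|destruct (Nat.eqb_spec v z) as [-> | Nv]]; split;
      repeat match goal with |- context [adr ?m ?a ?b =? adr ?m ?c ?d] =>
        destruct (Nat.eqb_spec (adr m a b) (adr m c d)); try (exfalso; unfold adr in *; lia) end; simpl; lia.
Qed.

Lemma does_count_nbrs (n : nat) (E : graph) (I : nat -> Z) (R : nat -> R) :
  valid_input n E -> 1 <= length E -> ctx n E I -> (forall a, 64 * length E <= a -> I a = 0%Z) ->
  does count_nbrs (I, R) (length E * 34 + 4) (fun s => ctx n E (fst s) /\ snd s = R /\
    forall z, fst s (adr (length E) z 0) = Z.of_nat (deg E z) /\
      fst s (adr (length E) z 1) = Z.of_nat (list_sum (nbrs E z)) /\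
      forall g, 2 <= g < 8 -> fst s (adr (length E) z g) = 0%Z).
Proof.
  intros V Hm HC HZ. set (m := length E) in *.
  eapply does_weaken.
  - apply (does_edge_loop n E (Block (bump 0 6 7 ++ bump 0 7 6)) 26 (fun j I =>
      forall z, I (adr m z 0) = Z.of_nat (length (nbrs (firstn j E) z)) /\
      I (adr m z 1) = Z.of_nat (list_sum (nbrs (firstn j E) z)) /\
      forall g, 2 <= g < 8 -> I (adr m z g) = 0%Z)); auto; fold m.
    + intros j I1 u v Ej C1 B6 B7 BI.
      assert (Huv : u <> v) by (apply nth_error_In in Ej; apply V in Ej; tauto).
      destruct (C1) as (_ & _ & D2 & D3 & _). fold m in D3.
      destruct (run_bump2 m u v 0 I1 R Hm ltac:(lia) Huv D2 D3 B6 B7) as (J & EJ & J1 & J2 & J3).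
      apply does_block; [reflexivity|]. rewrite EJ. cbn [fst snd].
      split; [|split; [|split; [|split]]]; auto.
      * apply ctx_frame with I1; auto. fold m. intros r Hr. apply J1; lia.
      * apply J1; lia.
      * apply J1; lia.
      * intros z. destruct (BI z) as (Z0 & Z1 & ZG). destruct (J3 z) as (K0 & K1).
        rewrite (nbrs_firstn_S E j u v z Ej), length_app, list_sum_app.
        split; [|split].
        -- rewrite K0, Z0. lia.
        -- rewrite K1, Z1. lia.
        -- intros g Hg. rewrite J2 by lia. now apply ZG.
    + intros j I1 I2 HI HJ z. destruct (HJ z) as (Z0 & Z1 & ZG).
      repeat split; intros; rewrite HI by adr_lia; auto.
    + intros z. rewrite !HZ by adr_lia. repeat split; auto.
      intros g Hg. apply HZ. unfold adr. lia.
  - lia.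
  - intros s (C & HI & HR). split; [assumption | split; [assumption|]]. intros z. generalize (HI z).
    fold m. rewrite (firstn_all E : firstn m E = E). auto.
Qed.

(** [E0] is the whole graph, which decides who is a leaf; [E] is the part of the edge list read so
    far. *)
Definition spine_nbrs (E0 E : graph) (z : nat) : list nat :=
  if 2 <=? deg E0 z then filter (fun u => 2 <=? deg E0 u) (nbrs E z) else [].

Definition arrays_from (E F : graph) (I : nat -> Z) : Prop :=
  forall z, I (adr (length E) z 0) = Z.of_nat (deg E z) /\
    I (adr (length E) z 1) = Z.of_nat (list_sum (nbrs E z)) /\
    I (adr (length E) z 2) = Z.of_nat (length (spine_nbrs E F z)) /\
    I (adr (length E) z 3) = Z.of_nat (list_sum (spine_nbrs E F z)).

Lemma does_count_spine_nbrs (n : nat) (E : graph) (I : nat -> Z) (R : nat -> R) :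
  valid_input n E -> 1 <= length E -> ctx n E I ->
  (forall z, I (adr (length E) z 0) = Z.of_nat (deg E z) /\
      I (adr (length E) z 1) = Z.of_nat (list_sum (nbrs E z)) /\
      forall g, 2 <= g < 8 -> I (adr (length E) z g) = 0%Z) ->
  does count_spine_nbrs (I, R) (length E * 52 + 4) (fun s => ctx n E (fst s) /\ snd s = R /\
    arrays_from E E (fst s)).
Proof.
  intros V Hm HC HZ. set (m := length E) in *.
  eapply does_weaken.
  - apply (does_edge_loop n E _ 44 (fun j => arrays_from E (firstn j E))); auto; fold m.
    + intros j I1 u v Ej C1 B6 B7 BI.
      assert (Huv : u <> v) by (apply nth_error_In in Ej; apply V in Ej; tauto).
      destruct (C1) as (_ & _ & D2 & D3 & _). fold m in D3.
      replace 44 with (14 + (26 + 2 + 2)) by reflexivity.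
      destruct (run_get_field m u 0 6 18 I1 R) as (J1 & EJ1 & V1 & F1); auto; try lia.
      destruct (run_get_field m v 0 7 19 J1 R) as (J2 & EJ2 & V2 & F2); rewrite ?F1; auto; try lia.
      assert (F : forall x, x <> 8 -> x <> 9 -> x <> 18 -> x <> 19 -> J2 x = I1 x)
        by (intros; rewrite F2, F1; auto).
      eapply does_seq with (Q1 := fun s => s = (J2, R)).
      { apply does_block; [reflexivity|]. now rewrite run_app, EJ1, EJ2. }
      intros s ->.
      assert (G18 : J2 18 = Z.of_nat (deg E u)) by (rewrite F2, V1 by lia; apply BI).
      assert (G19 : J2 19 = Z.of_nat (deg E v)).
      { rewrite V2, F1 by adr_lia. apply BI. }
      assert (C2 : ctx n E J2) by (apply ctx_frame with I1; auto; intros r Hr; apply F; lia).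
      assert (BI2 : arrays_from E (firstn j E) J2).
      { intros z. rewrite !F by adr_lia. apply BI. }
      assert (TH : forall r k, J2 r = Z.of_nat k -> holds (TLt 2 r) (J2, R) = (1 <? k)).
      { intros r k Hr. cbn [holds fst]. rewrite Hr, F, D2 by lia. apply (ltb_of_nat 1). }
      assert (SKIP : (deg E u < 2 \/ deg E v < 2) ->
        does skip (J2, R) 26 (fun s => ctx n E (fst s) /\ fst s 4 = I1 4 /\ fst s 5 = I1 5 /\
          arrays_from E (firstn (S j) E) (fst s) /\ snd s = R)).
      { intros Hs. apply does_block_le; [reflexivity | simpl; lia |]. cbn [run fold_left fst snd]. rewrite !F by lia. repeat (split; [now auto|]). split; [|reflexivity].
        intros z. replace (spine_nbrs E (firstn (S j) E) z) with (spine_nbrs E (firstn j E) z); [apply BI2|].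
        unfold spine_nbrs. rewrite (nbrs_firstn_S E j u v z Ej), filter_app.
        destruct (Nat.leb_spec 2 (deg E z)); [|reflexivity].
        unfold nbrs1. destruct (Nat.eqb_spec u z) as [-> | Nu]; [|destruct (Nat.eqb_spec v z) as [-> | Nv]];
          cbn [filter]; rewrite ?app_nil_r; try reflexivity.
        - destruct (Nat.leb_spec 2 (deg E v)); [lia | now rewrite app_nil_r].
        - destruct (Nat.leb_spec 2 (deg E u)); [lia | now rewrite app_nil_r]. }
      apply does_if; intros T1; rewrite (TH 18 _ G18) in T1.
      * apply does_if; intros T2; rewrite (TH 19 _ G19) in T2.
        -- apply Nat.ltb_lt in T1, T2.
           destruct (C2) as (_ & _ & E2 & E3 & _). fold m in E3.
           destruct (run_bump2 m u v 2 J2 R Hm ltac:(lia) Huv E2 E3) as (K & EK & K1 & K2 & K3);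
             [rewrite F; auto; lia | rewrite F; auto; lia |].
           apply does_block; [reflexivity|]. rewrite EK. cbn [fst snd].
           split; [|split; [|split; [|split]]]; auto.
           ++ apply ctx_frame with J2; auto. fold m. intros r Hr. apply K1; lia.
           ++ rewrite K1 by lia. apply F; lia.
           ++ rewrite K1 by lia. apply F; lia.
           ++ intros z. destruct (BI2 z) as (Z0 & Z1 & Z2 & Z3). fold m in Z0, Z1, Z2, Z3 |- *. destruct (K3 z) as (L2 & L3).
              rewrite !K2, Z0, Z1, L2, L3, Z2, Z3 by lia.
              unfold spine_nbrs. rewrite (nbrs_firstn_S E j u v z Ej), filter_app.
              repeat split; destruct (Nat.leb_spec 2 (deg E z)) as [Lz | Lz];
                rewrite ?length_app, ?list_sum_app; unfold nbrs1;
                (destruct (Nat.eqb_spec u z) as [Eu | Nu]; [|destruct (Nat.eqb_spec v z) as [Ev | Nv]]);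
                cbn [filter]; rewrite ?(proj2 (Nat.leb_le 2 (deg E u)) T1), ?(proj2 (Nat.leb_le 2 (deg E v)) T2);
                cbn [length list_sum fold_right]; subst; try lia.
        -- apply SKIP. apply Nat.ltb_ge in T2. lia.
      * eapply does_weaken; [apply SKIP | lia | auto]. apply Nat.ltb_ge in T1. lia.
    + intros j I1 I2 HI HJ z. destruct (HJ z) as (Z0 & Z1 & Z2 & Z3).
      repeat split; intros; rewrite HI by adr_lia; auto.
    + intros z. destruct (HZ z) as (Z0 & Z1 & ZG).
      fold m. rewrite Z0, Z1, !ZG by lia.
      replace (spine_nbrs E (firstn 0 E) z) with (@nil nat); [auto|].
      unfold spine_nbrs. now destruct (2 <=? deg E z).
  - lia.
  - intros s (C & HI & HR). rewrite firstn_all in HI. auto.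
Qed.

(** * Loops over the vertices and the search for an end of the spine *)

Definition base (n m : nat) (I : nat -> Z) : Prop :=
  I 0 = Z.of_nat n /\ I 2 = 1%Z /\ I 3 = Z.of_nat (64 * m).

Local Notation arrays E := (arrays_from E E).

Lemma base_frame (n m : nat) (I J : nat -> Z) :
  (forall r, r = 0 \/ r = 2 \/ r = 3 -> J r = I r) -> base n m I -> base n m J.
Proof. intros H (B0 & B2 & B3). repeat split; rewrite H by auto; assumption. Qed.

Lemma arrays_frame (E : graph) (I J : nat -> Z) :
  (forall z f, f < 4 -> J (adr (length E) z f) = I (adr (length E) z f)) -> arrays E I -> arrays E J.
Proof. intros H HA z. rewrite !H by lia. apply HA. Qed.

Lemma does_vertex_loop (n m : nat) (body : cmd) (b : nat) (Inv : nat -> (nat -> Z) -> (nat -> R) -> Prop)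
    (I0 : nat -> Z) (R0 : nat -> R) :
  (forall j I R, j < n -> base n m I -> I 6 = Z.of_nat j -> Inv j I R ->
     does body (I, R) b (fun s => base n m (fst s) /\ fst s 6 = Z.of_nat j /\ Inv (S j) (fst s) (snd s))) ->
  (forall j I J R, (forall r, r <> 6 -> J r = I r) -> Inv j I R -> Inv j J R) ->
  base n m I0 -> Inv 0 I0 R0 ->
  does (vertex_loop body) (I0, R0) (n * (b + 3) + 3) (fun s => base n m (fst s) /\ Inv n (fst s) (snd s)).
Proof.
  intros HB HF B0 H0. unfold vertex_loop. eapply does_weaken.
  - eapply does_seq with (Q1 := fun s => base n m (fst s) /\ fst s 6 = 0%Z /\ Inv 0 (fst s) (snd s)).
    { apply does_block; [reflexivity|]. exec_all. cbn [fst snd]. split; [|split].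
      - apply base_frame with I0; auto. intros r Hr. rd. reflexivity.
      - rd. reflexivity.
      - apply HF with I0; auto. intros r Hr. rd. reflexivity. }
    intros s Hs.
    apply (does_while 6 0 _ (b + 1) n (fun j s => base n m (fst s) /\ fst s 6 = Z.of_nat j /\ Inv j (fst s) (snd s))).
    + intros j s' Hj ((C0 & _) & C6 & _). cbn [holds]. now rewrite C0, C6, ltb_of_nat.
    + intros j [I R] Hj (C & C6 & CI). cbn [fst snd] in *. eapply does_seq.
      * now apply (HB j I R).
      * intros [I1 R1] (D & D6 & DI). cbn [fst snd] in *. apply (does_block [IAdd 6 6 2]); [reflexivity|].
        exec_all. cbn [fst snd]. split; [|split].
        -- apply base_frame with I1; auto. intros r Hr. rd. reflexivity.
        -- rd. destruct D as (_ & D2 & _). rewrite D2. lia.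
        -- apply HF with I1; auto. intros r Hr. rd. reflexivity.
    + exact Hs.
  - simpl length. lia.
  - intros s (G & _ & GI). auto.
Qed.

(** Once an end has been met, register 11 holds some end; which one is left open, since either
    orientation of the spine will do. *)
Definition end_found (n : nat) (E : graph) (j : nat) (I : nat -> Z) : Prop :=
  I 10 = Z.of_nat (length (filter (fun z => 1 <? deg E z) (seq 0 j))) /\
  forall z, z < j -> 2 <= deg E z -> length (spine_nbrs E E z) < 2 ->
    exists y, y < n /\ 2 <= deg E y /\ length (spine_nbrs E E y) < 2 /\ I 11 = Z.of_nat y.

Lemma does_find_end (n : nat) (E : graph) (I : nat -> Z) (R : nat -> R) :
  1 <= length E -> base n (length E) I -> arrays E I ->
  does find_end (I, R) (n * 32 + 5) (fun s => base n (length E) (fst s) /\ arrays E (fst s) /\ snd s = R /\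
    end_found n E n (fst s)).
Proof.
  intros Hm HB HA. set (m := length E) in *. unfold find_end. eapply does_weaken.
  - eapply does_seq with (Q1 := fun s => base n m (fst s) /\ arrays E (fst s) /\ snd s = R /\
      fst s 10 = 0%Z).
    { apply does_block; [reflexivity|]. exec_all. cbn [fst snd]. split; [|split; [|split]].
      - apply base_frame with I; auto. intros r Hr. rd. reflexivity.
      - apply arrays_frame with I; auto. intros z f Hf. fold m. rewrite !upd_other by adr_lia. reflexivity.
      - reflexivity.
      - rd. reflexivity. }
    intros [I1 R1] (B & A & HR & H10). cbn [fst snd] in *. subst R1.
    apply (does_vertex_loop n m _ 29 (fun j J R' => arrays E J /\ R' = R /\ end_found n E j J)).
    + intros j J R' Hj BJ J6 (AJ & -> & J10 & JE). clear B A H10 I1.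
      assert (BJ' := BJ). destruct BJ' as (_ & B2 & B3).
      destruct (run_get_field m j 0 6 18 J R) as (J1 & E1 & V1 & F1); auto; try lia.
      destruct (run_get_field m j 2 6 19 J1 R) as (J2 & E2 & V2 & F2); rewrite ?F1; auto; try lia.
      assert (F : forall x, x <> 8 -> x <> 9 -> x <> 18 -> x <> 19 -> J2 x = J x)
        by (intros; rewrite F2, F1; auto).
      assert (G18 : J2 18 = Z.of_nat (deg E j)) by (rewrite F2, V1 by lia; apply AJ).
      assert (G19 : J2 19 = Z.of_nat (length (spine_nbrs E E j))).
      { rewrite V2, F1 by adr_lia. apply AJ. }
      set (J3 := upd J2 9 2%Z).
      assert (F3 : forall x, x <> 8 -> x <> 9 -> x <> 18 -> x <> 19 -> J3 x = J x).
      { intros. unfold J3. rd. now apply F. }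
      assert (H18 : J3 18 = Z.of_nat (deg E j)) by (unfold J3; rd; assumption).
      assert (H19 : J3 19 = Z.of_nat (length (spine_nbrs E E j))) by (unfold J3; rd; assumption).
      assert (H9 : J3 9 = 2%Z) by (unfold J3; rd; reflexivity).
      eapply does_weaken.
      * eapply does_seq with (Q1 := fun s => s = (J3, R)).
        { apply does_block; [reflexivity|]. rewrite !run_app, E1, E2. exec_all. reflexivity. }
        intros s ->. clearbody J3. clear J1 J2 E1 V1 F1 E2 V2 F2 F G18 G19.
        assert (BF : forall J', (forall x, x = 0 \/ x = 2 \/ x = 3 \/ x = 6 \/ 20 <= x -> J' x = J3 x) ->
          base n m J' /\ J' 6 = Z.of_nat j /\ arrays E J').
        { intros J' HJ'. split; [|split].
          - apply base_frame with J; auto. intros r Hr. rewrite HJ', F3; lia.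
          - rewrite HJ', F3; lia.
          - apply arrays_frame with J; auto. fold m. intros z f Hf. rewrite HJ', F3; unfold adr; lia. }
        assert (SQ : filter (fun z => 1 <? deg E z) (seq 0 (S j)) =
          filter (fun z => 1 <? deg E z) (seq 0 j) ++ (if 1 <? deg E j then [j] else [])).
        { rewrite seq_S, filter_app. simpl. now destruct (1 <? deg E j). }
        instantiate (1 := fun s => base n m (fst s) /\ fst s 6 = Z.of_nat j /\ (arrays E (fst s) /\ snd s = R /\ end_found n E (S j) (fst s))).
        apply (does_if (TLt 2 18) _ _ _ (1 + (2 + 2))); intros T.
        -- cbn [holds fst] in T. rewrite F3, B2, H18 in T by lia. rewrite (ltb_of_nat 1) in T.
           eapply does_seq with (t1 := 1) (Q1 := fun s => s = (upd J3 10 (J3 10%nat + 1)%Z, R)).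
           { apply (does_block [IAdd 10 10 2]); [reflexivity|]. exec_all. now rewrite (F3 2), B2 by lia. }
           intros s ->. apply (does_if (TLt 19 9) _ _ _ 2); intros T2; cbn [holds fst] in T2; revert T2; rd;
             rewrite H19, H9, (ltb_of_nat _ 2); intros T2.
           ++ apply (does_block [IConst 9 0; IAdd 11 6 9]); [reflexivity|]. exec_all. cbn [fst snd].
              destruct (BF (upd (upd (upd J3 10 (J3 10%nat + 1)%Z) 9 0%Z) 11 (J3 6%nat + 0)%Z)) as (P1 & P2 & P3).
              { intros x Hx. rd. reflexivity. }
              split; [exact P1 | split; [exact P2 | split; [exact P3 | split; [reflexivity | split]]]]; rd.
              ** rewrite SQ, T, length_app, F3, J10 by lia. simpl. lia.
              ** intros z Hz D1 D2. exists j. apply Nat.ltb_lt in T, T2. repeat split; auto.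
                 rewrite F3, J6; lia.
           ++ apply does_block_le; [reflexivity | simpl; lia |]. cbn [run fold_left fst snd].
              destruct (BF (upd J3 10 (J3 10%nat + 1)%Z)) as (P1 & P2 & P3).
              { intros x Hx. rd. reflexivity. }
              split; [exact P1 | split; [exact P2 | split; [exact P3 | split; [reflexivity | split]]]]; rd.
              ** rewrite SQ, T, length_app, F3, J10 by lia. simpl. lia.
              ** intros z Hz D1 D2. apply Nat.ltb_ge in T2. rewrite F3 by lia.
                 apply (JE z); auto. destruct (Nat.eq_dec z j) as [-> | ?]; lia.
        -- cbn [holds fst] in T. rewrite F3, B2, H18 in T by lia. rewrite (ltb_of_nat 1) in T.
           apply does_block_le; [reflexivity | simpl; lia |]. cbn [run fold_left fst snd].
           destruct (BF J3) as (P1 & P2 & P3); auto.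
           split; [exact P1 | split; [exact P2 | split; [exact P3 | split; [reflexivity | split]]]]; rewrite F3 by lia.
           ** rewrite SQ, T, length_app, J10. simpl. lia.
           ** apply Nat.ltb_ge in T. intros z Hz D1 D2. apply (JE z); auto.
              destruct (Nat.eq_dec z j) as [-> | ?]; lia.
      * simpl length. lia.
      * auto.
    + intros j J J' R' HJ (AJ & -> & J10 & JE). split; [|split; [reflexivity | split]].
      * apply arrays_frame with J; auto. intros z f Hf. fold m. apply HJ. unfold adr. lia.
      * rewrite HJ by lia. exact J10.
      * rewrite HJ by lia. exact JE.
    + exact B.
    + split; [exact A | split; [reflexivity | split; [exact H10 | intros z Hz; lia]]].
  - simpl length. lia.
  - auto.
Qed.

(** * Recovering the order of the spine, and counting edges *)

Lemma Permutation_list_sum (l l' : list nat) : Permutation l l' -> list_sum l = list_sum l'.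
Proof. induction 1; simpl; lia. Qed.

Definition spine_around (p : list nat) (i : nat) : list nat :=
  (if i =? 0 then [] else [nth (i - 1) p 0]) ++ (if S i <? length p then [nth (S i) p 0] else []).

Lemma spine_nbrs_around (n : nat) (E : graph) (p : list nat) (i : nat) :
  spine n E p -> i < length p -> Permutation (spine_nbrs E E (nth i p 0)) (spine_around p i).
Proof.
  intros HS Hi.
  assert (I : In (nth i p 0) p) by now apply nth_In.
  apply (spine_mem HS) in I as [_ D]. unfold spine_nbrs.
  rewrite (proj2 (Nat.leb_le _ _) D). apply NoDup_Permutation.
  - apply NoDup_filter, (NoDup_nbrs n), HS.
  - unfold spine_around. destruct (Nat.eqb_spec i 0), (Nat.ltb_spec (S i) (length p)); simpl;
      repeat constructor; simpl; try tauto.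
    intros [Q | []]. apply (spine_inj n E) in Q; auto; lia.
  - intros z. rewrite filter_In, Nat.leb_le, in_nbrs. split.
    + intros [A Dz]. destruct (spine_nbr n E p i z HS Hi A) as [(H & ->) | [(H & ->) | L]].
      * unfold spine_around. destruct (Nat.eqb_spec i 0); [lia | simpl; auto].
      * unfold spine_around. apply Nat.ltb_lt in H. rewrite H. apply in_or_app. simpl. auto.
      * apply (leaf_of_deg n) in L; [lia | apply HS].
    + intros Hz. assert (Z : exists j, j < length p /\ z = nth j p 0 /\ (j = S i \/ i = S j)).
      { unfold spine_around in Hz. apply in_app_or in Hz as [Hz | Hz].
        - destruct (Nat.eqb_spec i 0); simpl in Hz; [tauto|]. exists (i - 1). intuition lia.
        - destruct (Nat.ltb_spec (S i) (length p)); simpl in Hz; [|tauto]. exists (S i). intuition. }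
      destruct Z as (j & Hj & -> & Hji). split.
      * apply (spine_adj HS); auto. lia.
      * apply (spine_mem HS). now apply nth_In.
Qed.

(** Subtracting the previous vertex from the sum of the spine neighbours yields the next one. At the
    first vertex, which has no predecessor, 0 is subtracted. *)
Lemma spine_next (n : nat) (E : graph) (p : list nat) (i : nat) :
  spine n E p -> S i < length p ->
  list_sum (spine_nbrs E E (nth i p 0)) = match i with O => 0 | S k => nth k p 0 end + nth (S i) p 0.
Proof.
  intros HS Hi. rewrite (Permutation_list_sum _ _ (spine_nbrs_around n E p i HS ltac:(lia))).
  unfold spine_around. apply Nat.ltb_lt in Hi. rewrite Hi, list_sum_app.
  destruct i as [|k]; simpl; rewrite ?Nat.sub_0_r; lia.
Qed.

(** Fewer than two spine neighbours force [y] to an end of [p]; if it is the last vertex, the list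
    is reversed. *)
Lemma spine_oriented (n : nat) (E : graph) (p : list nat) (y : nat) :
  spine n E p -> y < n -> 2 <= deg E y -> length (spine_nbrs E E y) < 2 ->
  exists q, spine n E q /\ nth 0 q 0 = y /\ length q = length p.
Proof.
  intros HS Hy D L. assert (I : In y p) by (apply (spine_mem HS); auto).
  apply (In_nth _ _ 0) in I as (i & Hi & <-).
  rewrite (Permutation_length (spine_nbrs_around n E p i HS Hi)) in L.
  unfold spine_around in L. rewrite length_app in L.
  destruct (Nat.eqb_spec i 0) as [E0 | Ni]; [rewrite E0; now exists p|].
  destruct (Nat.ltb_spec (S i) (length p)); [simpl in L; lia|].
  exists (rev p). split; [now apply spine_rev|]. split; [|apply length_rev].
  rewrite rev_nth by lia. f_equal. lia.
Qed.

Lemma spine_first_end (n : nat) (E : graph) (p : list nat) :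
  spine n E p -> 1 <= length p -> length (spine_nbrs E E (nth 0 p 0)) < 2.
Proof.
  intros HS H. rewrite (Permutation_length (spine_nbrs_around n E p 0 HS H)).
  unfold spine_around. simpl. destruct (1 <? length p); simpl; lia.
Qed.

Lemma spine_count (n : nat) (E : graph) (p : list nat) : spine n E p ->
  length (filter (fun z => 1 <? deg E z) (seq 0 n)) = length p.
Proof.
  intros HS. apply Permutation_length, NoDup_Permutation.
  - apply NoDup_filter, seq_NoDup.
  - apply HS.
  - intros z. rewrite filter_In, in_seq, Nat.ltb_lt, (spine_mem HS). lia.
Qed.

(** Two adjacent leaves would form a component of their own, out of reach of any third vertex. *)
Lemma leaf_parent (n : nat) (E : graph) (p : list nat) (v : nat) :
  spine n E p -> connected n E -> 3 <= n -> v < n -> deg E v < 2 ->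
  exists i, i < length p /\ leaf_of E v (nth i p 0).
Proof.
  intros HS HC Hn Hv D. assert (V := spine_valid HS).
  assert (D1 := spine_deg_pos HS v Hv).
  assert (U : exists u, adj E v u).
  { unfold deg in D1. destruct (nbrs E v) as [|u l] eqn:El; [simpl in D1; lia|]. exists u.
    apply adj_sym, in_nbrs. rewrite El. now left. }
  destruct U as (u & A). assert (L : leaf_of E v u) by (apply deg1_leaf_of; [lia | assumption]).
  destruct (adj_valid n E _ _ V A) as (_ & Hu & Huv).
  destruct (le_lt_dec 2 (deg E u)) as [Du | Du].
  - assert (I : In u p) by (apply (spine_mem HS); auto).
    apply (In_nth _ _ 0) in I as (i & Hi & <-). now exists i.
  - exfalso. assert (Lu : leaf_of E u v).
    { apply deg1_leaf_of; [|now apply adj_sym]. generalize (spine_deg_pos HS u Hu). lia. }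
    assert (W : forall l x, (x = u \/ x = v) -> walk_from E x l -> last l x = u \/ last l x = v).
    { induction l as [|y l IH]; intros x Hx Hw; [exact Hx|]. destruct Hw as [Hy Hw].
      assert (Hy' : y = u \/ y = v) by (destruct Hx as [-> | ->]; [right; now apply Lu | left; now apply L]).
      specialize (IH y Hy' Hw). destruct l as [|a l]; [exact Hy'|].
      assert (LD : forall (l : list nat) a d d', last (a :: l) d = last (a :: l) d').
      { clear. induction l as [|b l IH]; intros a d d'; [reflexivity | apply (IH b)]. }
      change (last (y :: a :: l) x) with (last (a :: l) x). now rewrite (LD l a x y). }
    assert (X : exists x, x < n /\ x <> u /\ x <> v).
    { destruct (Nat.eq_dec u 0), (Nat.eq_dec v 0), (Nat.eq_dec u 1), (Nat.eq_dec v 1);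
        try lia; ((exists 0; lia) || (exists 1; lia) || (exists 2; lia)). }
    destruct X as (x & Hx & Nu & Nv). destruct (HC v x Hv Hx) as (l & Hw & Hl).
    destruct (W l v (or_intror eq_refl) Hw); congruence.
Qed.

(** The loops run over edges while the time bound is in n. Every edge joins a leaf to its neighbour
    or two consecutive spine vertices, and listing these pairs in both orientations gives at most 4
    n. *)
Lemma edge_bound (n : nat) (E : graph) (p : list nat) : spine n E p -> length E <= 4 * n.
Proof.
  intros HS. assert (V := spine_valid HS).
  set (C := flat_map (fun z => [(z, hd 0 (nbrs E z)); (hd 0 (nbrs E z), z)]) (seq 0 n) ++
    flat_map (fun i => [(nth i p 0, nth (S i) p 0); (nth (S i) p 0, nth i p 0)]) (seq 0 (length p))).
  assert (LK : forall (A : Type) (f : nat -> A) (g : nat -> A) k s,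
    length (flat_map (fun i => [f i; g i]) (seq s k)) = 2 * k).
  { intros A f g k. induction k as [|k IH]; intros s; simpl; [reflexivity | rewrite IH; lia]. }
  assert (LC : length C = 2 * n + 2 * length p) by (unfold C; rewrite length_app, !LK; reflexivity).
  assert (LP : length p <= n).
  { rewrite <- (length_seq n 0). apply NoDup_incl_length; [apply HS|].
    intros v Hv. apply (spine_mem HS) in Hv. apply in_seq. lia. }
  enough (length E <= length C) by lia.
  apply NoDup_incl_length; [apply V|].
  assert (LF : forall z u, z < n -> adj E z u -> deg E z < 2 -> hd 0 (nbrs E z) = u).
  { intros z u Hz A D. apply adj_sym, in_nbrs in A. unfold deg in D.
    destruct (nbrs E z) as [|a [|]]; simpl in *; try lia; intuition. }
  intros [u v] He. assert (A : adj E u v) by now left.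
  destruct (adj_valid n E _ _ V A) as (Hu & Hv & _). unfold C. apply in_or_app.
  destruct (le_lt_dec 2 (deg E u)) as [Du | Du]; [destruct (le_lt_dec 2 (deg E v)) as [Dv | Dv]|].
  - right. assert (Iu : In u p) by (apply (spine_mem HS); auto).
    assert (Iv : In v p) by (apply (spine_mem HS); auto).
    apply (In_nth _ _ 0) in Iu as (i & Hi & <-). apply (In_nth _ _ 0) in Iv as (j & Hj & <-).
    apply (spine_adj HS) in A; auto. apply in_flat_map. destruct A as [-> | ->].
    + exists i. split; [apply in_seq; lia | simpl; auto].
    + exists j. split; [apply in_seq; lia | simpl; auto].
  - left. apply in_flat_map. exists v. split; [apply in_seq; lia|].
    rewrite (LF v u Hv (adj_sym _ _ _ A) Dv). simpl; auto.
  - left. apply in_flat_map. exists u. split; [apply in_seq; lia|].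
    rewrite (LF u v Hu A Du). simpl; auto.
Qed.

(** * The walk along the spine *)

Definition angle_step (n : nat) : R := (1 / (10 * INR n))%R.

Definition slot_pos (n : nat) (E : graph) (p : list nat) (s : slot) : R * R :=
  place (angle_step n) (phase E p) s.

Definition table (n : nat) (E : graph) (p : list nat) (L : list slot) (R : nat -> R) : Prop :=
  forall k, k < length L -> R (66 + 4 * k) = fst (slot_pos n E p (nth k L (SV 0))) /\
    R (67 + 4 * k) = snd (slot_pos n E p (nth k L (SV 0))).

Definition slots_upto (E : graph) (p : list nat) (i : nat) : list slot :=
  flat_map (slots E p) (seq 0 i).

Definition verdict (E : graph) (p : list nat) (i : nat) (z : Z) : Prop :=
  (z = 1%Z /\ forall k, k < i -> fits E p k) \/ (z = 0%Z /\ ~ forall k, k < i -> fits E p k).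

Definition prev_vertex (p : list nat) (i : nat) : nat := match i with O => 0 | S k => nth k p 0 end.

(* Intermediate state while the [i]-th spine vertex is processed: [j] is the index of the current
   point in registers 2 and 3, the positions of the first [a] spine vertices and the table pointers
   of the first [b] ones are stored, [c] of them have been checked, [f] is the phase flag and [L] is
   the list of the slots written so far. *)
Record walking (n : nat) (E : graph) (p : list nat) (i j a b c : nat) (f : bool)
    (L : list slot) (I : nat -> Z) (R : nat -> R) : Prop := {
  w_base : base n (length E) I;
  w_arrays : arrays E I;
  w_len : I 10 = Z.of_nat (length p);
  w_cur : i < length p -> I 11 = Z.of_nat (nth i p 0) /\ I 12 = Z.of_nat (prev_vertex p i);
  w_flag : I 13 = Z.b2z f;
  w_index : I 14 = Z.of_nat i;
  w_ptr : I 15 = Z.of_nat (66 + 4 * length L);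
  w_start : I 16 = Z.of_nat (66 + 4 * length (slots_upto E p i));
  w_verdict : verdict E p c (I 17);
  w_angle : R 1 = (INR j * angle_step n)%R;
  w_x : R 2 = fst (Vpos (angle_step n) j);
  w_y : R 3 = snd (Vpos (angle_step n) j);
  w_step : R 4 = angle_step n;
  w_notch1 : R 7 = notch (angle_step n) true;
  w_notch0 : R 8 = notch (angle_step n) false;
  w_height : R 9 = height (angle_step n);
  w_table : table n E p L R;
  w_staged : forall k, k < a -> R (64 + 4 * nth k p 0) = fst (slot_pos n E p (SV (S k))) /\
    R (65 + 4 * nth k p 0) = snd (slot_pos n E p (SV (S k)));
  w_tables : forall k, k < b ->
    I (adr (length E) (nth k p 0) 4) = Z.of_nat (66 + 4 * length (slots_upto E p k))
}.

Arguments w_angle {n E p i j a b c f L I R}.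
Arguments w_arrays {n E p i j a b c f L I R}.
Arguments w_base {n E p i j a b c f L I R}.
Arguments w_cur {n E p i j a b c f L I R}.
Arguments w_flag {n E p i j a b c f L I R}.
Arguments w_height {n E p i j a b c f L I R}.
Arguments w_index {n E p i j a b c f L I R}.
Arguments w_len {n E p i j a b c f L I R}.
Arguments w_notch0 {n E p i j a b c f L I R}.
Arguments w_notch1 {n E p i j a b c f L I R}.
Arguments w_step {n E p i j a b c f L I R}.
Arguments w_verdict {n E p i j a b c f L I R}.
Arguments w_x {n E p i j a b c f L I R}.
Arguments w_y {n E p i j a b c f L I R}.

Definition trig (n j : nat) (R : nat -> R) : Prop :=
  R 10 = cos (INR j * angle_step n) /\ R 11 = sin (INR j * angle_step n).

Lemma walking_frame n E p i j a b c f L I R J S :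
  1 <= length E ->
  (forall r, r <> 8 -> r <> 9 -> r <> 18 -> r <> 19 -> J r = I r) ->
  (forall r, 1 <= r <= 9 \/ 64 <= r -> S r = R r) ->
  walking n E p i j a b c f L I R -> walking n E p i j a b c f L J S.
Proof.
  intros Hm HJ HS [B A HL HC Hf Hi Hp Ht Hv Ha Hx Hy Hst H1 H0 Hh HT Hstg Htb].
  split; rewrite ?HJ, ?HS by lia; auto.
  - apply base_frame with I; auto. intros r Hr. apply HJ; lia.
  - apply arrays_frame with I; auto. intros z g Hg. apply HJ; unfold adr; lia.
  - intros k Hk. rewrite !HS by lia. now apply HT.
  - intros k Hk. rewrite !HS by lia. now apply Hstg.
  - intros k Hk. rewrite HJ by adr_lia. now apply Htb.
Qed.

Lemma run_emit n E p i j a b c f L I R x y s :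
  1 <= length E -> walking n E p i j a b c f L I R -> x < 64 -> y < 64 ->
  R x = fst (slot_pos n E p s) -> R y = snd (slot_pos n E p s) ->
  exists J S, run (emit x y) (I, R) = (J, S) /\
    walking n E p i j a b c f (L ++ [s]) J S /\ forall r, r < 64 -> S r = R r.
Proof.
  intros Hm [B A HL HC Hf Hi Hp Ht Hv Ha Hx Hy Hst H1 H0 Hh HT Hstg Htb] Lx Ly Ex Ey.
  destruct B as (B0 & B2 & B3).
  set (q := 66 + 4 * length L) in *.
  unfold emit. exec1. rewrite Hp, Nat2Z.id. exec1. rewrite Hp, B2. exec1.
  replace (Z.to_nat (Z.of_nat q + 1)) with (S q) by lia.
  exec1. exec1.
  exec_done.
  eexists. eexists. split; [reflexivity|]. split.
  - assert (F : forall r, r <> q -> r <> S q -> upd (upd R q (R x)) (S q) (R y) r = R r)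
      by (intros; rd; reflexivity).
    split; rewrite ?F by (unfold q; lia); rd; auto.
    + repeat split; rd; assumption.
    + intros z. repeat split; rewrite !upd_other by adr_lia; apply A.
    + rewrite length_app. cbn [length]. unfold q. lia.
    + intros k Hk. rewrite length_app in Hk. cbn [length] in Hk.
      destruct (Nat.eq_dec k (length L)) as [-> | Nk].
      * rewrite nth_middle. fold q. replace (67 + 4 * length L) with (S q) by (unfold q; lia).
        rd. auto.
      * rewrite app_nth1 by lia. rewrite !F by (unfold q; lia). apply HT. lia.
    + intros k Hk. rewrite !F by (unfold q; lia). now apply Hstg.
    + intros k Hk. rewrite !upd_other by adr_lia. now apply Htb.
  - intros r Hr. rewrite !upd_other by (unfold q; lia). reflexivity.
Qed.

Lemma run_emit_notch n E p i j a b c f L I R r :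
  1 <= length E -> walking n E p i j a b c f L I R -> trig n j R ->
  (r = 7 /\ phase E p j = true \/ r = 8 /\ phase E p j = false) ->
  exists J S, run (emit_notch r) (I, R) = (J, S) /\
    walking n E p i j a b c f (L ++ [ST j]) J S /\ trig n j S.
Proof.
  intros Hm W [T1 T2] Hr. unfold emit_notch. rewrite run_app.
  assert (Hr' : R r = notch (angle_step n) (phase E p j)).
  { destruct Hr as [[-> ->] | [-> ->]]; [exact (w_notch1 W) |
      exact (w_notch0 W)]. }
  assert (Hr'' : r < 10) by lia. clear Hr.
  assert (Hh := w_height W).
  assert (Hx := w_x W). assert (Hy := w_y W).
  exec_all.
  match goal with |- context [run _ (I, ?S)] => set (S1 := S) end.
  assert (F : forall k, k <> 12 -> k <> 13 -> k <> 14 -> S1 k = R k)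
    by (intros k K1 K2 K3; unfold S1; rd; reflexivity).
  destruct (run_emit n E p i j a b c f L I S1 12 13 (ST j)) as (J & S & EJ & WJ & FJ); try lia.
  - apply walking_frame with I R; auto. intros k Hk. apply F; lia.
  - unfold S1. rd. rewrite Hr', T1, T2, Hh, Hx. reflexivity.
  - unfold S1. rd. rewrite Hr', T1, T2, Hh, Hy. reflexivity.
  - exists J, S. split; [exact EJ | split; [exact WJ|]].
    split; rewrite FJ, F by lia; assumption.
Qed.

Lemma run_stage v u x y I R :
  v <> 8 -> v <> 9 -> x < 64 -> y < 64 -> I 2 = 1%Z -> I v = Z.of_nat u ->
  exists J, run (stage x y v) (I, R) = (J, upd (upd R (64 + 4 * u) (R x)) (65 + 4 * u) (R y)) /\
    forall r, r <> 8 -> r <> 9 -> J r = I r.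
Proof.
  intros V8 V9 Lx Ly H2 Hv. unfold stage. exec1. rewrite Hv. exec1. exec1. exec1. exec1.
  replace (Z.to_nat (Z.of_nat u + Z.of_nat u + (Z.of_nat u + Z.of_nat u) + 64)) with (64 + 4 * u) by lia.
  exec1. rewrite H2. exec1.
  replace (Z.to_nat (Z.of_nat u + Z.of_nat u + (Z.of_nat u + Z.of_nat u) + 64 + 1)) with (65 + 4 * u) by lia.

  exec_done.
  eexists. split; [reflexivity|]. intros r R8 R9. rd. reflexivity.
Qed.

Definition before_first (i : nat) : list slot := if i =? 0 then [SV 0] else [].

Definition at_vertex n E p i (s : store) : Prop :=
  walking n E p i i i i i (phase E p i) (slots_upto E p i ++ before_first i) (fst s) (snd s).

Lemma step_start n E p i I R :
  spine n E p -> 1 <= length E -> i < length p -> at_vertex n E p i (I, R) ->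
  exists J S, run (field_addr 4 11 ++ [IStore 8 16; RCos 10 1; RSin 11 1]) (I, R) = (J, S) /\
    walking n E p i i i (i + 1) i (phase E p i) (slots_upto E p i ++ before_first i) J S /\ trig n i S.
Proof.
  intros HS Hm Hi W. unfold at_vertex in W. cbn [fst snd] in W. set (m := length E) in *.
  destruct W as [B A HL HC Hf Hidx Hp Ht Hv Ha Hx Hy Hst H1 H0 Hh HT Hstg Htb].
  destruct (HC Hi) as [C1 C2]. destruct B as (B0 & B2 & B3).
  rewrite run_app.
  destruct (run_field_addr m (nth i p 0) 4 11 I R) as (J & EJ & J8 & JX); auto; try lia.
  rewrite EJ. exec1. rewrite J8, Nat2Z.id, JX, Ht by lia. exec1. exec1.
  exec_done.
  eexists. eexists. split; [reflexivity|]. split.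
  - assert (F : forall r, r <> 8 -> r <> 9 -> r <> adr m (nth i p 0) 4 ->
      upd J (adr m (nth i p 0) 4) (Z.of_nat (66 + 4 * length (slots_upto E p i))) r = I r).
    { intros r R8 R9 RA. rd. now apply JX. }
    assert (LA : 64 <= adr m (nth i p 0) 4) by adr_lia.
    split; rewrite ?F by lia; rd; auto.
    + repeat split; rewrite F by lia; assumption.
    + intros z. fold m. rewrite !F by adr_lia. apply A.
    + intros k Hk. fold m. destruct (Nat.eq_dec k i) as [-> | Nk]; [rd; reflexivity|].
      assert (Nki : nth k p 0 <> nth i p 0).
      { intros Q. apply (spine_inj n E) in Q; auto; lia. }
      rewrite F by adr_lia. apply Htb. lia.
  - unfold trig. rewrite <- Ha. split; rd; reflexivity.
Qed.

(** Both notch tests at once: before moving to the vertex a disk is drawn if the phase is false,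
    afterwards ([neg]) if it is true. *)
Lemma step_notch n E p i j a b c f L r s (neg : bool) :
  1 <= length E -> walking n E p i j a b c f L (fst s) (snd s) -> trig n j (snd s) ->
  f = phase E p j -> r = (if neg then 7 else 8) ->
  does (if neg then If (TLt 13 2) skip (Block (emit_notch r)) else If (TLt 13 2) (Block (emit_notch r)) skip)
    s 15 (fun s' => walking n E p i j a b c f (L ++ if Bool.eqb f neg then [ST j] else []) (fst s') (snd s')
      /\ trig n j (snd s')).
Proof.
  intros Hm W T Hf Hr. destruct s as [I R]. cbn [fst snd] in *.
  assert (H13 := w_flag W).
  destruct (w_base W) as (_ & H2 & _).
  assert (TH : holds (TLt 13 2) (I, R) = negb f).
  { cbn [holds fst]. rewrite H13, H2. now destruct f. }
  assert (SK : f <> neg -> does skip (I, R) 13 (fun s' =>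
     walking n E p i j a b c f (L ++ if Bool.eqb f neg then [ST j] else []) (fst s') (snd s') /\ trig n j (snd s'))).
  { intros Hn. apply does_block_le; [reflexivity | simpl; lia |]. replace (Bool.eqb f neg) with false by (destruct f, neg; reflexivity || congruence).
    rewrite app_nil_r. auto. }
  assert (EM : f = neg -> does (Block (emit_notch r)) (I, R) 13 (fun s' =>
     walking n E p i j a b c f (L ++ if Bool.eqb f neg then [ST j] else []) (fst s') (snd s') /\ trig n j (snd s'))).
  { intros Hn. destruct (run_emit_notch n E p i j a b c f L I R r) as (J & S & EJ & WJ & TJ); auto.
    { destruct neg; [left | right]; split; congruence. }
    apply does_block_le; [reflexivity | simpl; lia |]. rewrite EJ. replace (Bool.eqb f neg) with true by (destruct f, neg; reflexivity || congruence). auto. }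
  destruct neg; apply (does_if _ _ _ _ 13); intros T'; rewrite TH in T'; destruct f; try discriminate;
    (apply SK; discriminate) || (apply EM; reflexivity).
Qed.

Lemma step_below n E p i f L I R :
  spine n E p -> 1 <= length E -> i < length p ->
  walking n E p i i i (i + 1) i f L I R -> trig n i R ->
  exists J S, run ([RAdd 2 2 10; RSub 3 3 11; RAdd 1 1 4; RCos 10 1; RSin 11 1] ++ stage 2 3 11 ++
         [RAdd 12 2 11; RSub 13 3 10] ++ emit 12 13 ++ get_field 0 11 18 ++ [IConst 9 4; IConst 19 5]) (I, R) = (J, S) /\
    walking n E p i (i + 1) (i + 1) (i + 1) i f (L ++ [SB (i + 1)]) J S /\ trig n (i + 1) S /\
    J 9 = 4%Z /\ J 19 = 5%Z /\ J 18 = Z.of_nat (deg E (nth i p 0)).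
Proof.
  intros HS Hm Hi W [T1 T2]. set (m := length E) in *.
  rewrite run_app.
  set (a' := (R 1%nat + R 4%nat)%R) in *.
  set (R1 := upd (upd (upd (upd (upd R 2 (R 2%nat + R 10%nat)%R) 3 (R 3%nat - R 11%nat)%R) 1 a') 10 (cos a')) 11 (sin a')).
  assert (ER1 : run [RAdd 2 2 10; RSub 3 3 11; RAdd 1 1 4; RCos 10 1; RSin 11 1] (I, R) = (I, R1)).
  { exec_all. reflexivity. }
  rewrite ER1. clear ER1.
  assert (F1 : forall r, r <> 1 -> r <> 2 -> r <> 3 -> r <> 10 -> r <> 11 -> R1 r = R r).
  { intros. unfold R1. rd. reflexivity. }
  assert (EA : a' = (INR (i + 1) * angle_step n)%R).
  { unfold a'. rewrite (w_angle W), (w_step W), plus_INR. simpl INR. ring. }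
  assert (A1 : R1 1 = (INR (i + 1) * angle_step n)%R) by (unfold R1; rd; exact EA).
  assert (A2 : R1 2 = fst (Vpos (angle_step n) (i + 1))).
  { unfold R1. rd. rewrite (w_x W), T1, Nat.add_1_r. reflexivity. }
  assert (A3 : R1 3 = snd (Vpos (angle_step n) (i + 1))).
  { unfold R1. rd. rewrite (w_y W), T2, Nat.add_1_r. reflexivity. }
  assert (A10 : R1 10 = cos (INR (i + 1) * angle_step n)) by (unfold R1; rd; now rewrite EA).
  assert (A11 : R1 11 = sin (INR (i + 1) * angle_step n)) by (unfold R1; rd; now rewrite EA).
  clearbody R1. clear EA. clear a'.
  destruct (w_cur W Hi) as [Hc _].
  destruct (w_base W) as (_ & H2 & _).
  rewrite run_app.
  destruct (run_stage 11 (nth i p 0) 2 3 I R1) as (J1 & EJ1 & FJ1); auto; try lia.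
  rewrite EJ1, run_app. clear EJ1. set (v := nth i p 0) in *.
  set (R2 := upd (upd R1 (64 + 4 * v) (R1 2)) (65 + 4 * v) (R1 3)).
  assert (F2 : forall r, r <> 64 + 4 * v -> r <> 65 + 4 * v -> R2 r = R1 r).
  { intros. unfold R2. rd. reflexivity. }
  assert (W2 : walking n E p i (i + 1) (i + 1) (i + 1) i f L J1 R2).
  { destruct W as [B A HL HC Hf Hidx Hp Ht Hv Ha Hx Hy Hst H1 H0 Hh HT Hstg Htb].
    split; rewrite ?FJ1 by lia; rewrite ?F2 by lia; rewrite ?F1 by lia; auto.
    - apply base_frame with I; auto. intros r Hr. apply FJ1; lia.
    - apply arrays_frame with I; auto. intros z g Hg. apply FJ1; unfold adr; lia.
    - intros k Hk. rewrite !F2, !F1 by lia. now apply HT.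
    - intros k Hk. destruct (Nat.eq_dec k i) as [-> | Nk].
      + fold v. unfold R2. rd. rewrite A2, A3, Nat.add_1_r. split; reflexivity.
      + assert (Nki : nth k p 0 <> v).
        { intros Q. apply (spine_inj n E) in Q; auto; lia. }
        rewrite !F2, !F1 by lia. apply Hstg. lia.
    - intros k Hk. rewrite FJ1 by adr_lia. now apply Htb. }
  assert (B10 : R2 10 = cos (INR (i + 1) * angle_step n)) by (rewrite F2 by lia; exact A10).
  assert (B11 : R2 11 = sin (INR (i + 1) * angle_step n)) by (rewrite F2 by lia; exact A11).
  assert (B2 : R2 2 = fst (Vpos (angle_step n) (i + 1))) by (rewrite F2 by lia; exact A2).
  assert (B3 : R2 3 = snd (Vpos (angle_step n) (i + 1))) by (rewrite F2 by lia; exact A3).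
  clearbody R2. exec_all. rewrite run_app.
  destruct (run_emit n E p i (i + 1) (i + 1) (i + 1) i f L J1
     (upd (upd R2 12 (R2 2%nat + R2 11%nat)%R) 13 (R2 3%nat - R2 10%nat)%R) 12 13 (SB (i + 1))) as (J3 & S3 & EJ3 & W3 & F3); try lia.
  { apply walking_frame with J1 R2; auto. intros r Hr. rd. reflexivity. }
  { rd. rewrite B2, B11. reflexivity. }
  { rd. rewrite B3, B10. reflexivity. }
  rewrite EJ3, run_app.
  destruct (w_base W3) as (_ & _ & H33).
  destruct (w_cur W3 Hi) as [Hc3 _].
  destruct (run_get_field m v 0 11 18 J3 S3) as (J4 & EJ4 & V4 & F4); auto; try lia.
  rewrite EJ4. exec_all. eexists. eexists. split; [reflexivity|]. split; [|split; [|split; [|split]]].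
  - apply walking_frame with J3 S3; auto. intros r R8 R9 R18 R19. rd. auto.
  - split; rewrite F3 by lia; rd; assumption.
  - rd. reflexivity.
  - rd. reflexivity.
  - rd. rewrite V4. apply (w_arrays W3).
Qed.

Lemma verdict_fits E p i z : verdict E p i z -> fits E p i -> verdict E p (i + 1) z.
Proof.
  intros [[H1 H2] | [H1 H2]] HF; [left | right]; split; auto.
  - intros k Hk. destruct (Nat.eq_dec k i) as [-> | ?]; [assumption | apply H2; lia].
  - intros Q. apply H2. intros k Hk. apply Q. lia.
Qed.

Lemma verdict_reject E p i : ~ fits E p i -> verdict E p (i + 1) 0.
Proof. intros H. right. split; [reflexivity|]. intros Q. apply H, Q. lia. Qed.

Lemma walking_flags n E p i j a b c c' f f' L I J R :
  1 <= length E -> (forall r, r <> 13 -> r <> 17 -> J r = I r) -> J 13 = Z.b2z f' -> verdict E p c' (J 17) ->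
  walking n E p i j a b c f L I R -> walking n E p i j a b c' f' L J R.
Proof.
  intros Hm HJ H13 H17 [B A HL HC Hf Hidx Hp Ht Hv Ha Hx Hy Hst H1 H0 Hh HT Hstg Htb].
  split; rewrite ?HJ by lia; auto.
  - apply base_frame with I; auto. intros r Hr. apply HJ; lia.
  - apply arrays_frame with I; auto. intros z g Hg. apply HJ; unfold adr; lia.
  - intros k Hk. rewrite HJ by adr_lia. now apply Htb.
Qed.

Lemma step_phase n E p i j a b L s :
  1 <= length E -> walking n E p i j a b i (phase E p i) L (fst s) (snd s) ->
  fst s 9 = 4%Z -> fst s 19 = 5%Z -> fst s 18 = Z.of_nat (deg E (nth i p 0)) ->
  does next_phase s 10 (fun s' => walking n E p i j a b (i + 1) (phase E p (i + 1)) L (fst s') (snd s') /\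
    snd s' = snd s).
Proof.
  intros Hm W H9 H19 H18. destruct s as [I R]. cbn [fst snd] in *.
  set (d := deg E (nth i p 0)) in *.
  assert (H13 := w_flag W). assert (H17 := w_verdict W).
  destruct (w_base W) as (_ & H2 & _).
  assert (PH : phase E p (i + 1) = if 4 <? d then true else if d <? 4 then false else phase E p i)
    by (rewrite Nat.add_1_r; reflexivity).
  unfold next_phase. apply (does_if _ _ _ _ 8); intros T; cbn [holds fst] in T; rewrite H9, H18, (ltb_of_nat 4) in T;
    rewrite T in PH.
  - apply (does_seq _ _ _ 7 1 (fun s => snd s = R /\ (forall r, r <> 17 -> fst s r = I r) /\
      verdict E p (i + 1) (fst s 17))).
    + apply (does_if _ _ _ _ 5); intros T1; cbn [holds fst] in T1; rewrite H19, H18, (ltb_of_nat 5) in T1.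
      * apply does_block_le; [reflexivity | simpl; lia |]. exec_all. cbn [fst snd]. split; [reflexivity | split].
        -- intros r Hr. rd. reflexivity.
        -- rd. apply verdict_reject. intros [F _]. apply Nat.ltb_lt in T1. fold d in F. lia.
      * apply (does_if _ _ _ _ 3); intros T2; cbn [holds fst] in T2; rewrite H13, H2 in T2.
        -- apply does_block_le; [reflexivity | simpl; lia |]. cbn [run fold_left fst snd]. split; [reflexivity | split; [auto|]].
           apply verdict_fits; [assumption|]. apply Nat.ltb_ge in T1. split; [exact T1|].
           intros _. now destruct (phase E p i).
        -- apply does_block_le; [reflexivity | simpl; lia |]. exec_all. cbn [fst snd]. split; [reflexivity | split].
           ++ intros r Hr. rd. reflexivity.
           ++ rd. apply verdict_reject. intros [_ F]. apply Nat.ltb_lt in T. specialize (F T).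
              now rewrite F in T2.
    + intros [J R'] (HR & HJ & HV). cbn [fst snd] in *. subst R'.
      apply (does_block [IConst 13 1]); [reflexivity|]. exec_all. cbn [fst snd]. split; [|reflexivity].
      rewrite PH. apply walking_flags with i (phase E p i) I; auto; rd; auto.
      intros r R13 R17. rd. auto.
  - apply Nat.ltb_ge in T. apply (does_if _ _ _ _ 6); intros T1; cbn [holds fst] in T1;
      rewrite H9, H18, (ltb_of_nat _ 4) in T1; rewrite T1 in PH.
    + apply does_block_le; [reflexivity | simpl; lia |]. exec_all. cbn [fst snd]. split; [|reflexivity]. rewrite PH.
      apply walking_flags with i (phase E p i) I; auto; rd; auto.
      * intros r R13 R17. rd. auto.
      * apply verdict_fits; [assumption|]. split; fold d; lia.
    + apply does_block_le; [reflexivity | simpl; lia |]. cbn [run fold_left fst snd]. split; [|reflexivity]. rewrite PH.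
      apply walking_flags with i (phase E p i) I; auto.
      apply verdict_fits; [assumption|]. split; fold d; lia.
Qed.

Lemma slots_upto_S E p i : slots_upto E p (i + 1) = slots_upto E p i ++ slots E p i.
Proof.
  unfold slots_upto. rewrite Nat.add_1_r, seq_S, flat_map_app. simpl. now rewrite app_nil_r.
Qed.

Lemma step_last n E p i I R :
  spine n E p -> 1 <= length E -> i < length p ->
  walking n E p i (i + 1) (i + 1) (i + 1) (i + 1) (phase E p (i + 1))
    ((((slots_upto E p i ++ before_first i) ++ if Bool.eqb (phase E p i) false then [ST i] else []) ++ [SB (i + 1)])
      ++ if Bool.eqb (phase E p (i + 1)) true then [ST (i + 1)] else []) I R ->
  trig n (i + 1) R ->
  exists J S, run ([RAdd 12 2 10; RSub 13 3 11] ++ emit 12 13 ++ get_field 3 11 18 ++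
     [ISub 8 18 12; IConst 9 0; IAdd 12 11 9; IAdd 11 8 9; IAdd 16 15 9; IAdd 14 14 2]) (I, R) = (J, S) /\
    at_vertex n E p (i + 1) (J, S).
Proof.
  intros HS Hm Hi W [T1 T2]. set (m := length E) in *. rewrite run_app. exec_all. rewrite run_app.
  assert (Hx := w_x W). assert (Hy := w_y W).
  match type of W with walking _ _ _ _ _ _ _ _ _ ?l _ _ => set (L := l) in W end.
  destruct (run_emit n E p i (i + 1) (i + 1) (i + 1) (i + 1) (phase E p (i + 1)) L I
     (upd (upd R 12 (R 2%nat + R 10%nat)%R) 13 (R 3%nat - R 11%nat)%R) 12 13 (SV (i + 2)))
     as (J1 & S1 & EJ1 & W1 & F1); try lia; try exact Hm.
  { apply walking_frame with I R; auto. intros r Hr. rd. reflexivity. }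
  { rd. rewrite Hx, T1. replace (i + 2) with (S (i + 1)) by lia. reflexivity. }
  { rd. rewrite Hy, T2. replace (i + 2) with (S (i + 1)) by lia. reflexivity. }
  rewrite EJ1, run_app.
  (* The next path position completes the block of [p_i], so the table is again a concatenation of
     whole blocks. *)
  assert (EL : L ++ [SV (i + 2)] = slots_upto E p (i + 1)).
  { unfold L. rewrite slots_upto_S, <- !app_assoc. f_equal. unfold slots, before_first.
    rewrite Nat.add_1_r, (Nat.add_succ_r i 1), Nat.add_1_r.
    destruct (phase E p i), (phase E p (S i)); reflexivity. }
  rewrite EL in W1. clear EL EJ1 W.
  destruct (w_base W1) as (H0 & H2 & H3).
  destruct (w_cur W1 Hi) as [Hc Hpv].
  destruct (run_get_field m (nth i p 0) 3 11 18 J1 S1) as (J2 & EJ2 & V2 & F2); auto; try lia.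
  rewrite EJ2. clear EJ2.
  destruct W1 as [B A HL HC Hf Hidx Hp Ht Hv Ha Hx1 Hy1 Hst H1' H0' Hh HT Hstg Htb].
  assert (V : J2 18 = Z.of_nat (list_sum (spine_nbrs E E (nth i p 0)))) by (rewrite V2; apply A).
  assert (BF : before_first (i + 1) = []) by (unfold before_first; destruct (Nat.eqb_spec (i + 1) 0); [lia | reflexivity]).
  exec_all. eexists. eexists. split; [reflexivity|].
  unfold at_vertex. cbn [fst snd]. rewrite BF, app_nil_r.
  match goal with |- walking _ _ _ _ _ _ _ _ _ _ ?J _ =>
    assert (FK : forall r, r <> 8 -> r <> 9 -> r <> 11 -> r <> 12 -> r <> 14 -> r <> 16 -> r <> 18 -> J r = J1 r)
      by (intros; rd; auto) end.
  split; rewrite ?FK by lia; auto.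
  - apply base_frame with J1; auto. intros r Hr. apply FK; lia.
  - apply arrays_frame with J1; auto. intros z g Hg. apply FK; unfold adr; lia.
  (* After the last vertex the subtraction has no meaning, and [w_cur] then claims nothing. *)
  - intros Hi1. rd. rewrite V, !F2, Hc, Hpv by lia.
    rewrite (spine_next n E p i HS) by lia. fold (prev_vertex p i).
    replace (prev_vertex p (i + 1)) with (nth i p 0) by (rewrite Nat.add_1_r; reflexivity).
    rewrite Nat.add_1_r. split; lia.
  - rd. rewrite !F2, Hidx, H2 by lia. lia.
  - rd. rewrite !F2, Hp by lia. lia.
  - intros k Hk. rewrite FK by adr_lia. now apply Htb.
Qed.

Lemma does_walk_step n E p i s :
  spine n E p -> 1 <= length E -> i < length p -> at_vertex n E p i s ->
  does walk_step s 97 (at_vertex n E p (i + 1)).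
Proof.
  intros HS Hm Hi W. destruct s as [I R]. unfold walk_step. eapply does_weaken.
  - eapply does_seq with (Q1 := fun s => walking n E p i i i (i + 1) i (phase E p i)
      (slots_upto E p i ++ before_first i) (fst s) (snd s) /\ trig n i (snd s)).
    { apply does_block; [reflexivity|]. destruct (step_start n E p i I R) as (J & S & -> & H); auto. }
    intros s1 [W1 T1]. eapply does_seq.
    { apply (step_notch n E p i i i (i + 1) i (phase E p i) _ 8 s1 false Hm W1 T1); reflexivity. }
    intros [I2 R2] [W2 T2]. cbn [fst snd] in *. eapply does_seq.
    { apply does_block; [reflexivity|].
      destruct (step_below n E p i _ _ I2 R2 HS Hm Hi W2 T2) as (J & S & EJ & H). rewrite EJ.
      instantiate (1 := fun s => walking n E p i (i + 1) (i + 1) (i + 1) i (phase E p i)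
        (((slots_upto E p i ++ before_first i) ++ if Bool.eqb (phase E p i) false then [ST i] else []) ++ [SB (i + 1)])
        (fst s) (snd s) /\ trig n (i + 1) (snd s) /\ fst s 9 = 4%Z /\ fst s 19 = 5%Z /\
        fst s 18 = Z.of_nat (deg E (nth i p 0))).
      exact H. }
    intros s3 (W3 & T3 & A9 & A19 & A18). eapply does_seq.
    { apply (step_phase n E p i _ _ _ _ s3 Hm W3 A9 A19 A18). }
    intros s4 (W4 & T4). rewrite <- T4 in T3. eapply does_seq.
    { apply (step_notch n E p i (i + 1) _ _ _ _ _ 7 s4 true Hm W4 T3); reflexivity. }
    intros [I5 R5] [W5 T5]. cbn [fst snd] in *.
    apply does_block; [reflexivity|].
    destruct (step_last n E p i I5 R5 HS Hm Hi W5 T5) as (J & S & -> & H). exact H.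
  - simpl length. lia.
  - auto.
Qed.

Lemma does_walk_spine n E p I :
  spine n E p -> 1 <= n -> 1 <= length E -> base n (length E) I -> arrays E I ->
  I 10 = Z.of_nat (length p) -> (1 <= length p -> I 11 = Z.of_nat (nth 0 p 0)) ->
  does walk_spine (I, fun _ => 0%R) (length p * 99 + 22) (at_vertex n E p (length p)).
Proof.
  intros HS Hn Hm HB HA H10 H11. unfold walk_spine. eapply does_weaken.
  - eapply does_seq with (Q1 := at_vertex n E p 0).
    { apply does_block; [reflexivity|]. unfold init_walk. exec_all.
      assert (Hn' : (1 <= INR n)%R) by (apply (le_INR 1); lia).
      assert (EW : (1 / 1 / (10 / 1 * IZR (I 0%nat)) = angle_step n)%R).
      { destruct HB as (-> & _). rewrite <- INR_IZR_INZ. unfold angle_step. field. lra. }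
      unfold at_vertex. cbn [fst snd]. rewrite EW.
      assert (EN : (1 / 2 - angle_step n * (1 / 8))%R = notch (angle_step n) true) by (unfold notch; field).
      split; rd; auto.
      - apply arrays_frame with I; auto. intros z g Hg. rewrite !upd_other by adr_lia. reflexivity.
      - left. split; [reflexivity|]. intros k Hk. lia.
      - simpl INR. ring.
      - unfold notch. field.
      - unfold height. f_equal. field.
      - intros k Hk. simpl in Hk. assert (k = 0) by lia. subst k. rd. simpl. split; reflexivity.
      - intros k Hk. lia.
      - intros k Hk. lia. }
    intros s W.
    apply (does_while 14 10 walk_step 97 (length p) (at_vertex n E p)); [| |exact W].
    + intros j s' Hj W'. cbn [holds]. unfold at_vertex in W'.
      rewrite (w_index W'), (w_len W'). apply ltb_of_nat.
    + intros j s' Hj W'. replace (S j) with (j + 1) by lia. now apply does_walk_step.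
  - simpl length. lia.
  - auto.
Qed.

(** * Placing the leaves and writing the output *)

Lemma nth_slots_upto E p i K r : i < K -> r < length (slots E p i) ->
  length (slots_upto E p i) + r < length (slots_upto E p K) /\
  nth (length (slots_upto E p i) + r) (slots_upto E p K) (SV 0) = nth r (slots E p i) (SV 0).
Proof.
  intros Hi Hr. replace K with (i + S (K - S i)) by lia.
  unfold slots_upto at 2 4. rewrite seq_app, flat_map_app. simpl. fold (slots_upto E p i).
  rewrite !length_app. split; [lia|].
  rewrite app_nth2_plus. now apply app_nth1.
Qed.

Lemma leaves_below_S E j u :
  length (leaves_below E (S j) u) =
  length (leaves_below E j u) + (if (deg E j <? 2) && (par E j =? u) then 1 else 0).
Proof.
  unfold leaves_below. rewrite seq_S, filter_app, length_app. simpl.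
  now destruct ((deg E j <? 2) && (par E j =? u)).
Qed.

(** The claim about leaves is restricted to ranks within their block: in a rejected caterpillar a
    pointer may run past the slots of its vertex. *)
Definition leaves_placed n E p z j (I : nat -> Z) (R : nat -> R) : Prop :=
  arrays E I /\ I 17 = z /\
  (forall i, i < length p -> I (adr (length E) (nth i p 0) 4) =
     Z.of_nat (66 + 4 * (length (slots_upto E p i) + length (leaves_below E j (nth i p 0))))) /\
  table n E p (slots_upto E p (length p)) R /\
  (forall i, i < length p -> R (64 + 4 * nth i p 0) = fst (slot_pos n E p (SV (S i))) /\
     R (65 + 4 * nth i p 0) = snd (slot_pos n E p (SV (S i)))) /\
  (forall v i, v < j -> i < length p -> leaf_of E v (nth i p 0) -> rank E v < length (slots E p i) ->
     R (64 + 4 * v) = fst (slot_pos n E p (nth (rank E v) (slots E p i) (SV 0))) /\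
     R (65 + 4 * v) = snd (slot_pos n E p (nth (rank E v) (slots E p i) (SV 0)))).

Lemma does_place_leaves n E p s :
  spine n E p -> 1 <= length E ->
  (forall v, v < n -> deg E v < 2 -> exists i, i < length p /\ leaf_of E v (nth i p 0)) ->
  at_vertex n E p (length p) s ->
  does place_leaves s (n * 43 + 3) (fun s' => base n (length E) (fst s') /\
    leaves_placed n E p (fst s 17) n (fst s') (snd s')).
Proof.
  intros HS Hm HL W. destruct s as [I0 R0]. unfold at_vertex in W. cbn [fst snd] in *.
  assert (V := spine_valid HS). set (m := length E) in *.
  unfold place_leaves. apply (does_vertex_loop n m _ 40 (leaves_placed n E p (I0 17))).
  - intros j I R Hj B H6 (A & H17 & HT & Htab & Hsp & Hlf). destruct (B) as (B0 & B2 & B3).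
    destruct (run_get_field m j 0 6 18 I R) as (J1 & EJ1 & V1 & F1); auto; try lia.
    set (J2 := upd J1 9 2%Z).
    assert (F2 : forall x, x <> 8 -> x <> 9 -> x <> 18 -> J2 x = I x) by (intros; unfold J2; rd; auto).
    assert (G9 : J2 9 = 2%Z) by (unfold J2; rd; reflexivity).
    assert (G18 : J2 18 = Z.of_nat (deg E j)).
    { unfold J2; rd. rewrite V1. apply A. }
    eapply does_weaken.
    + eapply does_seq with (t1 := 8) (Q1 := fun s => s = (J2, R)).
      { apply does_block; [reflexivity|]. rewrite run_app, EJ1. exec_all. reflexivity. }
      intros s ->. clearbody J2. clear EJ1 V1 F1 J1.
      instantiate (1 := fun s => base n m (fst s) /\ fst s 6 = Z.of_nat j /\
        leaves_placed n E p (I0 17) (S j) (fst s) (snd s)).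
      apply (does_if _ _ _ _ 27); intros T; cbn [holds fst] in T; rewrite G18, G9, (ltb_of_nat _ 2) in T.
      * assert (T' := T). apply Nat.ltb_lt in T'.
        destruct (HL j Hj T') as (i & Hi & L). set (u := nth i p 0) in *.
        assert (P := leaf_of_par n E j u V L).
        assert (SU : list_sum (nbrs E j) = u).
        { generalize P (leaf_of_deg n E j u V L). unfold par, deg. clearbody u. clear.
          destruct (nbrs E j) as [|a [|]]; intros P D; try discriminate. simpl in *. lia. }
        destruct (run_get_field m j 1 6 7 J2 R) as (J3 & EJ3 & V3 & F3);
          rewrite ?F2 by lia; auto; try lia.
        destruct (run_field_addr m u 4 7 J3 R) as (J4 & EJ4 & V4 & F4); try lia.
        { rewrite F3, F2 by lia. exact B3. }
        { rewrite V3, F2 by adr_lia. rewrite <- SU. apply A. }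
        assert (F : forall x, x <> 7 -> x <> 8 -> x <> 9 -> x <> 18 -> J4 x = I x)
          by (intros; rewrite F4, F3, F2; auto).
        set (k := length (slots_upto E p i) + length (leaves_below E j u)) in *.
        assert (LA : 64 <= adr m u 4) by adr_lia.
        assert (HTu : J4 (adr m u 4) = Z.of_nat (66 + 4 * k)).
        { rewrite F by lia. exact (HT i Hi). }
        set (J5 := upd (upd (upd (upd (upd J4 18 (Z.of_nat (66 + 4 * k))) 9 4%Z) 19 (Z.of_nat (66 + 4 * k) + 4)%Z)
          (adr m u 4) (Z.of_nat (66 + 4 * k) + 4)%Z) 18 (Z.of_nat (66 + 4 * k) + 1)%Z).
        set (R5 := upd (upd R 12 (R (66 + 4 * k))) 13 (R (67 + 4 * k))).
        assert (E5 : run [ILoad 18 8; IConst 9 4; IAdd 19 18 9; IStore 8 19; RLoad 12 18; IAdd 18 18 2; RLoad 13 18]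
            (J4, R) = (J5, R5)).
        { exec1. rewrite V4, Nat2Z.id, HTu. exec1. exec1. exec1. rewrite V4, Nat2Z.id. exec1. rewrite Nat2Z.id.
          exec1. rewrite (F 2), B2 by lia. exec1.
          replace (Z.to_nat (Z.of_nat (66 + 4 * k) + 1)) with (67 + 4 * k) by lia. rd. reflexivity. }
        assert (F5 : forall x, x <> 7 -> x <> 8 -> x <> 9 -> x <> 18 -> x <> 19 -> x <> adr m u 4 -> J5 x = I x).
        { intros. unfold J5. rd. apply F; auto. }
        destruct (run_stage 6 j 12 13 J5 R5) as (J6 & E6 & F6); try lia.
        { rewrite F5 by lia. exact B2. }
        { rewrite F5 by lia. exact H6. }
        assert (F7 : forall x, x <> 7 -> x <> 8 -> x <> 9 -> x <> 18 -> x <> 19 -> x <> adr m u 4 -> J6 x = I x).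
        { intros. rewrite F6, F5; auto. }
        apply does_block; [reflexivity|]. rewrite !run_app, EJ3, EJ4, E5, E6. cbn [fst snd].
        assert (FR : forall r, 66 <= r -> r <> 64 + 4 * j -> r <> 65 + 4 * j ->
          upd (upd R5 (64 + 4 * j) (R5 12)) (65 + 4 * j) (R5 13) r = R r).
        { intros. unfold R5. rd. reflexivity. }
        assert (FR' : forall v, v <> j ->
          upd (upd R5 (64 + 4 * j) (R5 12)) (65 + 4 * j) (R5 13) (64 + 4 * v) = R (64 + 4 * v) /\
          upd (upd R5 (64 + 4 * j) (R5 12)) (65 + 4 * j) (R5 13) (65 + 4 * v) = R (65 + 4 * v)).
        { intros. unfold R5. rd. auto. }
        split; [|split; [|split; [|split; [|split; [|split; [|split]]]]]].
        -- apply base_frame with I; auto. intros r Hr. apply F7; lia.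
        -- rewrite F7 by lia. exact H6.
        -- apply arrays_frame with I; auto. intros z f Hf. fold m. apply F7; unfold adr; lia.
        -- rewrite F7 by lia. exact H17.
        -- intros i' Hi'. fold m. rewrite leaves_below_S, T, P. cbn [andb].
           destruct (Nat.eq_dec i' i) as [-> | Ni].
           ++ fold u. rewrite Nat.eqb_refl. rewrite F6 by lia. unfold J5. rd. unfold k. lia.
           ++ assert (Nu : u <> nth i' p 0).
              { intros Q. apply (spine_inj n E) in Q; auto; lia. }
              rewrite (proj2 (Nat.eqb_neq _ _) Nu), F7 by adr_lia.
              rewrite Nat.add_0_r. now apply HT.
        -- intros q Hq. rewrite !FR by lia. now apply Htab.
        -- intros i' Hi'.
           assert (Nj : nth i' p 0 <> j).
           { intros Q. apply (leaf_of_not_spine n E p j u i' HS Hi' L). auto. }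
           destruct (FR' _ Nj) as [-> ->]. now apply Hsp.
        -- intros v i' Hv Hi' Lv Hr. destruct (Nat.eq_dec v j) as [-> | Nv].
           ++ assert (i' = i).
              { apply (spine_inj n E p); auto. rewrite <- (leaf_of_par n E j _ V Lv). exact P. }
              subst i'. assert (Ek : k = length (slots_upto E p i) + rank E j).
              { unfold k, rank. now rewrite P. }
              destruct (nth_slots_upto E p i (length p) (rank E j) Hi Hr) as [N1 N2].
              rewrite <- Ek in N1, N2. destruct (Htab k N1) as [X Y]. rewrite N2 in X, Y.
              rewrite <- X, <- Y. unfold R5. rd. auto.
           ++ destruct (FR' _ Nv) as [-> ->]. apply Hlf; auto. lia.
      * apply does_block_le; [reflexivity | simpl; lia |]. cbn [run fold_left fst snd].
        split; [|split; [|split; [|split; [|split; [|split; [|split]]]]]].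
        -- apply base_frame with I; auto. intros r Hr. apply F2; lia.
        -- rewrite F2 by lia. exact H6.
        -- apply arrays_frame with I; auto. intros z f Hf. fold m. apply F2; unfold adr; lia.
        -- rewrite F2 by lia. exact H17.
        -- intros i' Hi'. fold m. rewrite leaves_below_S, T. cbn [andb].
           rewrite F2, Nat.add_0_r by adr_lia. now apply HT.
        -- exact Htab.
        -- exact Hsp.
        -- intros v i' Hv Hi' Lv Hr. apply Hlf; auto. apply Nat.ltb_ge in T.
           destruct (Nat.eq_dec v j) as [-> | Nv]; [|lia].
           apply (leaf_of_deg n) in Lv; [lia | assumption].
    + lia.
    + auto.
  - intros j I J R HJ (A & H17 & HT & Htab & Hsp & Hlf).
    split; [|split; [|split; [|split; [|split]]]]; auto.
    + apply arrays_frame with I; auto. intros z f Hf. fold m. apply HJ. unfold adr. lia.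
    + rewrite HJ by lia. exact H17.
    + intros i Hi. fold m. rewrite HJ by adr_lia. now apply HT.
  - apply W.
  - destruct W as [B A HLen HC Hf Hidx Hp Ht Hv Ha Hx Hy Hst H1 H0 Hh Htab Hstg Htb].
    assert (ET : table n E p (slots_upto E p (length p)) R0).
    { intros k Hk. destruct (Htab k) as [X Y]; [rewrite length_app; lia|].
      rewrite app_nth1 in X, Y by assumption. auto. }
    split; [|split; [|split; [|split; [|split]]]]; auto.
    + intros i Hi. rewrite Htb by assumption. unfold leaves_below. cbn [seq filter length].
      now rewrite Nat.add_0_r.
    + intros v i Lt. lia.
Qed.

Lemma does_output n m z I R :
  base n m I -> I 17 = z ->
  does output (I, R) (n * 11 + 9) (fun s => fst s 0 = z /\ snd s 0 = (1 / 2)%R /\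
    forall v, v < n -> snd s (1 + 2 * v) = R (64 + 4 * v) /\ snd s (2 + 2 * v) = R (65 + 4 * v)).
Proof.
  intros (B0 & B2 & B3) H17. unfold output. eapply does_weaken.
  - eapply does_seq with (Q1 := fun s => fst s 0 = Z.of_nat n /\ fst s 2 = 1%Z /\ fst s 17 = z /\
      fst s 6 = 0%Z /\ fst s 4 = 64%Z /\ fst s 5 = 1%Z /\ fst s 9 = 3%Z /\ snd s = R).
    { apply does_block; [reflexivity|]. exec_all. cbn [fst snd]. repeat split; rd; auto. }
    intros [I1 R1] (A0 & A2 & A17 & A6 & A4 & A5 & A9 & HR). cbn [fst snd] in *. subst R1.
    eapply does_seq.
    (* Moving in increasing order is safe: the cells 1 + 2j and 2 + 2j lie below 64 + 4(j + 1),
       where the positions not yet read begin. *)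
    { apply (does_while 6 0 _ 9 n (fun j s => fst s 0 = Z.of_nat n /\ fst s 2 = 1%Z /\ fst s 17 = z /\
        fst s 6 = Z.of_nat j /\ fst s 4 = Z.of_nat (64 + 4 * j) /\ fst s 5 = Z.of_nat (1 + 2 * j) /\
        fst s 9 = 3%Z /\
        (forall v, v < j -> snd s (1 + 2 * v) = R (64 + 4 * v) /\ snd s (2 + 2 * v) = R (65 + 4 * v)) /\
        forall v, j <= v -> snd s (64 + 4 * v) = R (64 + 4 * v) /\ snd s (65 + 4 * v) = R (65 + 4 * v))).
      - intros j s Hj (C0 & _ & _ & C6 & _). cbn [holds]. now rewrite C0, C6, ltb_of_nat.
      - intros j [J S] Hj (C0 & C2 & C17 & C6 & C4 & C5 & C9 & CD & CS). cbn [fst snd] in *.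
        apply does_block; [reflexivity|].
        exec1. rewrite C4, Nat2Z.id. exec1. rewrite C5, Nat2Z.id. exec1. rewrite C4, C2.
        exec1. rewrite C5, C2. exec1.
        replace (Z.to_nat (Z.of_nat (64 + 4 * j) + 1)) with (65 + 4 * j) by lia.
        replace (Z.to_nat (Z.of_nat (64 + 4 * j) + 1)) with (65 + 4 * j) by lia. rd.
        exec1. replace (Z.to_nat (Z.of_nat (1 + 2 * j) + 1)) with (2 + 2 * j) by lia. rd.
        exec1. rewrite C9. exec1. rewrite C2. exec1. rewrite C6, C2.
        exec_done. cbn [fst snd].
        destruct (CS j (le_n _)) as [X Y].
        split; [|split; [|split; [|split; [|split; [|split; [|split; [|split]]]]]]]; rd; auto; try lia.
        + intros v Hv. destruct (Nat.eq_dec v j) as [-> | Nv].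
          * rd. auto.
          * rd. apply CD. lia.
        + intros v Hv. rd. apply CS. lia.
      - cbn [fst snd]. repeat split; auto; intros; lia. }
    intros [I2 R2] (C0 & C2 & C17 & C6 & C4 & C5 & C9 & CD & CS). cbn [fst snd] in *.
    apply does_block; [reflexivity|]. exec_all.
    instantiate (1 := fun s => fst s 0 = z /\ snd s 0 = (1 / 2)%R /\
      forall v, v < n -> snd s (1 + 2 * v) = R (64 + 4 * v) /\ snd s (2 + 2 * v) = R (65 + 4 * v)).
    cbn [fst snd]. split; [rd; lia | split; [rd; reflexivity|]].
    intros v Hv. rd. now apply CD.
  - simpl length. lia.
  - auto.
Qed.

(** * Correctness and running time of the whole program *)

Definition laid_out n E (s : store) : Prop :=
  exists q, spine n E q /\ verdict E q (length q) (fst s 0) /\ snd s 0 = (1 / 2)%R /\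
    ((forall i, i < length q -> fits E q i) -> forall v, v < n -> exists sl, placed E q v sl /\
      (snd s (1 + 2 * v), snd s (2 + 2 * v)) = slot_pos n E q sl).

Lemma does_large n E p I :
  spine n E p -> connected n E -> 3 <= n -> 1 <= length E -> ctx n E I ->
  (forall a, 64 * length E <= a -> I a = 0%Z) ->
  does large (I, fun _ => 0%R) (100 * length E + 200 * n + 100) (laid_out n E).
Proof.
  intros HS HC Hn Hm HI HZ. assert (V := spine_valid HS).
  assert (LP := fun v Hv D => leaf_parent n E p v HS HC Hn Hv D).
  assert (Hp : 1 <= length p).
  { destruct (le_lt_dec 2 (deg E 0)) as [D | D].
    - assert (I0 : In 0 p) by (apply (spine_mem HS); lia). destruct p; [destruct I0 | simpl; lia].
    - destruct (LP 0 ltac:(lia) D) as (i & Hi & _). lia. }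
  unfold large. eapply does_weaken.
  - eapply does_seq; [apply (does_count_nbrs n E I _ V Hm HI HZ)|].
    intros [I1 R1] (C1 & HR1 & A1). cbn [fst snd] in *. subst R1.
    eapply does_seq; [apply (does_count_spine_nbrs n E I1 _ V Hm C1 A1)|].
    intros [I2 R2] (C2 & HR2 & A2). cbn [fst snd] in *. subst R2.
    assert (B2 : base n (length E) I2) by (destruct C2 as (H0 & _ & H2 & H3 & _); repeat split; assumption).
    eapply does_seq; [apply (does_find_end n E I2 _ Hm B2 A2)|].
    intros [I3 R3] (B3 & A3 & HR3 & H10 & H11). cbn [fst snd] in *. subst R3.
    rewrite (spine_count n E p HS) in H10.
    assert (Hin : In (nth 0 p 0) p) by (apply nth_In; lia).
    apply (spine_mem HS) in Hin as [Hin1 Hin2].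
    destruct (H11 (nth 0 p 0) Hin1 Hin2 (spine_first_end n E p HS Hp)) as (y & Hy & Dy & Ly & Ey).
    (* From here on the spine is [q], that is [p] or its reverse, whichever starts at the end
       found. *)
    destruct (spine_oriented n E p y HS Hy Dy Ly) as (q & HQ & Q0 & QL).
    rewrite <- QL in H10, Hp. clear H11 LP. rewrite <- Q0 in Ey.
    assert (LQ := fun v Hv D => leaf_parent n E q v HQ HC Hn Hv D).
    assert (REST : does (Seq walk_spine (Seq place_leaves output)) (I3, fun _ => 0%R)
      (length q * 99 + 22 + (n * 43 + 3 + (n * 11 + 9))) (laid_out n E)); [|rewrite QL in REST; exact REST].
    eapply does_seq; [apply (does_walk_spine n E q I3 HQ ltac:(lia) Hm B3 A3 H10 (fun _ => Ey))|].
    intros s4 W4. assert (HV := w_verdict W4).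
    eapply does_seq; [apply (does_place_leaves n E q s4 HQ Hm LQ W4)|].
    intros [I5 R5] (B5 & A5 & H17 & _ & _ & Hsp & Hlf). cbn [fst snd] in *.
    eapply does_weaken; [apply (does_output n (length E) (fst s4 17) I5 R5 B5 H17) | apply le_n |].
    intros s6 (Hz & HR & HO). exists q. split; [exact HQ|]. rewrite Hz. split; [exact HV|]. split; [exact HR|].
    intros HF v Hv. destruct (HO v Hv) as [-> ->].
    destruct (le_lt_dec 2 (deg E v)) as [D | D].
    + assert (Iv : In v q) by (apply (spine_mem HQ); auto).
      apply (In_nth _ _ 0) in Iv as (i & Hi & <-). exists (SV (S i)). split.
      * exists i. auto.
      * destruct (Hsp i Hi) as [-> ->]. symmetry. apply surjective_pairing.
    + destruct (LQ v Hv D) as (i & Hi & L). exists (nth (rank E v) (slots E q i) (SV 0)). split.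
      * exists i. auto.
      * destruct (rank_usable n E q i v HQ Hi (HF i Hi) Hv L) as [Hr _].
        destruct (Hlf v i Hv Hi L Hr) as [-> ->]. symmetry. apply surjective_pairing.
  - assert (QL : length p <= n) by now apply (spine_length_le n E).
    lia.
  - auto.
Qed.

Definition solved n E (s : store) : Prop :=
  let cf := at_pc (clen udc_cmd) s in
  (out_yes cf <-> UDC n E) /\ (out_yes cf -> udc_rep n E (out_radius cf) (out_center cf)).

Lemma laid_out_solved n E s : 1 <= n -> laid_out n E s -> solved n E s.
Proof.
  intros Hn (q & HQ & HV & HR & HP). unfold solved, out_yes, out_radius, at_pc. cbn [ireg rreg].
  assert (YF : fst s 0 = 1%Z -> forall i, i < length q -> fits E q i).
  { destruct HV as [[_ H] | [H _]]; [auto | rewrite H; discriminate]. }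
  assert (YR : fst s 0 = 1%Z -> udc_rep n E (snd s 0) (out_center (at_pc (clen udc_cmd) s))).
  { intros Y. rewrite HR. apply (placed_udc_rep n E q); auto. }
  split; [split|]; [| |exact YR].
  - intros Y. eexists. eexists. exact (YR Y).
  - intros U. destruct HV as [[H _] | [_ H]]; [assumption | exfalso].
    apply H. intros i Hi. now apply (UDC_fits n E q i HQ U).
Qed.

Lemma small_rep n E (R : nat -> R) : valid_input n E -> is_tree n E -> n < 3 ->
  R 1 = 0%R -> R 2 = 0%R -> R 3 = 1%R -> R 4 = 0%R ->
  udc_rep n E (1 / 2) (fun v => (R (1 + 2 * v), R (2 + 2 * v))).
Proof.
  intros V T Hn H1 H2 H3 H4. split; [lra|]. intros u v Hu Hv Huv.
  replace ((2 * (1 / 2)) ^ 2)%R with 1%R by field.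
  assert (A : adj E u v).
  { assert (D := deg_pos n E v V T ltac:(lia) Hv). unfold deg in D.
    destruct (nbrs E v) as [|w l] eqn:El; [simpl in D; lia|].
    assert (Aw : adj E w v) by (apply in_nbrs; rewrite El; now left).
    destruct (adj_valid n E w v V Aw) as (Hw & _ & Hwv). replace u with w by lia. exact Aw. }
  assert (D : sqdist (R (1 + 2 * u), R (2 + 2 * u)) (R (1 + 2 * v), R (2 + 2 * v)) = 1%R).
  { assert (C : u = 0 /\ v = 1 \/ u = 1 /\ v = 0) by lia.
    destruct C as [[-> ->] | [-> ->]]; unfold sqdist; simpl; rewrite H1, H2, H3, H4; ring. }
  rewrite D. split; [lra | tauto].
Qed.

Lemma does_small n E I : valid_input n E -> is_tree n E -> n < 3 ->
  does small (I, fun _ => 0%R) 3 (solved n E).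
Proof.
  intros V T Hn. apply (does_block [RConst 0 1 2; RConst 3 1 1; IConst 0 1]); [reflexivity|]. exec_all.
  match goal with |- solved _ _ (_, ?S) => assert (HS : udc_rep n E (1 / 2) (fun v => (S (1 + 2 * v), S (2 + 2 * v)))) end.
  { apply small_rep; auto; rd; field. }
  unfold solved, out_yes, out_radius, out_center, at_pc. cbn [ireg rreg fst snd]. rd. split.
  - split; [|reflexivity]. intros _. eexists. eexists. exact HS.
  - intros _. exact HS.
Qed.

Theorem theorem1 :
  exists (P : program) (C : nat),
    forall (n : nat) (E : list (nat * nat)),
      valid_input n E -> caterpillar n E ->
      exists (k : nat) (cf : cfg),
        (k <= C * (n + 1))%nat /\
        halts_in P k (init_cfg n E) cf /\
        (out_yes cf <-> UDC n E) /\
        (out_yes cf -> udc_rep n E (out_radius cf) (out_center cf)).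
Proof.
  (* The program takes at most 114 |E| + 200 n + 205 steps, where |E| <= 4 n. *)
  exists (compile udc_cmd 0), 1000. intros n E V HC.
  assert (T : is_tree n E) by apply HC. assert (Hn : 1 <= n) by apply T.
  (* A single vertex has degree 0 and hence admits no [spine]. *)
  assert (M : n = 1 \/ exists p, spine n E p).
  { destruct (Nat.eq_dec n 1); [now left | right]. apply caterpillar_spine; auto. lia. }
  assert (L : length E <= 4 * n).
  { destruct M as [-> | [p HS]]; [|now apply (edge_bound n E p)].
    destruct E as [|[u v] E]; [simpl; lia|]. destruct V as [_ V].
    destruct (V u v (or_introl eq_refl)) as (? & ? & ? & _). lia. }
  assert (D : does udc_cmd (ireg (init_cfg n E), fun _ => 0%R) (1000 * (n + 1)) (solved n E)).
  { unfold udc_cmd at 1. replace (1000 * (n + 1)) with (1000 * (n + 1) - 2 + 2) by lia.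
    apply does_if; intros Z; cbn [holds fst ireg init_cfg] in Z.
    - apply Z.eqb_eq in Z. eapply does_weaken; [apply (does_small n E); auto | lia | auto].
      destruct (Nat.lt_ge_cases n 3); [assumption|].
      assert (E0 : E = []) by (destruct E; [reflexivity | simpl in Z; lia]).
      assert (Dg := deg_pos n E 0 V T ltac:(lia) ltac:(lia)). rewrite E0 in Dg. cbn in Dg. lia.
    - apply Z.eqb_neq in Z. assert (Hm : 1 <= length E) by lia.
      eapply does_weaken with (Q := solved n E).
      + eapply does_seq; [apply (does_relocate n E _ Hm)|].
        intros [I R] (CI & HZ & HR). cbn [fst snd] in *. subst R.
        eapply does_seq with (t1 := 1) (Q1 := fun s => s = (upd I 8 3%Z, fun _ => 0%R)).
        { apply (does_block [IConst 8 3]); [reflexivity|]. exec_all. reflexivity. }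
        intros s ->. apply (does_if _ _ _ _ (100 * length E + 200 * n + 100)); intros T3;
          cbn [holds fst] in T3; revert T3; rd; destruct (CI) as (-> & _); rewrite (ltb_of_nat _ 3); intros T3.
        * apply Nat.ltb_lt in T3. eapply does_weaken; [apply (does_small n E); auto | lia | auto].
        * apply Nat.ltb_ge in T3. destruct M as [-> | [p HS]]; [lia|].
          eapply does_weaken; [apply (does_large n E p) | lia |]; auto.
          -- apply T.
          -- apply ctx_frame with I; auto. intros r Hr. rd. reflexivity.
          -- intros a Ha. rd. auto.
          -- intros s Hs. now apply laid_out_solved.
      + lia.
      + auto. }
  destruct D as (k & s & Hev & Hk & HQ). exists k, (at_pc (clen udc_cmd) s).
  split; [exact Hk|]. split; [|exact HQ]. exact (compile_halts udc_cmd _ s k Hev).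
Qed.
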